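(* There exists a real, even, transcendental entire map $f\colon\mathbb{C}\to\mathbb{C}$ such that: (1) $f\colon\mathbb{R}\to\mathbb{R}$ is convex; (2) $f(\mathbb{Q})\subset\mathbb{Q}$; (3) the periodic points of $f\colon f^{-1}(\mathbb{D})\cap\mathbb{D}\to\mathbb{D}$ and of $f\colon\mathbb{R}\to\mathbb{R}$ coincide and all lie in $\mathbb{Q}$, and the multipliers of $f$ at these periodic points all lie in $\mathbb{Q}$; (4) $f\colon f^{-1}(\mathbb{D})\cap\mathbb{D}\to\mathbb{D}$ is an escaping quadratic-like map that is not conjugate to an affine escaping quadratic-like map.
   Context: $\mathbb{D}$ is the open unit disk. An entire map is real if $f(\bar z)=\overline{f(z)}$ and even if $f(-z)=f(z)$. For a map $f\colon U\to V$ with $U\subseteq V$, a periodic point is a point $z\in U$ with $f^{\circ n}(z)=z$ for some $n\ge1$ and $z,f(z),\dots,f^{\circ(n-1)}(z)\in U$; the multiplier at such a point (of exact period $n$) is $(f^{\circ n})'(z)$. An escaping quadratic-like map is a holomorphic covering map $f\colon U\to V$ of degree $2$, where $U,V$ are nonempty open subsets of $\mathbb{C}$ with $U$ relatively compact in $V$ and $V$ simply connected (then $U$ has two connected components each mapped biholomorphically onto $V$). Such an $f$ is conjugate to an affine escaping quadratic-like map if there is a univalent map $\varphi\colon V\to\mathbb{C}$ such that $\varphi\circ f\circ\varphi^{-1}$ is affine on each of the two connected components of $\varphi(U)$. *)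

(* Defs.v *)
From Stdlib Require Import Reals QArith Qreals List.
From Coquelicot Require Import Coquelicot.

Open Scope R_scope.

Definition unit_disk (z : C) : Prop := Cmod z < 1.
Definition real_line (z : C) : Prop := Im z = 0.
Definition isQ (w : C) : Prop := exists q : Q, w = RtoC (Q2R q).

Definition entire (f : C -> C) : Prop := forall z : C, ex_derive (K:=C_AbsRing) f z.
Definition real_map (f : C -> C) : Prop := forall z : C, f (Cconj z) = Cconj (f z).
Definition even_map (f : C -> C) : Prop := forall z : C, f (Copp z) = f z.
Definition polynomial_fun (f : C -> C) : Prop :=
  exists (n : nat) (a : nat -> C),
    forall z : C, f z = sum_n (fun k => mult (a k) (pow_n (K:=C_Ring) z k)) n.
Definition transcendental_entire (f : C -> C) : Prop :=
  entire f /\ ~ polynomial_fun f.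

(* the restriction f : R -> R, x |-> f(x) (real-valued since f is real) *)
Definition restrR (f : C -> C) (x : R) : R := Re (f (RtoC x)).
Definition convex_on_R (g : R -> R) : Prop :=
  forall x y t : R, 0 <= t <= 1 ->
    g (t * x + (1 - t) * y) <= t * g x + (1 - t) * g y.

Definition periodic_pt (U : C -> Prop) (f : C -> C) (z : C) : Prop :=
  exists n : nat, (1 <= n)%nat /\ Nat.iter n f z = z /\
    (forall k : nat, (k < n)%nat -> U (Nat.iter k f z)).
Definition exact_period (f : C -> C) (z : C) (n : nat) : Prop :=
  (1 <= n)%nat /\ Nat.iter n f z = z /\
  (forall k : nat, (1 <= k)%nat -> (k < n)%nat -> Nat.iter k f z <> z).
Definition multiplier (f : C -> C) (z : C) (m : C) : Prop :=
  exists n : nat, exact_period f z n /\ is_derive (K:=C_AbsRing) (Nat.iter n f) z m.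

Definition subset (A B : C -> Prop) : Prop := forall z, A z -> B z.
Definition nonempty (A : C -> Prop) : Prop := exists z, A z.
Definition closure (A : C -> Prop) (z : C) : Prop :=
  forall P : C -> Prop, locally z P -> exists u, A u /\ P u.
Definition compact_set (K : C -> Prop) : Prop :=
  forall (I : Type) (O : I -> C -> Prop),
    (forall i, open (O i)) -> (forall z, K z -> exists i, O i z) ->
    exists l : list I, forall z, K z -> exists i, In i l /\ O i z.
Definition rel_compact_in (U V : C -> Prop) : Prop :=
  compact_set (closure U) /\ subset (closure U) V.
Definition connected_set (A : C -> Prop) : Prop :=
  forall O1 O2 : C -> Prop, open O1 -> open O2 ->
    (forall z, A z -> O1 z \/ O2 z) ->
    (forall z, A z -> O1 z -> O2 z -> False) ->
    (forall z, A z -> O1 z) \/ (forall z, A z -> O2 z).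
Definition same_component (A : C -> Prop) (x y : C) : Prop :=
  exists B : C -> Prop, connected_set B /\ subset B A /\ B x /\ B y.

Definition unit_interval (t : R) : Prop := 0 <= t <= 1.
Definition path_in (V : C -> Prop) (g : R -> C) : Prop :=
  (forall t, unit_interval t -> filterlim g (within unit_interval (locally t)) (locally (g t)))
  /\ (forall t, unit_interval t -> V (g t)).
Definition unit_square (p : R * R) : Prop := unit_interval (fst p) /\ unit_interval (snd p).
Definition simply_connected (V : C -> Prop) : Prop :=
  nonempty V /\
  (forall x y, V x -> V y -> exists g, path_in V g /\ g 0 = x /\ g 1 = y) /\
  (forall g, path_in V g -> g 0 = g 1 ->
     exists H : R * R -> C,
       (forall p, unit_square p ->
          filterlim H (within unit_square (locally p)) (locally (H p))) /\
       (forall p, unit_square p -> V (H p)) /\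
       (forall t, unit_interval t -> H (t, 0) = g t /\ H (t, 1) = g 0) /\
       (forall s, unit_interval s -> H (0, s) = g 0 /\ H (1, s) = g 0)).

Definition homeo_onto (f : C -> C) (S W : C -> Prop) : Prop :=
  (forall z, S z -> W (f z)) /\
  (forall z, S z -> continuous f z) /\
  exists g : C -> C,
    (forall w, W w -> S (g w) /\ f (g w) = w) /\
    (forall z, S z -> g (f z) = z) /\
    (forall w, W w -> continuous g w).
Definition covering_map (U V : C -> Prop) (f : C -> C) : Prop :=
  (forall z, U z -> V (f z)) /\
  (forall z, U z -> continuous f z) /\
  forall w, V w -> exists W : C -> Prop,
    open W /\ W w /\ subset W V /\
    exists (I : Type) (S : I -> C -> Prop),
      (forall i, open (S i)) /\
      (forall z, (U z /\ W (f z)) <-> exists i, S i z) /\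
      (forall i j z, S i z -> S j z -> i = j) /\
      (forall i, homeo_onto f (S i) W).
Definition degree_two (U V : C -> Prop) (f : C -> C) : Prop :=
  forall w, V w -> exists z1 z2, z1 <> z2 /\ U z1 /\ U z2 /\ f z1 = w /\ f z2 = w /\
    forall z, U z -> f z = w -> z = z1 \/ z = z2.

Definition escaping_quadratic_like (U V : C -> Prop) (f : C -> C) : Prop :=
  nonempty U /\ nonempty V /\ open U /\ open V /\
  rel_compact_in U V /\ simply_connected V /\
  (forall z, U z -> ex_derive (K:=C_AbsRing) f z) /\
  covering_map U V f /\ degree_two U V f.

(* phi univalent on V, and phi o f o phi^-1 affine on each connected
   component of phi(U) *)
Definition univalent_on (V : C -> Prop) (phi : C -> C) : Prop :=
  (forall z, V z -> ex_derive (K:=C_AbsRing) phi z) /\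
  (forall x y, V x -> V y -> phi x = phi y -> x = y).
Definition conj_to_affine_eql (U V : C -> Prop) (f : C -> C) : Prop :=
  exists phi : C -> C, univalent_on V phi /\
    forall z0, U z0 -> exists a b : C,
      forall z, U z ->
        same_component (fun w => exists u, U u /\ w = phi u) (phi z0) (phi z) ->
        phi (f z) = Cplus (Cmult a (phi z)) b.

Definition preimage_disk_domain (f : C -> C) (z : C) : Prop :=
  unit_disk z /\ unit_disk (f z).

(* Main.v *)
(** The map is f(z) = 8 z^2 - 4 + E(z^2) with E(u) = sum e_k u^k and
    e_k in [1/64, 1/32]/k!.  For every such choice f is convex on R, transcendental,
    expands distances by 7 on each half of the domain, and |x| < f(x) for real
    |x| >= 1; so all real cycles lie in D, and cycles in D are real since they are
    determined by the sequence of signs of their real parts.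

    The e_k are fixed by successive polynomial corrections, of size 2^-m / k! at
    step m, vanishing to second order at the finitely many u = q^2 treated before.
    Hermite interpolation makes E(u), E'(u) rational at one more square, or moves
    the cycle with a given sign sequence to nearby rational points; in the limit all
    cycles are rational, and so are the multipliers because f'(Q) is in Q.

    If phi conjugates f to an affine map with slopes a, a' on the two components,
    then phi' has no zero at points of period at most 2 (its zeros would accumulate
    there along backward orbits).  Hence the fixed points p > 0 > m and the cycle
    q > 0 > r satisfy f'(p)^2 = a^2, f'(m)^2 = a'^2, f'(q) f'(r) = a a', whereas
    q < -m < -r < p and f' is increasing, so |f'(q) f'(r)| < |f'(p) f'(m)|. *)

Require Import Defs.
From Stdlib Require Import Reals QArith Qreals List.
From Coquelicot Require Import Coquelicot.
From Stdlib Require Import Factorial Lra Lia Psatz Compare_dec Classical ClassicalEpsilon Cantor.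
Open Scope R_scope.

(** The constants 8 and 4 are chosen with the bound |E| <= 1/2 on the unit disk in mind: every u in
    the disk with |8u - 4 + E(u)| <= 1 lies within 3/16 of 1/2, hence away from the critical point 0
    and from the unit circle. Corrections are measured coefficientwise against 1/k!, a scale stable
    under differentiation; the band for e_k has centre 3/128 and leaves room 1/128, which the sum of
    all corrections never exceeds. Vanishing to second order freezes the derivative together with
    the value. Since E is a function of z^2, data prescribed at x are also prescribed at -x; no
    conflict arises, because two points of one cycle with equal squares have equal images and
    therefore coincide. A conjugacy phi is only known to be complex differentiable and injective.
    The isolation of the zeros of phi' is the one place where Cauchy's theory enters, and Goursat's
    theorem is proved for that purpose; the dynamics then replaces the general fact that univalent
    maps have no critical points. *)

(** * Neighbourhoods, continuity and derivatives in [C] expressed through [Cmod] *)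

Lemma Cminus_eq_0 (x y : C) : (x - y)%C = 0 -> x = y.
Proof. intros H. replace x with ((x - y) + y)%C by ring. rewrite H. ring. Qed.

(** The balls behind [locally] on [C] are squares, those of [Cmod] are disks; the factor [sqrt 2]
    compares them. *)
Lemma locally_Cmod (z : C) (P : C -> Prop) :
  locally z P <-> exists d, 0 < d /\ forall y, Cmod (y - z) < d -> P y.
Proof.
  split.
  - intros [d Hd]. exists d. split; [apply cond_pos|].
    intros y Hy. apply Hd. apply (C_NormedModule_mixin_compat1 z y d). exact Hy.
  - intros (d & Hd & H).
    assert (H2 : 0 < sqrt 2) by (apply sqrt_lt_R0; lra).
    assert (Hd' : 0 < d / sqrt 2) by (apply Rdiv_lt_0_compat; lra).
    exists (mkposreal _ Hd'). intros y Hy. apply H.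
    apply (C_NormedModule_mixin_compat2 z y (mkposreal _ Hd')) in Hy. simpl in Hy.
    replace d with (sqrt 2 * (d / sqrt 2)) by (field; lra). exact Hy.
Qed.

Lemma continuous_C (f : C -> C) (z : C) :
  continuous f z <->
  forall eps, 0 < eps -> exists d, 0 < d /\
    forall y, Cmod (y - z) < d -> Cmod (f y - f z) < eps.
Proof.
  split.
  - intros H eps He. apply (locally_Cmod z (fun y => Cmod (f y - f z) < eps)).
    apply (H (fun w => Cmod (w - f z) < eps)). apply locally_Cmod.
    exists eps. auto.
  - intros H P HP. apply locally_Cmod in HP. destruct HP as (e & He & HP).
    destruct (H e He) as (d & Hd & H'). apply locally_Cmod. exists d. split; auto.
Qed.

(** Derivatives over [C_AbsRing] take their limits in the uniform structure of the ring, whose balls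
    are disks; so a second translation is needed beside [locally_Cmod]. *)
Lemma locally_C_AbsRing (z : C) (P : C -> Prop) :
  locally (T := AbsRing_UniformSpace C_AbsRing) z P <->
  exists d, 0 < d /\ forall y, Cmod (y - z) < d -> P y.
Proof.
  split.
  - intros [d Hd]. exists d. split; [apply cond_pos|]. exact Hd.
  - intros (d & Hd & H). exists (mkposreal d Hd). exact H.
Qed.

Notation isdC := (@is_derive C_AbsRing C_NormedModule).

Lemma is_derive_C (f : C -> C) (z l : C) :
  isdC f z l <->
  forall eps, 0 < eps -> exists d, 0 < d /\
    forall y, Cmod (y - z) < d ->
      Cmod (f y - f z - l * (y - z)) <= eps * Cmod (y - z).
Proof.
  split.
  - intros [_ H] eps He.
    specialize (H z (fun P HP => HP) (mkposreal eps He)).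
    apply (proj1 (locally_C_AbsRing z _)) in H. destruct H as (d & Hd & H). exists d. split; auto.
    intros y Hy. specialize (H y Hy). simpl in H.
    rewrite (Cmult_comm l). exact H.
  - intros H. split. apply is_linear_scal_l.
    intros x Hx. assert (Hxz : z = x).
    { apply (@is_filter_lim_locally_unique C_AbsRing (AbsRing_NormedModule C_AbsRing) z x Hx). }
    subst x.
    intros [eps He]. destruct (H eps He) as (d & Hd & H').
    apply (proj2 (locally_C_AbsRing z _)). exists d. split; auto. intros y Hy. specialize (H' y Hy).
    simpl. rewrite (Cmult_comm l) in H'. exact H'.
Qed.

Lemma derive_continuous_C (f : C -> C) (z l : C) :
  isdC f z l -> continuous f z.
Proof.
  intros H. apply continuous_C. intros e He.
  destruct (proj1 (is_derive_C f z l) H 1 Rlt_0_1) as (d & Hd & H').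
  assert (Hp : 0 < 1 + Cmod l) by (pose proof (Cmod_ge_0 l); lra).
  exists (Rmin d (e / (1 + Cmod l))). split.
  { apply Rmin_pos; [exact Hd|]. apply Rdiv_lt_0_compat; lra. }
  intros y Hy. specialize (H' y (Rlt_le_trans _ _ _ Hy (Rmin_l _ _))).
  pose proof (Rlt_le_trans _ _ _ Hy (Rmin_r _ _)) as Hy2.
  apply Rlt_div_r in Hy2; [|exact Hp].
  replace (f y - f z)%C with ((f y - f z - l * (y - z)) + l * (y - z))%C by ring.
  eapply Rle_lt_trans; [apply Cmod_triangle|]. rewrite Cmod_mult. lra.
Qed.

Lemma isdC_unique (f : C -> C) (z l1 l2 : C) :
  isdC f z l1 -> isdC f z l2 -> l1 = l2.
Proof.
  intros H1 H2. apply is_C_derive_unique in H1. apply is_C_derive_unique in H2. congruence.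
Qed.

Lemma Cmod_minus_sym (x y : C) : Cmod (x - y) = Cmod (y - x).
Proof. rewrite <- Cmod_opp. f_equal. ring. Qed.

Lemma Cmod_triangle_minus (x y z : C) : Cmod (x - z) <= Cmod (x - y) + Cmod (y - z).
Proof. replace (x - z)%C with ((x - y) + (y - z))%C by ring. apply Cmod_triangle. Qed.

Lemma Cmod_triangle_inv (x y : C) : Cmod x - Cmod y <= Cmod (x - y).
Proof.
  pose proof (Cmod_triangle (x - y) y) as H.
  replace (x - y + y)%C with x in H by ring. lra.
Qed.

Lemma Cmod_sum3 (x y z : C) : Cmod (x + y + z) <= Cmod x + Cmod y + Cmod z.
Proof.
  eapply Rle_trans; [apply Cmod_triangle|]. pose proof (Cmod_triangle x y). lra.
Qed.

Lemma Cmod_zero_le (x : C) : Cmod x <= 0 -> x = 0.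
Proof. intros H. apply Cmod_eq_0. pose proof (Cmod_ge_0 x). lra. Qed.

Lemma im_le_Cmod (z : C) : Rabs (Im z) <= Cmod z.
Proof. eapply Rle_trans; [apply Rmax_r|apply (Rmax_Cmod z)]. Qed.

Lemma Rle_eps0 (a : R) : (forall e, 0 < e -> a <= e) -> a <= 0.
Proof. intros H. destruct (Rle_or_lt a 0); auto. specialize (H (a / 2)). lra. Qed.

Lemma half_pow_pos m : 0 < (/ 2) ^ m.
Proof. apply pow_lt. lra. Qed.

Lemma half_pow_small a e : 0 <= a -> 0 < e -> exists N, (/ 2) ^ N * a < e.
Proof.
  intros Ha He. destruct (pow_lt_1_zero (/ 2) ltac:(rewrite Rabs_pos_eq; lra) (e / (a + 1))) as [N HN].
  { apply Rdiv_lt_0_compat; lra. }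
  exists N. specialize (HN N (le_n N)). pose proof (half_pow_pos N).
  rewrite Rabs_pos_eq in HN by lra. apply Rlt_div_r in HN; lra.
Qed.

(** * Contractions of closed disks *)

Lemma C_complete (u : nat -> C) :
  (forall eps, 0 < eps -> exists N, forall n m, (N <= n)%nat -> (N <= m)%nat ->
     Cmod (u n - u m) < eps) ->
  exists l : C, forall eps, 0 < eps -> exists N, forall n, (N <= n)%nat -> Cmod (u n - l) < eps.
Proof.
  intros H.
  destruct (proj1 (@filterlim_locally_cauchy nat C_CompleteNormedModule eventually _ u)) as [l Hl].
  - intros [e He]. destruct (H e He) as [N HN]. exists (fun n => (N <= n)%nat). split; [exists N; auto|].
    intros n m Hn Hm. apply (C_NormedModule_mixin_compat1 (u n) (u m)). apply (HN m n Hm Hn).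
  - exists l. intros e He. apply (Hl (fun w => Cmod (w - l) < e)). apply locally_Cmod. exists e. auto.
Qed.

Lemma contraction_fixed_point (T : C -> C) (c : C) (r : R) :
  0 <= r ->
  (forall u, Cmod (u - c) <= r -> Cmod (T u - c) <= r) ->
  (forall u v, Cmod (u - c) <= r -> Cmod (v - c) <= r -> Cmod (T u - T v) <= / 2 * Cmod (u - v)) ->
  exists u, Cmod (u - c) <= r /\ T u = u.
Proof.
  intros Hr Hin Hc.
  set (x := fun n => Nat.iter n T c).
  assert (Hx : forall n, Cmod (x n - c) <= r).
  { induction n. unfold x; simpl. replace (c - c)%C with (RtoC 0) by ring. rewrite Cmod_0; lra.
    apply Hin. exact IHn. }
  (* Starting at the centre puts every iterate within [r] of [x 0], so contracting [n] times gives
     the Cauchy bound without summing a geometric series. *)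
  assert (Hd : forall k n, Cmod (x (n + k)%nat - x n) <= (/ 2) ^ n * r).
  { intros k. induction n. simpl. rewrite Rmult_1_l. apply Hx.
    change (x (S n + k)%nat) with (T (x (n + k)%nat)). change (x (S n)) with (T (x n)).
    eapply Rle_trans; [apply Hc; apply Hx|]. simpl. lra. }
  destruct (C_complete x) as [l Hl].
  { intros e He. destruct (half_pow_small r (e / 2) Hr) as [N HN]; [lra|]. exists N. intros n m Hn Hm.
    replace n with (N + (n - N))%nat by lia. replace m with (N + (m - N))%nat by lia.
    eapply Rle_lt_trans; [apply (Cmod_triangle_minus _ (x N))|].
    rewrite (Cmod_minus_sym (x N)). pose proof (Hd (n - N)%nat N). pose proof (Hd (m - N)%nat N). lra. }
  assert (Hlr : Cmod (l - c) <= r).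
  { apply le_epsilon. intros e He. destruct (Hl e He) as [N HN]. specialize (HN N ltac:(lia)).
    eapply Rle_trans; [apply (Cmod_triangle_minus _ (x N))|]. rewrite Cmod_minus_sym.
    pose proof (Hx N). lra. }
  exists l. split; [exact Hlr|].
  assert (H0 : (T l - l)%C = 0).
  { apply Cmod_zero_le. apply Rle_eps0. intros e He. destruct (Hl (e / 2)) as [N HN]; [lra|].
    pose proof (HN N ltac:(lia)) as H1. pose proof (HN (S N) ltac:(lia)) as H2.
    eapply Rle_trans; [apply (Cmod_triangle_minus _ (x (S N)))|].
    change (x (S N)) with (T (x N)) in *.
    pose proof (Hc l (x N) Hlr (Hx N)) as H3. rewrite (Cmod_minus_sym l) in H3. lra. }
  apply Cminus_eq_0. exact H0.
Qed.

(** * Power series with coefficients O(1/k!) *)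

(** This class is preserved by [shift] with the same [M], and its sums are dominated by
    [M * exp |u|]; one constant thus controls a series and its derivative. *)
Definition coefb (e : nat -> R) (M : R) : Prop := forall k, Rabs (e k) <= M * / INR (fact k).

(** Coefficients of the formal derivative. *)
Definition shift (e : nat -> R) (k : nat) : R := INR (S k) * e (S k).

Notation Cseries := (@is_series C_AbsRing C_NormedModule).

(** The sum of e_k u^k, assembled from two real series so that it is a total function;
    [Es_is_series] recovers the complex series. *)
Definition Es (e : nat -> R) (u : C) : C :=
  (Series (fun k => e k * Re (Cpow u k)), Series (fun k => e k * Im (Cpow u k))).

Lemma is_series_exp (M x : R) : is_series (fun k => M * / INR (fact k) * x ^ k) (M * exp x).
Proof.
  apply (is_series_ext (fun k => scal M (/ INR (fact k) * x ^ k))).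
  { intros n. unfold scal; simpl. unfold mult; simpl. ring. }
  apply (is_series_scal M (fun k => / INR (fact k) * x ^ k) (exp x)).
  apply (is_series_ext (fun k => scal (x ^ k) (/ INR (fact k)))).
  { intros n. unfold scal; simpl. unfold mult; simpl. ring. }
  assert (H := is_exp_Reals x). unfold is_pseries in H.
  eapply is_series_ext; [|exact H]. intros n. simpl. rewrite pow_n_pow. reflexivity.
Qed.

Lemma ex_series_Rabs_le (a b : nat -> R) :
  (forall k, Rabs (a k) <= b k) -> ex_series b -> ex_series a.
Proof. exact (@ex_series_le R_AbsRing R_CompleteNormedModule a b). Qed.

Lemma coefb_ge0 e M : coefb e M -> 0 <= M.
Proof. intros H. specialize (H O). simpl in H. rewrite Rinv_1 in H. pose proof (Rabs_pos (e O)). lra. Qed.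

Lemma coefb_plus e d M M' : coefb e M -> coefb d M' -> coefb (fun k => e k + d k) (M + M').
Proof.
  intros H1 H2 k. eapply Rle_trans; [apply Rabs_triang|]. specialize (H1 k). specialize (H2 k). lra.
Qed.

Lemma coefb_shift e M : coefb e M -> coefb (shift e) M.
Proof.
  intros H k. unfold shift. rewrite Rabs_mult. rewrite Rabs_pos_eq by apply pos_INR.
  specialize (H (S k)). pose proof (lt_0_INR (S k) ltac:(lia)).
  apply (Rmult_le_compat_l (INR (S k))) in H; [|lra].
  eapply Rle_trans; [exact H|]. apply Req_le.
  change (fact (S k)) with (S k * fact k)%nat. rewrite mult_INR. field. split; [apply INR_fact_neq_0|lra].
Qed.

Lemma Cmod_term (e : nat -> R) M (u : C) k :
  coefb e M -> Cmod (RtoC (e k) * Cpow u k) <= M * / INR (fact k) * Cmod u ^ k.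
Proof.
  intros H. rewrite Cmod_mult, Cmod_R, Cmod_pow.
  apply Rmult_le_compat_r. apply pow_le, Cmod_ge_0. apply H.
Qed.

Lemma C_sum_n (a : nat -> C) n : sum_n a n = (sum_n (fun k => Re (a k)) n, sum_n (fun k => Im (a k)) n).
Proof.
  induction n. rewrite !sum_O. destruct (a O); reflexivity.
  rewrite !sum_Sn, IHn. reflexivity.
Qed.

Lemma Cseries_pair (a : nat -> C) (l : C) :
  is_series (fun k => Re (a k)) (Re l) -> is_series (fun k => Im (a k)) (Im l) -> Cseries a l.
Proof.
  intros H1 H2. unfold is_series.
  apply (filterlim_ext (fun n => (sum_n (fun k => Re (a k)) n, sum_n (fun k => Im (a k)) n))).
  { intros n. symmetry. apply C_sum_n. }
  intros P [eps HP].
  destruct (H1 _ (locally_ball (Re l) eps)) as [N1 HN1].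
  destruct (H2 _ (locally_ball (Im l) eps)) as [N2 HN2].
  exists (max N1 N2). intros n Hn. apply HP. split; [apply HN1|apply HN2]; lia.
Qed.

Lemma Es_is_series e M u : coefb e M -> Cseries (fun k => RtoC (e k) * Cpow u k)%C (Es e u).
Proof.
  intros H.
  assert (Hb : forall k, Rabs (e k * Re (Cpow u k)) <= M * / INR (fact k) * Cmod u ^ k
    /\ Rabs (e k * Im (Cpow u k)) <= M * / INR (fact k) * Cmod u ^ k).
  { intros k. rewrite <- Cmod_pow, !Rabs_mult. split; apply Rmult_le_compat; try apply Rabs_pos; try apply H.
    apply re_le_Cmod. apply im_le_Cmod. }
  assert (Hs : ex_series (fun k => M * / INR (fact k) * Cmod u ^ k)) by (eexists; apply is_series_exp).
  apply Cseries_pair.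
  - eapply is_series_ext; [|apply Series_correct].
    { intros n. simpl. unfold Re, Im; simpl. ring. }
    apply (ex_series_Rabs_le _ _ (fun k => proj1 (Hb k)) Hs).
  - eapply is_series_ext; [|apply Series_correct].
    { intros n. simpl. unfold Re, Im; simpl. ring. }
    apply (ex_series_Rabs_le _ _ (fun k => proj2 (Hb k)) Hs).
Qed.

Lemma Cseries_unique (a : nat -> C) (l l' : C) : Cseries a l -> Cseries a l' -> l = l'.
Proof. exact (@filterlim_locally_unique nat C_AbsRing C_NormedModule eventually _ (sum_n a) l l'). Qed.

Lemma Cmod_series_le (a : nat -> C) (l : C) (b : nat -> R) (B : R) :
  Cseries a l -> is_series b B -> (forall k, Cmod (a k) <= b k) -> Cmod l <= B.
Proof.
  intros Ha Hb Hle.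
  assert (H1 : is_lim_seq (fun n => Cmod (sum_n a n)) (Cmod l)).
  { apply (filterlim_comp _ _ _ (fun n => sum_n a n) Cmod eventually (locally l)); [exact Ha|].
    apply (@filterlim_norm C_AbsRing C_NormedModule l). }
  apply (is_lim_seq_le (fun n => Cmod (sum_n a n)) (sum_n b) (Cmod l) B); auto.
  intros n. induction n. rewrite !sum_O. apply Hle.
  rewrite !sum_Sn. eapply Rle_trans; [apply Cmod_triangle|].
  apply Rplus_le_compat; [exact IHn|apply Hle].
Qed.

Lemma Es_bound e M u : coefb e M -> Cmod (Es e u) <= M * exp (Cmod u).
Proof.
  intros H. apply (Cmod_series_le _ _ _ _ (Es_is_series e M u H) (is_series_exp M (Cmod u))).
  intros k. apply Cmod_term. exact H.
Qed.

Lemma Es_plus e d M M' u : coefb e M -> coefb d M' -> Es (fun k => e k + d k) u = (Es e u + Es d u)%C.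
Proof.
  intros H1 H2.
  eapply Cseries_unique. apply (Es_is_series _ _ u (coefb_plus _ _ _ _ H1 H2)).
  eapply is_series_ext; [|exact (@is_series_plus C_AbsRing C_NormedModule _ _ _ _ (Es_is_series e M u H1) (Es_is_series d M' u H2))].
  intros n. simpl. rewrite RtoC_plus. unfold plus; simpl. ring.
Qed.

Lemma k_le_pow2 k : INR k <= 2 ^ k.
Proof.
  induction k. simpl; lra. rewrite S_INR. simpl. pose proof (pow_R1_Rle 2 k ltac:(lra)). lra.
Qed.

Lemma Cpow_lip (u v : C) r k : 1 <= r -> Cmod u <= r -> Cmod v <= r ->
  Cmod (Cpow u k - Cpow v k) <= INR k * r ^ k * Cmod (u - v).
Proof.
  intros Hr Hu Hv. induction k.
  - simpl. replace (1 - 1)%C with (RtoC 0) by ring. rewrite Cmod_0. lra.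
  - rewrite !Cpow_S. replace (u * Cpow u k - v * Cpow v k)%C with
      (u * (Cpow u k - Cpow v k) + (u - v) * Cpow v k)%C by ring.
    eapply Rle_trans; [apply Cmod_triangle|]. rewrite !Cmod_mult, S_INR.
    pose proof (Cmod_ge_0 u). pose proof (Cmod_ge_0 (Cpow u k - Cpow v k)). pose proof (Cmod_ge_0 (u - v)).
    assert (Hp : Cmod (Cpow v k) <= r ^ k).
    { rewrite Cmod_pow. apply pow_incr. split; [apply Cmod_ge_0|exact Hv]. }
    assert (Hp1 : 0 < r ^ k) by (apply pow_lt; lra).
    assert (Cmod u * Cmod (Cpow u k - Cpow v k) <= r * (INR k * r ^ k * Cmod (u - v))).
    { apply Rmult_le_compat; auto. }
    assert (Cmod (u - v) * Cmod (Cpow v k) <= Cmod (u - v) * (r * r ^ k)).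
    { apply Rmult_le_compat_l; auto. nra. }
    simpl. lra.
Qed.

(** If R_k is the remainder for the exponent k + 1, then R_(k+1) = u R_k + (v - u)(v^(k+1) -
    u^(k+1)), and the last factor is bounded by [Cpow_lip]. *)
Lemma Cpow_taylor2 (u v : C) r k : 1 <= r -> Cmod u <= r -> Cmod v <= r ->
  Cmod (Cpow v (S k) - Cpow u (S k) - RtoC (INR (S k)) * Cpow u k * (v - u))
    <= INR (S k) * INR k * r ^ k * (Cmod (v - u) * Cmod (v - u)).
Proof.
  intros Hr Hu Hv. induction k.
  - simpl. replace (v * 1 - u * 1 - 1 * 1 * (v - u))%C with (RtoC 0) by ring. rewrite Cmod_0. lra.
  - replace (Cpow v (S (S k)) - Cpow u (S (S k)) - RtoC (INR (S (S k))) * Cpow u (S k) * (v - u))%C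
      with (u * (Cpow v (S k) - Cpow u (S k) - RtoC (INR (S k)) * Cpow u k * (v - u))
            + (v - u) * (Cpow v (S k) - Cpow u (S k)))%C.
    2:{ rewrite (S_INR (S k)), RtoC_plus, !(Cpow_S _ (S k)), !(Cpow_S u k). ring. }
    eapply Rle_trans; [apply Cmod_triangle|]. rewrite !Cmod_mult.
    pose proof (Cpow_lip v u r (S k) Hr Hv Hu) as HL.
    pose proof (Cmod_ge_0 u). pose proof (Cmod_ge_0 (v - u)).
    set (A := Cmod (Cpow v (S k) - Cpow u (S k) - RtoC (INR (S k)) * Cpow u k * (v - u))) in *.
    assert (0 <= A) by apply Cmod_ge_0.
    assert (H3 : Cmod u * A <= r * (INR (S k) * INR k * r ^ k * (Cmod (v - u) * Cmod (v - u)))).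
    { apply Rmult_le_compat; auto. }
    assert (H4 : Cmod (v - u) * Cmod (Cpow v (S k) - Cpow u (S k)) <=
       Cmod (v - u) * (INR (S k) * r ^ S k * Cmod (v - u))).
    { apply Rmult_le_compat_l; auto. }
    eapply Rle_trans; [apply Rplus_le_compat; [exact H3|exact H4]|].
    rewrite (S_INR (S k)). pose proof (S_INR k) as HS. simpl (r ^ S k).
    assert (0 <= INR (S k) * (r * r ^ k) * (Cmod (v - u) * Cmod (v - u))).
    { pose proof (pos_INR (S k)). assert (0 < r ^ k) by (apply pow_lt; lra).
      apply Rmult_le_pos; [apply Rmult_le_pos|]; nra. }
    rewrite HS in *. nra.
Qed.

(** The factor k from differentiating u^k is absorbed by k <= 2^k, which turns the majorant into an
    exponential series at [2 * r]. *)
Lemma Es_lip e M r u v : coefb e M -> 1 <= r -> Cmod u <= r -> Cmod v <= r ->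
  Cmod (Es e u - Es e v) <= M * exp (2 * r) * Cmod (u - v).
Proof.
  intros H Hr Hu Hv.
  assert (Hs : Cseries (fun k => RtoC (e k) * Cpow u k - RtoC (e k) * Cpow v k)%C (Es e u - Es e v)%C).
  { exact (@is_series_minus C_AbsRing C_NormedModule _ _ _ _ (Es_is_series e M u H) (Es_is_series e M v H)). }
  replace (M * exp (2 * r) * Cmod (u - v)) with (Cmod (u - v) * M * exp (2 * r)) by ring.
  apply (Cmod_series_le _ _ _ _ Hs (is_series_exp (Cmod (u - v) * M) (2 * r))).
  intros k. replace (RtoC (e k) * Cpow u k - RtoC (e k) * Cpow v k)%C with (RtoC (e k) * (Cpow u k - Cpow v k))%C by ring.
  rewrite Cmod_mult, Cmod_R.
  replace (Cmod (u - v) * M * / INR (fact k) * (2 * r) ^ k) with ((M * / INR (fact k)) * (Cmod (u - v) * (2 * r) ^ k)) by ring.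
  apply Rmult_le_compat; [apply Rabs_pos|apply Cmod_ge_0|apply H|].
  eapply Rle_trans; [apply (Cpow_lip u v r k Hr Hu Hv)|].
  rewrite Rmult_comm. apply Rmult_le_compat_l; [apply Cmod_ge_0|].
  rewrite Rpow_mult_distr. apply Rmult_le_compat_r; [apply pow_le; lra|apply k_le_pow2].
Qed.

(** Reindexed by [pred] so that the derivative series can be subtracted term by term from the series
    of [Es e]. *)
Lemma is_series_shift e M u : coefb e M ->
  Cseries (fun k => RtoC (e k) * RtoC (INR k) * Cpow u (pred k))%C (Es (shift e) u).
Proof.
  intros H. pose proof (Es_is_series _ _ u (coefb_shift e M H)) as HS.
  apply is_series_decr_1.
  eapply is_series_ext; [|match goal with |- is_series _ ?l => replace l with (Es (shift e) u) end; [exact HS|]].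
  - intros n. simpl pred. unfold shift. rewrite RtoC_mult.
    apply (f_equal (fun x => x * Cpow u n)%C). apply Cmult_comm.
  - simpl. change (Es (shift e) u = (Es (shift e) u - RtoC (e O) * RtoC 0 * RtoC 1)%C). ring.
Qed.

(** As in [Es_lip], now with the quadratic factor k(k - 1) absorbed by 4^k. *)
Lemma Es_taylor2 e M r u v : coefb e M -> 1 <= r -> Cmod u <= r -> Cmod v <= r ->
  Cmod (Es e v - Es e u - Es (shift e) u * (v - u)) <= M * exp (4 * r) * (Cmod (v - u) * Cmod (v - u)).
Proof.
  intros H Hr Hu Hv.
  pose proof (@is_series_minus C_AbsRing C_NormedModule _ _ _ _ (Es_is_series e M v H) (Es_is_series e M u H)) as H1.
  pose proof (@is_series_scal C_AbsRing C_NormedModule (v - u)%C _ _ (is_series_shift e M u H)) as H2.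
  pose proof (@is_series_minus C_AbsRing C_NormedModule _ _ _ _ H1 H2) as H3. clear H1 H2.
  replace (M * exp (4 * r) * (Cmod (v - u) * Cmod (v - u))) with (Cmod (v - u) * Cmod (v - u) * M * exp (4 * r)) by ring.
  replace (Es e v - Es e u - Es (shift e) u * (v - u))%C with
    (minus (minus (Es e v) (Es e u)) (scal (v - u)%C (Es (shift e) u)) : C).
  2:{ unfold minus, plus, opp, scal; simpl. unfold mult; simpl. ring. }
  apply (Cmod_series_le _ _ _ _ H3 (is_series_exp (Cmod (v - u) * Cmod (v - u) * M) (4 * r))).
  intros k.
  replace (Cmod (v - u) * Cmod (v - u) * M * / INR (fact k) * (4 * r) ^ k)
    with ((M * / INR (fact k)) * ((4 * r) ^ k * (Cmod (v - u) * Cmod (v - u)))) by ring.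
  match goal with |- Cmod ?x <= _ => replace x with
   (RtoC (e k) * (Cpow v k - Cpow u k - RtoC (INR k) * Cpow u (pred k) * (v - u)))%C end.
  2:{ unfold minus, plus, opp, scal; simpl. unfold mult; simpl. ring. }
  rewrite Cmod_mult, Cmod_R.
  apply Rmult_le_compat; [apply Rabs_pos|apply Cmod_ge_0|apply H|].
  destruct k as [|k].
  - simpl. replace (1 - 1 - 0 * 1 * (v - u))%C with (RtoC 0) by ring. rewrite Cmod_0.
    pose proof (Cmod_ge_0 (v - u)). nra.
  - simpl pred. eapply Rle_trans; [apply (Cpow_taylor2 u v r k Hr Hu Hv)|].
    apply Rmult_le_compat_r; [apply Rmult_le_pos; apply Cmod_ge_0|].
    rewrite Rpow_mult_distr. replace 4 with (2 * 2) by ring. rewrite Rpow_mult_distr.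
    pose proof (k_le_pow2 (S k)). pose proof (k_le_pow2 k).
    assert (INR k <= 2 ^ S k) by (simpl; pose proof (pow_lt 2 k ltac:(lra)); lra).
    apply Rmult_le_compat; [apply Rmult_le_pos; apply pos_INR|apply pow_le; lra|
       apply Rmult_le_compat; auto; apply pos_INR|apply Rle_pow; auto].
Qed.

Lemma Es_derive e M u : coefb e M -> isdC (Es e) u (Es (shift e) u).
Proof.
  intros H. apply is_derive_C. intros eps He.
  set (r := Cmod u + 1). assert (Hr : 1 <= r) by (unfold r; pose proof (Cmod_ge_0 u); lra).
  pose proof (coefb_ge0 e M H) as HM.
  set (K := M * exp (4 * r) + 1). assert (HK : 0 < K).
  { unfold K. pose proof (exp_pos (4 * r)). nra. }
  exists (Rmin 1 (eps / K)). split; [apply Rmin_pos; [lra|apply Rdiv_lt_0_compat; lra]|].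
  intros y Hy.
  pose proof (Rlt_le_trans _ _ _ Hy (Rmin_l _ _)) as Hy1.
  pose proof (Rlt_le_trans _ _ _ Hy (Rmin_r _ _)) as Hy2.
  assert (Hyr : Cmod y <= r).
  { unfold r. pose proof (Cmod_triangle_inv y u). lra. }
  eapply Rle_trans; [apply (Es_taylor2 e M r u y H Hr); [unfold r; lra|exact Hyr]|].
  rewrite <- Rmult_assoc. apply Rmult_le_compat_r; [apply Cmod_ge_0|].
  apply Rlt_div_r in Hy2; [|exact HK].
  pose proof (Cmod_ge_0 (y - u)). unfold K in Hy2. lra.
Qed.

Definition Er (e : nat -> R) (x : R) : R := Series (fun k => e k * x ^ k).

Lemma Es_real e x : Es e (RtoC x) = RtoC (Er e x).
Proof.
  unfold Es, Er. unfold RtoC at 3. f_equal.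
  - apply Series_ext. intros n. rewrite <- RtoC_pow. reflexivity.
  - rewrite (Series_ext _ (fun k => 0 * e k)).
    { rewrite Series_scal_l. apply Rmult_0_l. }
    intros n. rewrite <- RtoC_pow. simpl. ring.
Qed.

Lemma Er_is_series e M x : coefb e M -> is_series (fun k => e k * x ^ k) (Er e x).
Proof.
  intros H. apply Series_correct.
  apply (ex_series_Rabs_le _ (fun k => M * / INR (fact k) * Rabs x ^ k)).
  - intros k. rewrite Rabs_mult, RPow_abs.
    apply Rmult_le_compat_r; [apply Rabs_pos|apply H].
  - eexists; apply is_series_exp.
Qed.

Lemma Es_conj e u : Es e (Cconj u) = Cconj (Es e u).
Proof.
  unfold Es, Cconj at 3. simpl. f_equal.
  - apply Series_ext. intros n. rewrite <- Cpow_conj. reflexivity.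
  - rewrite <- Series_opp. apply Series_ext. intros n. rewrite <- Cpow_conj. unfold Im, Cconj; simpl. ring.
Qed.

(** * The family of quadratic-like maps *)

(** The upper bound makes E small and 1/2-Lipschitz on the unit disk; the strictly positive lower
    bound gives monotonicity, convexity and transcendence, and survives passage to the limit. *)
Definition adm (e : nat -> R) : Prop :=
  forall k, / 64 * / INR (fact k) <= e k <= / 32 * / INR (fact k).

Definition hC (e : nat -> R) (u : C) : C := (RtoC 8 * u - RtoC 4 + Es e u)%C.
Definition fC (e : nat -> R) (z : C) : C := hC e (z * z)%C.
Definition hr (e : nat -> R) (x : R) : R := 8 * x - 4 + Er e x.
Definition fr (e : nat -> R) (x : R) : R := hr e (x * x).
Definition dfr (e : nat -> R) (x : R) : R := 2 * x * (8 + Er (shift e) (x * x)).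

Lemma inv_fact_pos k : 0 < / INR (fact k).
Proof. apply Rinv_0_lt_compat, INR_fact_lt_0. Qed.

Lemma adm_coefb e : adm e -> coefb e (/ 32).
Proof.
  intros H k. specialize (H k). pose proof (inv_fact_pos k). rewrite Rabs_pos_eq; lra.
Qed.

Lemma adm_pos e k : adm e -> 0 < e k.
Proof. intros H. specialize (H k). pose proof (inv_fact_pos k). lra. Qed.

Lemma shift_pos e k : adm e -> 0 < shift e k.
Proof. intros H. unfold shift. apply Rmult_lt_0_compat; [apply lt_0_INR; lia|apply adm_pos, H]. Qed.

Lemma hC_real e x : hC e (RtoC x) = RtoC (hr e x).
Proof. unfold hC, hr. rewrite Es_real, RtoC_plus, RtoC_minus, RtoC_mult. reflexivity. Qed.

Lemma fC_real e x : fC e (RtoC x) = RtoC (fr e x).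
Proof. unfold fC, fr. rewrite <- RtoC_mult. apply hC_real. Qed.

Lemma RtoC_neq_0 x : x <> 0 -> RtoC x <> 0.
Proof. intros H E. apply H, (RtoC_inj x 0 E). Qed.

Lemma Cconj_RtoC x : Cconj (RtoC x) = RtoC x.
Proof. unfold Cconj, RtoC; simpl. f_equal. ring. Qed.

Lemma fC_conj e z : fC e (Cconj z) = Cconj (fC e z).
Proof.
  unfold fC, hC.
  rewrite <- Cmult_conj, Es_conj, Cplus_conj, Cminus_conj, (Cmult_conj (RtoC 8)), !Cconj_RtoC.
  reflexivity.
Qed.

Lemma fC_even e z : fC e (- z)%C = fC e z.
Proof. unfold fC. f_equal. ring. Qed.

(** The chain rule wants the inner derivative for [C] as a module over itself; only the linearity
    half of [is_derive] has to be rebuilt, the other half agrees by conversion. *)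
Lemma isdC_comp (f g : C -> C) (z a b : C) :
  isdC f (g z) a -> isdC g z b ->
  isdC (fun x => f (g x)) z (a * b)%C.
Proof.
  intros H1 H2. rewrite Cmult_comm. 
  apply (is_derive_comp (K := C_AbsRing) (V := C_NormedModule) f g z a b H1).
  destruct H2 as [_ H2]. split; [apply is_linear_scal_l|exact H2].
Qed.

Lemma isdC_affine (a b z : C) : isdC (fun u => a * u + b)%C z a.
Proof.
  apply is_derive_C. intros e He. exists 1. split; [lra|]. intros y _.
  replace (a * y + b - (a * z + b) - a * (y - z))%C with (RtoC 0) by ring.
  rewrite Cmod_0. pose proof (Cmod_ge_0 (y - z)). nra.
Qed.

Lemma isdC_plus (f g : C -> C) (z a b : C) :
  isdC f z a -> isdC g z b ->
  isdC (fun x => f x + g x)%C z (a + b)%C.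
Proof. intros H1 H2. exact (@is_derive_plus C_AbsRing C_NormedModule f g z a b H1 H2). Qed.

Lemma isdC_sqr (z : C) : isdC (fun u => u * u)%C z (RtoC 2 * z)%C.
Proof.
  apply is_derive_C. intros e He. exists e. split; [lra|]. intros y Hy.
  replace (y * y - z * z - RtoC 2 * z * (y - z))%C with ((y - z) * (y - z))%C by ring.
  rewrite Cmod_mult. apply Rmult_le_compat_r; [apply Cmod_ge_0|lra].
Qed.

Lemma fC_derive e M z : coefb e M ->
  isdC (fC e) z ((RtoC 8 + Es (shift e) (z * z)) * (RtoC 2 * z))%C.
Proof.
  intros H. apply (isdC_comp (hC e) (fun u => u * u)%C).
  - apply (isdC_plus (fun u => RtoC 8 * u + - RtoC 4)%C (Es e)).
    apply isdC_affine. apply (Es_derive e M _ H).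
  - apply isdC_sqr.
Qed.

Lemma fC_derive_real e M x : coefb e M ->
  isdC (fC e) (RtoC x) (RtoC (dfr e x)).
Proof.
  intros H. pose proof (fC_derive e M (RtoC x) H) as HD.
  replace (RtoC (dfr e x)) with ((RtoC 8 + Es (shift e) (RtoC x * RtoC x)) * (RtoC 2 * RtoC x))%C; [exact HD|].
  unfold dfr. rewrite <- RtoC_mult, Es_real, <- RtoC_plus, <- !RtoC_mult. f_equal. ring.
Qed.

Lemma exp2_le_9 : exp 2 <= 9.
Proof.
  replace 2 with (1 + 1) by ring. rewrite exp_plus. pose proof exp_le_3. pose proof (exp_pos 1). nra.
Qed.

Lemma adm_Es_bound e u : adm e -> Cmod u <= 1 -> Cmod (Es e u) <= / 2.
Proof.
  intros H Hu. eapply Rle_trans; [apply (Es_bound e _ u (adm_coefb e H))|].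
  assert (exp (Cmod u) <= exp 1).
  { destruct Hu as [Hu| ->]; [left; apply exp_increasing, Hu|lra]. }
  pose proof exp_le_3. lra.
Qed.

Lemma adm_Es_lip e u v : adm e -> Cmod u <= 1 -> Cmod v <= 1 -> Cmod (Es e u - Es e v) <= / 2 * Cmod (u - v).
Proof.
  intros H Hu Hv.
  eapply Rle_trans; [apply (Es_lip e _ 1 u v (adm_coefb e H)); auto; lra|].
  apply Rmult_le_compat_r; [apply Cmod_ge_0|]. rewrite Rmult_1_r. pose proof exp2_le_9. lra.
Qed.

Lemma hC_expand e u v : adm e -> Cmod u <= 1 -> Cmod v <= 1 -> 7 * Cmod (u - v) <= Cmod (hC e u - hC e v).
Proof.
  intros H Hu Hv. pose proof (adm_Es_lip e u v H Hu Hv).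
  replace (hC e u - hC e v)%C with (RtoC 8 * (u - v) - - (Es e u - Es e v))%C by (unfold hC; ring).
  pose proof (Cmod_triangle_inv (RtoC 8 * (u - v)) (- (Es e u - Es e v))) as HT.
  rewrite Cmod_opp, Cmod_mult, Cmod_R, Rabs_pos_eq in HT by lra. pose proof (Cmod_ge_0 (u - v)). lra.
Qed.

(** The equation reads u = (w + 4 - E(u)) / 8. The right-hand side is within 3/16 of 1/2 and has
    Lipschitz constant 1/16, so it contracts the disk of radius 1/4 about 1/2. *)
Lemma hC_onto e w : adm e -> Cmod w <= 1 -> exists u, Cmod (u - RtoC (/ 2)) <= / 4 /\ hC e u = w.
Proof.
  intros H Hw.
  assert (Hin : forall u, Cmod (u - RtoC (/ 2)) <= / 4 -> Cmod u <= 1).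
  { intros u Hu. pose proof (Cmod_triangle_inv u (RtoC (/ 2))) as HT.
    rewrite Cmod_R, Rabs_pos_eq in HT by lra. lra. }
  destruct (contraction_fixed_point (fun u => (w + RtoC 4 - Es e u) * RtoC (/ 8))%C (RtoC (/ 2)) (/ 4))
    as (u & Hu & HT).
  - lra.
  - intros u Hu. replace ((w + RtoC 4 - Es e u) * RtoC (/ 8) - RtoC (/ 2))%C with ((w - Es e u) * RtoC (/ 8))%C.
    2:{ rewrite !RtoC_inv by lra. field; repeat split; apply RtoC_neq_0; lra. }
    rewrite Cmod_mult, Cmod_R, Rabs_pos_eq by lra.
    pose proof (Cmod_triangle w (- Es e u)) as HT. rewrite Cmod_opp in HT.
    pose proof (adm_Es_bound e u H (Hin u Hu)). unfold Cminus. lra.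
  - intros u v Hu Hv.
    replace ((w + RtoC 4 - Es e u) * RtoC (/ 8) - (w + RtoC 4 - Es e v) * RtoC (/ 8))%C
      with ((Es e v - Es e u) * RtoC (/ 8))%C by ring.
    rewrite Cmod_mult, Cmod_R, Rabs_pos_eq, Cmod_minus_sym by lra.
    pose proof (adm_Es_lip e u v H (Hin u Hu) (Hin v Hv)). pose proof (Cmod_ge_0 (u - v)). lra.
  - exists u. split; [exact Hu|]. unfold hC. rewrite <- HT at 1. rewrite RtoC_inv by lra. field;
    apply RtoC_neq_0; lra.
Qed.

(** Half-angle formula: the real part of the root is the square root of (|u| + Re u) / 2. *)
Lemma C_sqrt_exists (u : C) : 0 < Re u -> exists z : C, (z * z)%C = u /\ 0 < Re z.
Proof.
  intros Hu.
  set (a := sqrt ((Cmod u + Re u) / 2)).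
  assert (Hm : 0 < (Cmod u + Re u) / 2) by (pose proof (Cmod_ge_0 u); lra).
  assert (Ha : 0 < a) by (apply sqrt_lt_R0, Hm).
  assert (Ha2 : a * a = (Cmod u + Re u) / 2) by (apply sqrt_sqrt; lra).
  exists (a, Im u / (2 * a)). split; [|exact Ha].
  assert (Hn : Cmod u ^ 2 = Re u ^ 2 + Im u ^ 2) by apply Cmod2_alt.
  rewrite (surjective_pairing u). unfold Cmult; simpl. f_equal.
  - assert (Im u / (2 * a) * (Im u / (2 * a)) = (Cmod u - Re u) / 2).
    { replace (Im u / (2 * a) * (Im u / (2 * a))) with (Im u ^ 2 / (4 * (a * a))) by (field; lra).
      rewrite Ha2. replace (Im u ^ 2) with ((Cmod u - Re u) * (Cmod u + Re u)) by lra. field. lra. }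
    change (a * a - Im u / (2 * a) * (Im u / (2 * a)) = Re u). rewrite H, Ha2. field.
  - unfold Im. field. lra.
Qed.

Lemma Re_gt_half (z : C) : / 4 < Re (z * z)%C -> 0 < Re z -> / 2 < Re z.
Proof. destruct z as [x y]. simpl. nra. Qed.

Lemma fC_onto e w : adm e -> Cmod w <= 1 ->
  exists z, Cmod z < 1 /\ / 2 < Re z /\ fC e z = w.
Proof.
  intros H Hw. destruct (hC_onto e w H Hw) as (u & Hu & Hhu).
  assert (HR : Cmod u <= 3 / 4).
  { pose proof (Cmod_triangle_inv u (RtoC (/ 2))) as HT.
    rewrite Cmod_R, Rabs_pos_eq in HT by lra. lra. }
  (* The radius 1/4 would only give Re u >= 1/4. Feeding u back into its equation improves the
     radius to 3/16, and 5/16 = 1/2 - 3/16 exceeds 1/4, as [Re_gt_half] requires. *)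
  assert (Hr : 5 / 16 <= Re u).
  { assert (Hm : Cmod (u - RtoC (/ 2)) <= 3 / 16).
    { replace (u - RtoC (/ 2))%C with ((w - Es e u) * RtoC (/ 8))%C.
      2:{ rewrite <- Hhu. unfold hC. rewrite !RtoC_inv by lra. field; repeat split; apply RtoC_neq_0; lra. }
      rewrite Cmod_mult, Cmod_R, Rabs_pos_eq by lra.
      pose proof (Cmod_triangle w (- Es e u)) as HT. rewrite Cmod_opp in HT.
      pose proof (adm_Es_bound e u H ltac:(lra)). unfold Cminus. lra. }
    pose proof (re_le_Cmod (u - RtoC (/ 2))) as HL. simpl in HL.
    apply (Rle_trans _ _ _ HL) in Hm. apply Rabs_le_between in Hm. unfold Re in *. simpl in Hm. lra. }
  destruct (C_sqrt_exists u) as (z & Hz & Hzp); [lra|].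
  exists z. rewrite <- Hz in *. split; [|split].
  - rewrite Cmod_mult in HR. pose proof (Cmod_ge_0 z). nra.
  - apply Re_gt_half; [|exact Hzp]. lra.
  - exact Hhu.
Qed.

(** The same estimate places z^2 within 3/16 of 1/2. Then 11/16 = 1/2 + 3/16 keeps the domain away
    from the unit circle, and Re (z^2) >= 5/16 splits it by the strip |Re z| <= 1/2. *)
Lemma fC_region e z : adm e -> Cmod z <= 1 -> Cmod (fC e z) <= 1 ->
  Cmod z * Cmod z <= 11 / 16 /\ / 2 < Rabs (Re z).
Proof.
  intros H Hz Hf. pose proof (Cmod_ge_0 z) as H0.
  assert (Hu1 : Cmod (z * z) <= 1) by (rewrite Cmod_mult; nra).
  assert (Hm : Cmod (z * z - RtoC (/ 2)) <= 3 / 16).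
  { replace (z * z - RtoC (/ 2))%C with ((fC e z - Es e (z * z)) * RtoC (/ 8))%C.
    2:{ unfold fC, hC. rewrite !RtoC_inv by lra. field; repeat split; apply RtoC_neq_0; lra. }
    rewrite Cmod_mult, Cmod_R, Rabs_pos_eq by lra.
    pose proof (Cmod_triangle (fC e z) (- Es e (z * z))) as HT. rewrite Cmod_opp in HT.
    pose proof (adm_Es_bound e _ H Hu1). unfold Cminus. lra. }
  split.
  - rewrite <- Cmod_mult. pose proof (Cmod_triangle_inv (z * z) (RtoC (/ 2))) as HT.
    rewrite Cmod_R, Rabs_pos_eq in HT by lra. lra.
  - pose proof (re_le_Cmod (z * z - RtoC (/ 2))) as HL. simpl in HL.
    apply (Rle_trans _ _ _ HL) in Hm. apply Rabs_le_between in Hm.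
    destruct z as [x y]. simpl in *. unfold Rabs. destruct (Rcase_abs x); nra.
Qed.

(** * Inverse branches and itineraries *)

Definition side (s : bool) (z : C) : Prop := if s then / 2 < Re z else Re z < - / 2.

Lemma side_exists z : / 2 < Rabs (Re z) -> exists s, side s z.
Proof.
  unfold Rabs. destruct (Rcase_abs (Re z)); intros; [exists false|exists true]; simpl; lra.
Qed.

Lemma side_unique s s' z : side s z -> side s' z -> s = s'.
Proof. destruct s, s'; simpl; auto; intros; lra. Qed.

(** Factor z^2 - w^2 = (z - w)(z + w). On one side both real parts exceed 1/2 in absolute value with
    the same sign, so |z + w| >= 1 and the expansion of [hC] is inherited. *)
Lemma fC_expand e s z w : adm e -> Cmod z <= 1 -> Cmod w <= 1 -> side s z -> side s w ->
  7 * Cmod (z - w) <= Cmod (fC e z - fC e w).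
Proof.
  intros H Hz Hw Sz Sw. pose proof (Cmod_ge_0 z). pose proof (Cmod_ge_0 w).
  eapply Rle_trans; [|apply hC_expand; auto; rewrite Cmod_mult; nra].
  replace (z * z - w * w)%C with ((z - w) * (z + w))%C by ring. rewrite Cmod_mult.
  assert (1 <= Cmod (z + w)).
  { pose proof (re_le_Cmod (z + w)) as HL. eapply Rle_trans; [|exact HL]. simpl.
    destruct s; simpl in *; unfold Rabs; destruct (Rcase_abs _); unfold Re in *; lra. }
  pose proof (Cmod_ge_0 (z - w)). nra.
Qed.

Lemma fC_onto_side e s w : adm e -> Cmod w <= 1 -> exists z, Cmod z < 1 /\ side s z /\ fC e z = w.
Proof.
  intros H Hw. destruct (fC_onto e w H Hw) as (z & H1 & H2 & H3). destruct s.
  - exists z. auto.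
  - exists (- z)%C. rewrite Cmod_opp, fC_even. split; [|split]; auto. simpl. unfold Re in *; simpl. lra.
Qed.

(** The inverse branch with values on side [s], meaningful for |w| <= 1; expansion makes the chosen
    preimage the only one. *)
Definition branch (e : nat -> R) (s : bool) (w : C) : C :=
  epsilon (inhabits (RtoC 0)) (fun z => Cmod z < 1 /\ side s z /\ fC e z = w).

Lemma branch_spec e s w : adm e -> Cmod w <= 1 ->
  Cmod (branch e s w) < 1 /\ side s (branch e s w) /\ fC e (branch e s w) = w.
Proof. intros H Hw. apply (epsilon_spec (inhabits (RtoC 0)) _ (fC_onto_side e s w H Hw)). Qed.

Lemma branch_lip e s w w' : adm e -> Cmod w <= 1 -> Cmod w' <= 1 ->
  7 * Cmod (branch e s w - branch e s w') <= Cmod (w - w').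
Proof.
  intros H Hw Hw'. destruct (branch_spec e s w H Hw) as (A1 & A2 & A3).
  destruct (branch_spec e s w' H Hw') as (B1 & B2 & B3).
  rewrite <- A3 at 2. rewrite <- B3 at 2. apply (fC_expand e s); auto; lra.
Qed.

Lemma branch_unique e s z : adm e -> Cmod z <= 1 -> side s z -> Cmod (fC e z) <= 1 ->
  branch e s (fC e z) = z.
Proof.
  intros H Hz Sz Hf. destruct (branch_spec e s _ H Hf) as (A1 & A2 & A3).
  apply Cminus_eq_0, Cmod_zero_le.
  pose proof (fC_expand e s (branch e s (fC e z)) z H ltac:(lra) Hz A2 Sz) as HE.
  rewrite A3 in HE. replace (fC e z - fC e z)%C with (RtoC 0) in HE by ring. rewrite Cmod_0 in HE. lra.
Qed.

(** The distance of the two orbits grows by 7 at each step, yet after [n] steps it is the initial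
    distance again, which must be 0. *)
Lemma itinerary_unique e n z w (s : nat -> bool) : adm e -> (1 <= n)%nat ->
  Nat.iter n (fC e) z = z -> Nat.iter n (fC e) w = w ->
  (forall k, (k < n)%nat -> Cmod (Nat.iter k (fC e) z) <= 1 /\ side (s k) (Nat.iter k (fC e) z)) ->
  (forall k, (k < n)%nat -> Cmod (Nat.iter k (fC e) w) <= 1 /\ side (s k) (Nat.iter k (fC e) w)) ->
  z = w.
Proof.
  intros H Hn Hz Hw Oz Ow.
  assert (HE : forall k, (k <= n)%nat -> 7 ^ k * Cmod (z - w) <= Cmod (Nat.iter k (fC e) z - Nat.iter k (fC e) w)).
  { induction k; intros Hk. simpl. lra.
    specialize (IHk ltac:(lia)). destruct (Oz k ltac:(lia)). destruct (Ow k ltac:(lia)).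
    simpl Nat.iter. eapply Rle_trans; [|apply (fC_expand e (s k)); auto]. simpl. lra. }
  specialize (HE n ltac:(lia)). rewrite Hz, Hw in HE.
  apply Cminus_eq_0, Cmod_zero_le. pose proof (Cmod_ge_0 (z - w)).
  assert (7 <= 7 ^ n). { replace 7 with (7 ^ 1) at 1 by ring. apply Rle_pow; lra || lia. }
  nra.
Qed.

Lemma iter_conj e n z : Nat.iter n (fC e) (Cconj z) = Cconj (Nat.iter n (fC e) z).
Proof. induction n; simpl; auto. rewrite IHn. apply fC_conj. Qed.

Lemma iter_real e n x : Nat.iter n (fC e) (RtoC x) = RtoC (Nat.iter n (fr e) x).
Proof. induction n; simpl; auto. rewrite IHn. apply fC_real. Qed.

Lemma side_conj s z : side s z -> side s (Cconj z).
Proof. destruct s, z; auto. Qed.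

Lemma Im_0_real z : Im z = 0 -> z = RtoC (Re z).
Proof. destruct z as [x y]; unfold Im, Re, RtoC; simpl. intros ->. reflexivity. Qed.

Lemma Cconj_fixed z : Cconj z = z -> Im z = 0.
Proof. destruct z as [x y]. unfold Cconj, Im; simpl. intros [= H]. lra. Qed.

(** Conjugation preserves real parts, so the conjugate orbit has the same itinerary and coincides
    with the orbit. *)
Lemma periodic_real e n z (s : nat -> bool) : adm e -> (1 <= n)%nat -> Nat.iter n (fC e) z = z ->
  (forall k, (k < n)%nat -> Cmod (Nat.iter k (fC e) z) <= 1 /\ side (s k) (Nat.iter k (fC e) z)) ->
  Im z = 0.
Proof.
  intros H Hn Hz Oz. apply Cconj_fixed.
  apply (itinerary_unique e n _ _ s H Hn); auto.
  - rewrite iter_conj, Hz. reflexivity.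
  - intros k Hk. rewrite iter_conj, Cmod_conj. destruct (Oz k Hk). auto using side_conj.
Qed.

Lemma iter_fixed (A : Type) (f : A -> A) n x m : Nat.iter n f x = x -> Nat.iter n f (Nat.iter m f x) = Nat.iter m f x.
Proof. intros H. rewrite <- Nat.iter_add, Nat.add_comm, Nat.iter_add, H. reflexivity. Qed.

(** * Real dynamics *)

Lemma Er_pos_incr e M x y : coefb e M -> (forall k, 0 <= e k) -> 0 <= x <= y -> 0 <= Er e x <= Er e y.
Proof.
  intros H Hp Hxy. split.
  - replace 0 with (Series (fun k => 0 * e k)) by (rewrite Series_scal_l; ring).
    apply Series_le; [|eexists; apply (Er_is_series e M x H)].
    intros k. pose proof (pow_le x k (proj1 Hxy)). specialize (Hp k). nra.
  - apply Series_le; [|eexists; apply (Er_is_series e M y H)].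
    intros k. pose proof (pow_le x k (proj1 Hxy)). pose proof (pow_incr x y k Hxy). specialize (Hp k). nra.
Qed.

Lemma fr_even e x : fr e (- x) = fr e x.
Proof. unfold fr. f_equal. ring. Qed.

Lemma fr_Rabs e x : fr e (Rabs x) = fr e x.
Proof. unfold Rabs. destruct (Rcase_abs x); auto. apply fr_even. Qed.

Lemma fr_incr e x y : adm e -> 0 <= x < y -> fr e x < fr e y.
Proof.
  intros H Hxy. unfold fr, hr.
  pose proof (Er_pos_incr e _ (x * x) (y * y) (adm_coefb e H) (fun k => Rlt_le _ _ (adm_pos e k H)) ltac:(nra)).
  nra.
Qed.

Lemma dfr_incr e x y : adm e -> 0 <= x < y -> 0 <= dfr e x < dfr e y.
Proof.
  intros H Hxy. unfold dfr.
  pose proof (Er_pos_incr (shift e) _ (x * x) (y * y) (coefb_shift e _ (adm_coefb e H))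
    (fun k => Rlt_le _ _ (shift_pos e k H)) ltac:(nra)).
  nra.
Qed.

Lemma dfr_odd e x : dfr e (- x) = - dfr e x.
Proof. unfold dfr. replace (- x * - x) with (x * x) by ring. ring. Qed.

Lemma fr_escape e x : adm e -> 1 <= Rabs x -> Rabs x < fr e x.
Proof.
  intros H Hx. rewrite <- fr_Rabs. unfold fr, hr. set (y := Rabs x) in *.
  pose proof (Er_pos_incr e _ (y * y) (y * y) (adm_coefb e H) (fun k => Rlt_le _ _ (adm_pos e k H)) ltac:(nra)).
  nra.
Qed.

(** By [fr_escape] a point of modulus at least 1 has iterates of strictly larger modulus, so it
    never returns. *)
Lemma periodic_bounded e n x : adm e -> (1 <= n)%nat -> Nat.iter n (fr e) x = x ->
  forall k, Rabs (Nat.iter k (fr e) x) < 1.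
Proof.
  intros H Hn Hx k. destruct (Rlt_or_le (Rabs (Nat.iter k (fr e) x)) 1) as [|Hge]; auto. exfalso.
  set (y := Nat.iter k (fr e) x) in *.
  assert (Hy : Nat.iter n (fr e) y = y) by (apply iter_fixed; exact Hx).
  assert (HI : forall m, Rabs y <= Rabs (Nat.iter m (fr e) y) /\ ((1 <= m)%nat -> Rabs y < Rabs (Nat.iter m (fr e) y))).
  { induction m; simpl. split; [lra|lia].
    destruct IHm as [I1 _]. pose proof (fr_escape e (Nat.iter m (fr e) y) H ltac:(lra)).
    pose proof (Rle_abs (fr e (Nat.iter m (fr e) y))). split; intros; lra. }
  destruct (HI n) as [_ I2]. rewrite Hy in I2. specialize (I2 Hn). lra.
Qed.

(** In the induction the error term is t(1 - t)(x - y)(x^k - y^k), which is nonnegative because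
    powers are increasing. *)
Lemma pow_convex x y t k : 0 <= x -> 0 <= y -> 0 <= t <= 1 ->
  (t * x + (1 - t) * y) ^ k <= t * x ^ k + (1 - t) * y ^ k.
Proof.
  intros Hx Hy Ht. induction k. simpl. lra.
  simpl. assert (0 <= t * x + (1 - t) * y) by nra.
  apply (Rmult_le_compat_l (t * x + (1 - t) * y)) in IHk; auto.
  eapply Rle_trans; [exact IHk|].
  assert (0 <= (x - y) * (x ^ k - y ^ k)).
  { destruct (Rle_or_lt x y). pose proof (pow_incr x y k ltac:(lra)). nra.
    pose proof (pow_incr y x k ltac:(lra)). nra. }
  assert (0 <= t * (1 - t)) by nra. nra.
Qed.

Lemma fr_convex e : adm e -> convex_on_R (fr e).
Proof.
  intros H x y t Ht. unfold fr, hr.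
  assert (HE : Er e ((t * x + (1 - t) * y) * (t * x + (1 - t) * y)) <= t * Er e (x * x) + (1 - t) * Er e (y * y)).
  { assert (Hs : is_series (fun k => t * (e k * (x * x) ^ k) + (1 - t) * (e k * (y * y) ^ k))
       (t * Er e (x * x) + (1 - t) * Er e (y * y))).
    { apply (is_series_plus (fun k => t * (e k * (x * x) ^ k)) (fun k => (1 - t) * (e k * (y * y) ^ k))).
      apply (is_series_scal t _ _ (Er_is_series e _ (x * x) (adm_coefb e H))).
      apply (is_series_scal (1 - t) _ _ (Er_is_series e _ (y * y) (adm_coefb e H))). }
    rewrite <- (is_series_unique _ _ Hs).
    apply Series_le; [|eexists; exact Hs].
    intros k. pose proof (adm_pos e k H) as Hk. split.
    { apply Rmult_le_pos; [lra|apply pow_le, Rle_0_sqr]. }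
    assert (((t * x + (1 - t) * y) * (t * x + (1 - t) * y)) ^ k <= t * (x * x) ^ k + (1 - t) * (y * y) ^ k).
    { eapply Rle_trans; [|apply pow_convex; auto; apply Rle_0_sqr].
      apply pow_incr. split; [apply Rle_0_sqr|].
      pose proof (Rle_0_sqr (x - y)) as Hq. unfold Rsqr in Hq. assert (0 <= t * (1 - t)) by nra. nra. }
    nra. }
  pose proof (Rle_0_sqr (x - y)) as Hq. unfold Rsqr in Hq. assert (0 <= t * (1 - t)) by nra. nra.
Qed.

Lemma Er_ge_term e x n : adm e -> 0 <= x -> e n * x ^ n <= Er e x.
Proof.
  intros H Hx. pose proof (adm_coefb e H) as Hg.
  assert (Hs := Er_is_series e _ x Hg).
  assert (Hp : forall k, 0 <= e k * x ^ k).
  { intros k. apply Rmult_le_pos; [apply Rlt_le, adm_pos, H|apply pow_le, Hx]. }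
  assert (HL : forall N, sum_n (fun k => e k * x ^ k) N <= Er e x).
  { intros N. apply (is_lim_seq_incr_compare (sum_n (fun k => e k * x ^ k))); auto.
    intros m. rewrite sum_Sn. pose proof (Hp (S m)). unfold plus; simpl. simpl in H0. lra. }
  eapply Rle_trans; [|apply (HL n)].
  destruct n. rewrite sum_O. lra. rewrite sum_Sn.
  assert (0 <= sum_n (fun k => e k * x ^ k) n).
  { clear -Hp. induction n. rewrite sum_O. apply Hp. rewrite sum_Sn. pose proof (Hp (S n)). unfold plus; simpl in *. lra. }
  unfold plus; simpl in *. lra.
Qed.

Lemma Cpoly_growth (a : nat -> C) n : exists K, 0 <= K /\ forall x : R, 1 <= x ->
  Cmod (sum_n (fun k => mult (a k) (pow_n (K := C_Ring) (RtoC x) k)) n) <= K * x ^ n.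
Proof.
  induction n.
  - exists (Cmod (a O)). split; [apply Cmod_ge_0|]. intros x Hx. rewrite sum_O. simpl.
    change (Cmod (a O * 1) <= Cmod (a O) * 1). rewrite Cmult_1_r. lra.
  - destruct IHn as (K & HK & IH). exists (K + Cmod (a (S n))). split; [pose proof (Cmod_ge_0 (a (S n))); lra|].
    intros x Hx. rewrite sum_Sn. specialize (IH x Hx).
    eapply Rle_trans; [apply Cmod_triangle|].
    assert (Cmod (mult (a (S n)) (pow_n (K := C_Ring) (RtoC x) (S n))) = Cmod (a (S n)) * x ^ S n).
    { change (Cmod (a (S n) * (pow_n (K := C_Ring) (RtoC x) (S n)))%C = Cmod (a (S n)) * x ^ S n).
      rewrite Cmod_mult. f_equal.
      assert (HP : forall m, pow_n (K := C_Ring) (RtoC x) m = RtoC (x ^ m)).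
      { induction m; simpl; auto. rewrite IHm, RtoC_mult. reflexivity. }
      rewrite HP, Cmod_R, Rabs_pos_eq; auto. apply pow_le; lra. }
    rewrite H. assert (x ^ n <= x ^ S n) by (apply Rle_pow; lra || lia).
    assert (0 <= x ^ n) by (apply pow_le; lra). nra.
Qed.

Lemma fC_transcendental e : adm e -> transcendental_entire (fC e).
Proof.
  intros H. split. { intros z. eexists. apply (fC_derive e _ z (adm_coefb e H)). }
  intros (n & a & Ha). destruct (Cpoly_growth a n) as (K & HK & HG).
  pose proof (adm_pos e (S n) H) as Hp.
  (* With this [x] the single term of index n + 1 already exceeds (K + 5) x^n, more than the growth
     K x^n allowed for a polynomial of degree n. *)
  set (x := 1 + (K + 5) / e (S n)).
  assert (Hx : 1 <= x). { unfold x. assert (0 < (K + 5) / e (S n)) by (apply Rdiv_lt_0_compat; lra). lra. }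
  specialize (HG x Hx). rewrite <- Ha, fC_real, Cmod_R in HG.
  pose proof (Er_ge_term e (x * x) (S n) H ltac:(nra)) as HT.
  assert (HL : fr e x <= K * x ^ n) by (eapply Rle_trans; [apply Rle_abs|exact HG]).
  unfold fr, hr in HL.
  assert (Hxn : 1 <= x ^ n) by (apply pow_R1_Rle; lra).
  assert (Hex : K + 5 <= e (S n) * x).
  { unfold x. replace (e (S n) * (1 + (K + 5) / e (S n))) with (e (S n) + (K + 5)) by (field; lra). lra. }
  assert (x ^ S n <= (x * x) ^ S n) by (apply pow_incr; nra).
  simpl (x ^ S n) in H0.
  assert (e (S n) * (x * x ^ n) <= e (S n) * (x * x) ^ S n) by (apply Rmult_le_compat_l; lra).
  assert ((K + 5) * x ^ n <= e (S n) * x * x ^ n) by (apply Rmult_le_compat_r; lra).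
  nra.
Qed.

(* The periodic orbit with a prescribed itinerary is the fixed point of the
   contraction obtained by composing inverse branches. *)
Lemma itinerary_exists e n (s : nat -> bool) : adm e -> (1 <= n)%nat ->
  exists x : R, Nat.iter n (fr e) x = x /\
    forall k, (k < n)%nat -> side (s k) (RtoC (Nat.iter k (fr e) x)).
Proof.
  intros H Hn.
  set (G := fix G (m : nat) (t : nat -> bool) (w : C) : C :=
     match m with O => w | S m => branch e (t O) (G m (fun i => t (S i)) w) end).
  assert (HG : forall m t w, Cmod w <= 1 -> Cmod (G m t w) <= 1 /\ Nat.iter m (fC e) (G m t w) = w /\
     (forall k, (k < m)%nat -> Cmod (Nat.iter k (fC e) (G m t w)) <= 1 /\ side (t k) (Nat.iter k (fC e) (G m t w)))).
  { induction m; intros t w Hw. simpl. repeat split; auto; lia.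
    destruct (IHm (fun i => t (S i)) w Hw) as (I1 & I2 & I3).
    destruct (branch_spec e (t O) _ H I1) as (B1 & B2 & B3).
    change (G (S m) t w) with (branch e (t O) (G m (fun i => t (S i)) w)).
    split; [lra|]. split.
    - rewrite Nat.iter_succ_r, B3. exact I2.
    - intros [|k] Hk. simpl. split; auto; lra.
      rewrite Nat.iter_succ_r, B3. apply I3. lia. }
  assert (HL : forall m t w w', Cmod w <= 1 -> Cmod w' <= 1 -> 7 ^ m * Cmod (G m t w - G m t w') <= Cmod (w - w')).
  { induction m; intros t w w' Hw Hw'. simpl. lra.
    change (G (S m) t w) with (branch e (t O) (G m (fun i => t (S i)) w)).
    change (G (S m) t w') with (branch e (t O) (G m (fun i => t (S i)) w')).
    pose proof (branch_lip e (t O) _ _ H (proj1 (HG m (fun i => t (S i)) w Hw)) (proj1 (HG m (fun i => t (S i)) w' Hw'))) as HB.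
    eapply Rle_trans; [|apply (IHm (fun i => t (S i)) w w' Hw Hw')].
    simpl. pose proof (pow_lt 7 m ltac:(lra)). nra. }
  assert (H0 : forall u : C, (u - 0)%C = u) by (intros; ring).
  destruct (contraction_fixed_point (G n s) 0 1) as (z & Hz & HT).
  - lra.
  - intros u Hu. rewrite H0 in *. apply (HG n s u Hu).
  - intros u v Hu Hv. rewrite H0 in *. pose proof (HL n s u v Hu Hv).
    assert (7 <= 7 ^ n). { replace 7 with (7 ^ 1) at 1 by ring. apply Rle_pow; lra || lia. }
    pose proof (Cmod_ge_0 (G n s u - G n s v)). nra.
  - rewrite H0 in Hz. destruct (HG n s z Hz) as (I1 & I2 & I3). rewrite HT in I2, I3.
    assert (Hr : z = RtoC (Re z)) by (apply Im_0_real, (periodic_real e n z s); auto).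
    exists (Re z). split.
    + apply RtoC_inj. rewrite <- iter_real, <- Hr. exact I2.
    + intros k Hk. rewrite <- iter_real, <- Hr. apply I3, Hk.
Qed.

(** * The restriction to the disk is an escaping quadratic-like map *)

Lemma open_Cmod (P : C -> Prop) :
  (forall z, P z -> exists d, 0 < d /\ forall y, Cmod (y - z) < d -> P y) -> open P.
Proof. intros H z Hz. apply locally_Cmod, H, Hz. Qed.

Lemma open_unit_disk : open unit_disk.
Proof.
  apply open_Cmod. intros z Hz. unfold unit_disk in *. exists (1 - Cmod z). split; [lra|].
  intros y Hy. pose proof (Cmod_triangle_inv y z). lra.
Qed.

Lemma open_preimage (f : C -> C) (P Q : C -> Prop) :
  (forall z, P z -> continuous f z) -> open P -> open Q -> open (fun z => P z /\ Q (f z)).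
Proof.
  intros Hf HP HQ z [H1 H2]. apply (filter_and P (fun z => Q (f z))); [apply HP, H1|].
  apply (Hf z H1). apply HQ, H2.
Qed.

Lemma fC_continuous e z : adm e -> continuous (fC e) z.
Proof. intros H. eapply derive_continuous_C, fC_derive, adm_coefb, H. Qed.

Notation domain e := (preimage_disk_domain (fC e)).

Lemma open_domain e : adm e -> open (domain e).
Proof.
  intros H. apply (open_preimage (fC e) unit_disk unit_disk); try apply open_unit_disk.
  intros z _. apply fC_continuous, H.
Qed.

Lemma open_side s : open (side s).
Proof.
  apply open_Cmod. intros z Hz. destruct s; simpl in *.
  - exists (Re z - / 2). split; [lra|]. intros y Hy.
    pose proof (re_le_Cmod (y - z)) as HL'. unfold Re in *. simpl in HL'.
    pose proof (Rle_abs (- (fst y + - fst z))). rewrite Rabs_Ropp in *. lra.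
  - exists (- / 2 - Re z). split; [lra|]. intros y Hy.
    pose proof (re_le_Cmod (y - z)) as HL'. unfold Re in *. simpl in HL'.
    pose proof (Rle_abs (fst y + - fst z)). lra.
Qed.

Lemma domain_side e z : adm e -> domain e z -> exists s, side s z.
Proof.
  intros H [H1 H2]. unfold unit_disk in *. apply side_exists, (fC_region e z H); lra.
Qed.

Lemma fC_homeo e s : adm e ->
  homeo_onto (fC e) (fun z => domain e z /\ side s z) unit_disk.
Proof.
  intros H. unfold homeo_onto, preimage_disk_domain, unit_disk. split; [|split].
  - intros z [[_ Hz] _]. exact Hz.
  - intros z _. apply fC_continuous, H.
  - exists (branch e s). split; [|split].
    + intros w Hw. destruct (branch_spec e s w H ltac:(lra)) as (B1 & B2 & B3).
      rewrite B3. auto.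
    + intros z [[H1 H2] H3]. apply branch_unique; auto; lra.
    + intros w Hw. apply continuous_C. intros eps He. exists (Rmin eps (1 - Cmod w)).
      split; [apply Rmin_pos; lra|]. intros y Hy.
      pose proof (Rlt_le_trans _ _ _ Hy (Rmin_l _ _)). pose proof (Rlt_le_trans _ _ _ Hy (Rmin_r _ _)).
      pose proof (Cmod_triangle_inv y w).
      pose proof (branch_lip e s y w H ltac:(lra) ltac:(lra)).
      pose proof (Cmod_ge_0 (branch e s y - branch e s w)). lra.
Qed.

Lemma fC_covering e : adm e -> covering_map (domain e) unit_disk (fC e).
Proof.
  intros H. split; [|split].
  - intros z [_ Hz]. exact Hz.
  - intros z _. apply fC_continuous, H.
  (* The whole disk is evenly covered; its sheets are the two sides, indexed by [bool]. *)
  - intros w Hw. exists unit_disk. split; [apply open_unit_disk|]. split; [exact Hw|].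
    split; [intros z Hz; exact Hz|].
    exists bool, (fun s z => domain e z /\ side s z). split; [|split; [|split]].
    + intros s z [H1 H2]. apply filter_and; [apply (open_domain e H z H1)|apply (open_side s z H2)].
    + intros z. split.
      * intros [Hz _]. destruct (domain_side e z H Hz) as [s Hs]. exists s. auto.
      * intros [s [Hz _]]. split; [exact Hz|apply Hz].
    + intros i j z [_ Hi] [_ Hj]. apply (side_unique i j z Hi Hj).
    + intros s. apply fC_homeo, H.
Qed.

Lemma fC_degree_two e : adm e -> degree_two (domain e) unit_disk (fC e).
Proof.
  intros H w Hw. unfold preimage_disk_domain, unit_disk in *.
  destruct (branch_spec e true w H ltac:(lra)) as (B1 & B2 & B3).
  destruct (branch_spec e false w H ltac:(lra)) as (C1 & C2 & C3).
  exists (branch e true w), (branch e false w). split; [|split; [|split; [|split; [|split]]]].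
  - intros E. rewrite E in B2. simpl in *. lra.
  - rewrite B3; auto.
  - rewrite C3; auto.
  - exact B3.
  - exact C3.
  - intros z [Hz Hf] E. destruct (domain_side e z H (conj Hz Hf)) as [s Hs].
    rewrite <- E. destruct s; [left|right]; symmetry; apply branch_unique; auto; lra.
Qed.

(** The square of 5/6 is 25/36, slightly more than the bound 11/16 of [fC_region]. *)
Lemma closure_domain e z : adm e -> closure (domain e) z ->
  Cmod z <= 5 / 6.
Proof.
  intros H Hz. apply Rnot_lt_le. intros Hgt.
  destruct (Hz (fun y => 5 / 6 < Cmod y)) as (u & [U1 U2] & Hu).
  - apply locally_Cmod. exists (Cmod z - 5 / 6). split; [lra|]. intros y Hy.
    pose proof (Cmod_triangle_inv z y). rewrite (Cmod_minus_sym z y) in H0. lra.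
  - unfold unit_disk in *. pose proof (proj1 (fC_region e u H ltac:(lra) ltac:(lra))). nra.
Qed.

(** Each point of the plane receives a ball lying either in a member of the cover or outside [K].
    This gauge on the square [-1,1]^2 admits a finite covering list of tags, asserted under a double
    negation; tags marked [None] are discarded. *)
Lemma compact_closed_bounded (K : C -> Prop) :
  (forall z, K z -> Cmod z <= 1) -> open (fun z => ~ K z) -> compact_set K.
Proof.
  intros Hb Hc I O HO Hcov.
  assert (Hloc : forall z : C, exists p : posreal * option I, forall y, ball z (fst p) y ->
    match snd p with Some i => O i y | None => ~ K y end).
  { intros z. destruct (classic (K z)) as [Kz|Kz].
    - destruct (Hcov z Kz) as [i Hi]. destruct (HO i z Hi) as [d HB]. exists (d, Some i). exact HB.
    - destruct (Hc z Kz) as [d HB]. exists (d, None). exact HB. }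
  apply choice in Hloc. destruct Hloc as [p Hp].
  set (Tp := fun t : Compactness.Tn 2 R => (fst t, fst (snd t)) : C).
  destruct (NNPP _ (Compactness.compactness_list 2 (-1, (-1, tt)) (1, (1, tt)) (fun t => fst (p (Tp t))))) as [l Hl].
  exists (flat_map (fun t => match snd (p (Tp t)) with Some i => i :: nil | None => nil end) l).
  intros z Kz. pose proof (Hb z Kz) as Hz1.
  destruct (Hl (Re z, (Im z, tt))) as ((t1 & t2 & []) & Ht & _ & c1 & c2 & _).
  { pose proof (Rle_trans _ _ _ (re_le_Cmod z) Hz1) as Hre. pose proof (Rle_trans _ _ _ (im_le_Cmod z) Hz1) as Him.
    apply Rabs_le_between in Hre. apply Rabs_le_between in Him. simpl. repeat split; lra. }
  pose proof (Hp (Tp (t1, (t2, tt))) z (conj c1 c2)) as Hs.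
  destruct (snd (p (Tp (t1, (t2, tt))))) as [i|] eqn:E; [|contradiction].
  exists i. split; [|exact Hs]. apply in_flat_map. exists (t1, (t2, tt)). rewrite E. simpl. auto.
Qed.

Lemma open_closure_complement (A : C -> Prop) : open (fun z => ~ closure A z).
Proof.
  intros z H. apply not_all_ex_not in H. destruct H as [P H]. apply imply_to_and in H.
  destruct H as [HP HN]. apply (filter_imp (F := locally z) (fun y => locally y P)); [|apply locally_locally, HP].
  intros y Hy Hcl. apply HN, (Hcl P Hy).
Qed.

Lemma rel_compact_domain e : adm e -> rel_compact_in (domain e) unit_disk.
Proof.
  intros H. split.
  - apply compact_closed_bounded.
    + intros z Hz. pose proof (closure_domain e z H Hz). lra.
    + apply open_closure_complement.
  - intros z Hz. pose proof (closure_domain e z H Hz). unfold unit_disk. lra.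
Qed.

(** The segment is written with sums and products only, the form in which [filterlim_segment] proves
    continuity. *)
Lemma Cmod_convex (z w : C) t : Cmod z < 1 -> Cmod w < 1 -> 0 <= t <= 1 ->
  Cmod (z + RtoC t * (w + - (1) * z)) < 1.
Proof.
  intros Hz Hw Ht. replace (z + RtoC t * (w + - (1) * z))%C with (RtoC (1 - t) * z + RtoC t * w)%C
    by (rewrite RtoC_minus; ring).
  eapply Rle_lt_trans; [apply Cmod_triangle|].
  rewrite !Cmod_mult, !Cmod_R, !Rabs_pos_eq by lra.
  pose proof (Cmod_ge_0 z). pose proof (Cmod_ge_0 w).
  destruct (Req_dec t 0) as [->|]; nra.
Qed.

Lemma filterlim_RtoC {T : Type} {F : (T -> Prop) -> Prop} {FF : Filter F} (g : T -> R) (l : R) :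
  filterlim g F (locally l) -> filterlim (fun x => RtoC (g x)) F (locally (RtoC l)).
Proof.
  intros H P [eps HP]. apply (H (fun y => P (RtoC y))). exists eps. intros y Hy. apply HP.
  split; [exact Hy|apply ball_center].
Qed.

Lemma filterlim_Cplus {T : Type} {F : (T -> Prop) -> Prop} {FF : Filter F} (g h : T -> C) (a b : C) :
  filterlim g F (locally a) -> filterlim h F (locally b) ->
  filterlim (fun x => g x + h x)%C F (locally (a + b)%C).
Proof.
  intros Hg Hh. apply (filterlim_comp_2 g h Cplus Hg Hh).
  apply (@filterlim_plus C_AbsRing C_NormedModule a b).
Qed.

(** In [filterlim_scal] the left factor converges in the uniform structure of the ring, so its limit
    has to be transported. *)
Lemma filterlim_Cmult {T : Type} {F : (T -> Prop) -> Prop} {FF : Filter F} (g h : T -> C) (a b : C) :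
  filterlim g F (locally a) -> filterlim h F (locally b) ->
  filterlim (fun x => g x * h x)%C F (locally (a * b)%C).
Proof.
  intros Hg Hh.
  apply (@filterlim_comp_2 T (AbsRing_UniformSpace C_AbsRing) C C F (locally (T := AbsRing_UniformSpace C_AbsRing) a)
    (locally b) (locally (a * b)%C) FF g h Cmult); [|exact Hh|apply (@filterlim_scal C_AbsRing C_NormedModule a b)].
  intros P HP. apply (Hg P), Complex.locally_C, HP.
Qed.

Lemma filterlim_within_id {U : UniformSpace} (D : U -> Prop) (x : U) :
  filterlim (fun y : U => y) (within D (locally x)) (locally x).
Proof. intros P HP. apply (filter_imp (F := locally x) P); auto. Qed.

Lemma filterlim_segment {T : Type} {F : (T -> Prop) -> Prop} {FF : Filter F} (g : T -> C) (p : T -> R) (a w : C) (t : R) :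
  filterlim g F (locally a) -> filterlim p F (locally t) ->
  filterlim (fun x => g x + RtoC (p x) * (w + - (1) * g x))%C F (locally (a + RtoC t * (w + - (1) * a))%C).
Proof.
  intros Hg Hp. apply filterlim_Cplus; [exact Hg|]. apply filterlim_Cmult; [apply filterlim_RtoC, Hp|].
  apply filterlim_Cplus; [apply filterlim_const|]. apply filterlim_Cmult; [apply filterlim_const|exact Hg].
Qed.

Lemma simply_connected_disk : simply_connected unit_disk.
Proof.
  split; [exists (RtoC 0); unfold unit_disk; rewrite Cmod_0; lra|]. split.
  - intros x y Hx Hy. exists (fun t => x + RtoC t * (y + - (1) * x))%C. split; [split|split; ring].
    + intros t Ht. apply (@filterlim_segment _ _ (within_filter _ _ _ _) (fun _ => x) (fun t => t)); [apply filterlim_const|].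
      apply (@filterlim_within_id R_UniformSpace).
    + intros t Ht. apply Cmod_convex; auto.
  - intros g [Hg1 Hg2] Hloop.
    (* Straight-line contraction of the loop to its base point; the end points stay fixed because
       [g 1 = g 0]. *)
    exists (fun p => g (fst p) + RtoC (snd p) * (g 0 + - (1) * g (fst p)))%C. split; [|split; [|split]].
    + intros [t s] [Ht Hs]. simpl in Ht, Hs.
      apply (@filterlim_segment _ _ (within_filter _ _ _ _) (fun p => g (fst p)) snd).
      * apply (filterlim_comp _ _ _ (@fst R R) g _ (within unit_interval (locally t))); auto.
        intros P HP. unfold within in *.
        assert (HF : filterlim (@fst R R) (locally (t, s)) (locally t)) by apply (@continuous_fst R_UniformSpace R_UniformSpace t s).
        apply (filter_imp (F := locally (t, s))) with (2 := HF _ HP). intros p Hp [Hp1 _]. apply Hp, Hp1.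
      * eapply filterlim_filter_le_1; [apply filter_le_within|].
        apply (@continuous_snd R_UniformSpace R_UniformSpace t s).
    + intros [t s] [Ht Hs]. apply Cmod_convex; auto; apply Hg2; auto. unfold unit_interval. lra.
    + intros t Ht. simpl. split; ring.
    + intros s Hs. simpl. rewrite <- Hloop. split; ring.
Qed.

Lemma fC_escaping e : adm e -> escaping_quadratic_like (domain e) unit_disk (fC e).
Proof.
  intros H.
  assert (H0 : unit_disk (RtoC 0)) by (unfold unit_disk; rewrite Cmod_0; lra).
  split; [|split; [|split; [|split; [|split; [|split; [|split; [|split]]]]]]].
  - destruct (branch_spec e true (RtoC 0) H) as (B1 & B2 & B3); [rewrite Cmod_0; lra|].
    exists (branch e true (RtoC 0)). split; [exact B1|]. rewrite B3. exact H0.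
  - exists (RtoC 0). exact H0.
  - apply open_domain, H.
  - apply open_unit_disk.
  - apply rel_compact_domain, H.
  - apply simply_connected_disk.
  - intros z _. eexists. apply (fC_derive e _ z (adm_coefb e H)).
  - apply fC_covering, H.
  - apply fC_degree_two, H.
Qed.

(** * Hermite interpolation by small polynomials *)

Definition RQ (x : R) : Prop := exists q : Q, x = Q2R q.

Lemma RQ_plus x y : RQ x -> RQ y -> RQ (x + y).
Proof. intros [p ->] [q ->]. exists (p + q)%Q. symmetry. apply Q2R_plus. Qed.
Lemma RQ_opp x : RQ x -> RQ (- x).
Proof. intros [p ->]. exists (- p)%Q. symmetry. apply Q2R_opp. Qed.
Lemma RQ_minus x y : RQ x -> RQ y -> RQ (x - y).
Proof. intros Hx Hy. apply RQ_plus; auto using RQ_opp. Qed.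
Lemma RQ_mult x y : RQ x -> RQ y -> RQ (x * y).
Proof. intros [p ->] [q ->]. exists (p * q)%Q. symmetry. apply Q2R_mult. Qed.
Lemma RQ_IZR z : RQ (IZR z).
Proof. exists (inject_Z z). unfold Q2R, inject_Z; simpl. field. Qed.
Lemma RQ_inv_INR n : RQ (/ INR (S n)).
Proof.
  exists (1 # Pos.of_succ_nat n)%Q. unfold Q2R. cbn [Qnum Qden]. rewrite Rmult_1_l.
  f_equal. rewrite INR_IZR_INZ. reflexivity.
Qed.

Lemma RQ_dense x d : 0 < d -> exists y, RQ y /\ Rabs (y - x) < d.
Proof.
  intros Hd. destruct (archimed_cor1 d Hd) as (N & HN & HN0).
  destruct N as [|n]; [lia|]. set (N := S n) in *.
  assert (Hp : 0 < INR N) by (apply lt_0_INR; lia).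
  destruct (archimed (x * INR N)) as [H1 H2].
  exists (IZR (up (x * INR N)) * / INR N). split.
  - apply RQ_mult; [apply RQ_IZR|apply RQ_inv_INR].
  - replace (IZR (up (x * INR N)) * / INR N - x) with ((IZR (up (x * INR N)) - x * INR N) * / INR N) by (field; lra).
    rewrite Rabs_pos_eq.
    + assert (0 < / INR N) by (apply Rinv_0_lt_compat, Hp). nra.
    + apply Rmult_le_pos; [lra|apply Rlt_le, Rinv_0_lt_compat, Hp].
Qed.

(** Polynomials of degree at most [n] with coefficients bounded by [B]. The bound is not weighted by
    1/k!, so that it behaves well under multiplication by linear factors. *)
Definition polyb (n : nat) (B : R) (d : nat -> R) : Prop :=
  (forall k, (n < k)%nat -> d k = 0) /\ forall k, Rabs (d k) <= B.

Lemma polyb_le n n' B B' d : (n <= n')%nat -> B <= B' -> polyb n B d -> polyb n' B' d.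
Proof.
  intros Hn HB [H1 H2]. split; [intros k Hk; apply H1; lia|].
  intros k. specialize (H2 k). lra.
Qed.

(** Passing to weighted coefficients costs at most n!, the largest of the factorials involved. *)
Lemma polyb_coefb n B d : polyb n B d -> coefb d (B * INR (fact n)).
Proof.
  intros [H1 H2] k. assert (HB : 0 <= B) by (pose proof (H2 O); pose proof (Rabs_pos (d O)); lra).
  destruct (le_lt_dec k n) as [Hk|Hk].
  - eapply Rle_trans; [apply H2|]. rewrite Rmult_assoc. rewrite <- (Rmult_1_r B) at 1.
    apply Rmult_le_compat_l; auto.
    assert (Hf : INR (fact k) <= INR (fact n)) by (apply le_INR, fact_le, Hk).
    pose proof (INR_fact_lt_0 k).
    apply (Rmult_le_compat_r (/ INR (fact k))) in Hf; [|apply Rlt_le, inv_fact_pos].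
    rewrite Rinv_r in Hf by lra. exact Hf.
  - rewrite H1, Rabs_R0 by exact Hk. pose proof (inv_fact_pos k). pose proof (INR_fact_lt_0 n).
    apply Rmult_le_pos; [apply Rmult_le_pos|]; lra.
Qed.

Lemma Er_ext e d x : (forall k, e k = d k) -> Er e x = Er d x.
Proof. intros H. apply Series_ext. intros k. rewrite H. reflexivity. Qed.

Lemma Er_plus e d M M' x : coefb e M -> coefb d M' -> Er (fun k => e k + d k) x = Er e x + Er d x.
Proof.
  intros H1 H2. apply RtoC_inj. rewrite RtoC_plus, <- !Es_real. eapply Es_plus; eassumption.
Qed.

Lemma Er_bound e M x : coefb e M -> Rabs (Er e x) <= M * exp (Rabs x).
Proof. intros H. rewrite <- !Cmod_R, <- Es_real. apply Es_bound, H. Qed.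

Lemma Er_scal c e x : Er (fun k => c * e k) x = c * Er e x.
Proof. unfold Er. rewrite <- Series_scal_l. apply Series_ext. intros k. ring. Qed.

Lemma shift_plus e d k : shift (fun k => e k + d k) k = shift e k + shift d k.
Proof. unfold shift. ring. Qed.

Lemma shift_scal c e k : shift (fun k => c * e k) k = c * shift e k.
Proof. unfold shift. ring. Qed.

Lemma Er_shift_plus e d M M' x : coefb e M -> coefb d M' ->
  Er (shift (fun k => e k + d k)) x = Er (shift e) x + Er (shift d) x.
Proof.
  intros H1 H2. rewrite (Er_ext _ _ x (shift_plus e d)).
  eapply Er_plus; apply coefb_shift; eassumption.
Qed.

(** Coefficients of (x - l) d(x). *)
Definition mulLin (l : R) (d : nat -> R) (k : nat) : R :=
  match k with O => 0 | S j => d j end - l * d k.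

Lemma polyb_mulLin l n B d : polyb n B d -> polyb (S n) ((1 + Rabs l) * B) (mulLin l d).
Proof.
  intros [H1 H2]. pose proof (Rabs_pos l). split.
  - intros [|k] Hk; [lia|]. unfold mulLin. rewrite !H1 by lia. ring.
  - intros k. unfold mulLin. assert (HB : Rabs (l * d k) <= Rabs l * B).
    { rewrite Rabs_mult. apply Rmult_le_compat_l; auto. }
    assert (Rabs (match k with O => 0 | S j => d j end) <= B).
    { destruct k; auto. rewrite Rabs_R0. pose proof (H2 O). pose proof (Rabs_pos (d O)). lra. }
    eapply Rle_trans; [apply Rabs_triang|]. rewrite Rabs_Ropp. lra.
Qed.

Lemma Er_mulLin l d M x : coefb d M -> Er (mulLin l d) x = (x - l) * Er d x.
Proof.
  intros H. apply is_series_unique.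
  assert (Hs := Er_is_series d M x H).
  assert (H1 : is_series (fun k => match k with O => 0 | S j => d j * x ^ S j end) (x * Er d x)).
  { apply is_series_decr_1. simpl.
    match goal with |- is_series _ ?l => replace l with (x * Er d x) by (unfold plus, opp; simpl; ring) end.
    apply (is_series_ext (fun k => x * (d k * x ^ k))). { intros k. simpl. ring. }
    apply (is_series_scal x _ _ Hs). }
  assert (H2 := is_series_scal (- l) _ _ Hs).
  assert (H3 := is_series_plus _ _ _ _ H1 H2).
  replace ((x - l) * Er d x) with (plus (x * Er d x) (scal (- l) (Er d x))).
  2:{ unfold plus, scal; simpl. unfold mult; simpl. ring. }
  eapply is_series_ext; [|exact H3].
  intros k. unfold plus, scal; simpl. unfold mult; simpl. unfold mulLin. destruct k; simpl; ring.
Qed.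

(** Leibniz rule at the level of coefficients. *)
Lemma shift_mulLin l d k : shift (mulLin l d) k = d k + mulLin l (shift d) k.
Proof. unfold shift, mulLin. destruct k; rewrite ?S_INR; simpl; ring. Qed.

Lemma Er_shift_mulLin l n B d x : polyb n B d ->
  Er (shift (mulLin l d)) x = Er d x + (x - l) * Er (shift d) x.
Proof.
  intros H. rewrite (Er_ext _ _ x (shift_mulLin l d)).
  assert (Hd := polyb_coefb _ _ _ H). assert (Hs := coefb_shift _ _ Hd).
  rewrite <- (Er_mulLin l (shift d) _ x Hs).
  assert (Hsp : polyb n (INR n * B) (shift d)).
  { destruct H as [H1 H2]. split.
    - intros k Hk. unfold shift. rewrite H1 by lia. ring.
    - intros k. unfold shift. rewrite Rabs_mult, Rabs_pos_eq by apply pos_INR.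
      assert (0 <= B) by (pose proof (H2 O); pose proof (Rabs_pos (d O)); lra).
      destruct (le_lt_dec n k).
      + rewrite (H1 (S k)), Rabs_R0, Rmult_0_r by lia. apply Rmult_le_pos; auto. apply pos_INR.
      + apply Rmult_le_compat; auto; [apply pos_INR|apply Rabs_pos|apply le_INR; lia]. }
  eapply Er_plus; [exact Hd|]. apply (polyb_coefb _ _ _ (polyb_mulLin l _ _ _ Hsp)).
Qed.

Definition flat (d : nat -> R) (l : R) : Prop := Er d l = 0 /\ Er (shift d) l = 0.

Definition unit0 (k : nat) : R := match k with O => 1 | _ => 0 end.

Lemma polyb_unit0 : polyb 0 1 unit0.
Proof.
  split; intros [|k]; simpl; intros; rewrite ?Rabs_R1, ?Rabs_R0; lra || lia || reflexivity.
Qed.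

Lemma Er_unit0 x : Er unit0 x = 1 /\ Er (shift unit0) x = 0.
Proof.
  assert (H0 : Er (fun _ => 0) x = 0).
  { transitivity (0 * Er (fun _ => 0) x); [|ring]. rewrite <- (Er_scal 0 (fun _ => 0) x). apply Er_ext. intros; ring. }
  split.
  - apply is_series_unique. apply is_series_decr_1. simpl.
    apply (is_series_ext (fun k => 0 * x ^ k)). { intros k. simpl. ring. }
    match goal with |- is_series _ ?l => replace l with (Er (fun _ => 0) x) by (rewrite H0; unfold plus, opp; simpl; ring) end.
    apply (Er_is_series (fun _ => 0) 0). intros k. rewrite Rabs_R0. lra.
  - rewrite <- H0. apply Er_ext. intros k. unfold shift. simpl. ring.
Qed.

(** The bound [K] depends on the nodes only through their number, their gap and their size. This
    uniformity is what allows nodes to be moved afterwards without spoiling the estimate. *)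
Lemma hermite_point g Rb N : 0 < g -> 0 <= Rb -> exists K, 0 <= K /\
  forall L u a b, (length L <= N)%nat -> (forall l, In l L -> Rabs l <= Rb /\ g <= Rabs (u - l)) ->
  Rabs u <= Rb ->
  exists d, polyb (2 * N + 1) (K * (Rabs a + Rabs b)) d /\ (forall l, In l L -> flat d l) /\
    Er d u = a /\ Er (shift d) u = b.
Proof.
  intros Hg HR. induction N.
  - exists (1 + Rb). split; [lra|]. intros [|l L] u a b HL HLl Hu; [|simpl in HL; lia].
    exists (fun k => a * unit0 k + b * mulLin u unit0 k).
    pose proof (polyb_mulLin u _ _ _ polyb_unit0) as P1. pose proof polyb_unit0 as P0.
    assert (G : forall c d M, coefb d M -> coefb (fun k => c * d k) (Rabs c * M)).
    { intros c d M Hd k. rewrite Rabs_mult, Rmult_assoc. apply Rmult_le_compat_l; [apply Rabs_pos|apply Hd]. }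
    assert (G0 := polyb_coefb _ _ _ P0). assert (G1 := polyb_coefb _ _ _ P1).
    destruct (Er_unit0 u) as [U0 U1].
    split; [|split; [intros l []|split]].
    + split; [intros k Hk; rewrite (proj1 P0), (proj1 P1) by lia; ring|].
      intros k. eapply Rle_trans; [apply Rabs_triang|]. rewrite !Rabs_mult.
      pose proof (proj2 P0 k). pose proof (proj2 P1 k). pose proof (Rabs_pos a). pose proof (Rabs_pos b).
      assert (Rabs a * Rabs (unit0 k) <= Rabs a * 1) by (apply Rmult_le_compat_l; auto).
      assert (Rabs b * Rabs (mulLin u unit0 k) <= Rabs b * (1 + Rb)) by (apply Rmult_le_compat_l; lra). nra.
    + rewrite (Er_plus _ _ _ _ u (G a _ _ G0) (G b _ _ G1)), !Er_scal, (Er_mulLin u _ _ u G0), U0. ring.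
    + rewrite (Er_shift_plus _ _ _ _ u (G a _ _ G0) (G b _ _ G1)), (Er_ext _ _ u (shift_scal a _)),
        (Er_ext _ _ u (shift_scal b _)), !Er_scal, (Er_shift_mulLin u _ _ _ u P0), U0, U1. ring.
  - destruct IHN as (K & HK & IH).
    (* 1 + 2/g bounds the change of the data at [u]; the other factor accounts for two
       multiplications by x - l and the division by (u - l)^2. *)
    set (K2 := K * (1 + 2 / g) * ((1 + Rb) * (1 + Rb) / (g * g))).
    assert (Hg2 : 0 < 2 / g) by (apply Rdiv_lt_0_compat; lra).
    assert (Hgg : 0 < (1 + Rb) * (1 + Rb) / (g * g)) by (apply Rdiv_lt_0_compat; nra).
    assert (HK2 : 0 <= K2) by (unfold K2; apply Rmult_le_pos; [apply Rmult_le_pos|]; lra).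
    exists (K + K2). split; [lra|].
    intros [|l L] u a b HL HLl Hu.
    + destruct (IH nil u a b ltac:(simpl; lia) HLl Hu) as (d & D1 & D2 & D3). exists d.
      split; [|auto]. revert D1. apply polyb_le; [lia|]. pose proof (Rabs_pos a). pose proof (Rabs_pos b).
      apply Rmult_le_compat_r; lra.
    + destruct (HLl l (or_introl eq_refl)) as [Hl1 Hl2].
      assert (Hne : u - l <> 0). { intros E. rewrite E, Rabs_R0 in Hl2. lra. }
      (* The new node is handled by the factor ((x - l) / (u - l))^2, equal to 1 at [u] with
         derivative 2 / (u - l). The prescribed derivative is corrected for that in advance. *)
      destruct (IH L u a (b - 2 * a / (u - l)) ltac:(simpl in HL; lia)
         (fun x Hx => HLl x (or_intror Hx)) Hu) as (d & D1 & D2 & D3 & D4).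
      set (c := / ((u - l) * (u - l))).
      exists (fun k => c * mulLin l (mulLin l d) k).
      pose proof (polyb_mulLin l _ _ _ D1) as P1. pose proof (polyb_mulLin l _ _ _ P1) as P2.
      assert (V0 : forall t, Er (fun k => c * mulLin l (mulLin l d) k) t = c * ((t - l) * ((t - l) * Er d t))).
      { intros t. rewrite Er_scal. f_equal.
        rewrite (Er_mulLin l _ _ t (polyb_coefb _ _ _ P1)), (Er_mulLin l _ _ t (polyb_coefb _ _ _ D1)). reflexivity. }
      assert (V1 : forall t, Er (shift (fun k => c * mulLin l (mulLin l d) k)) t =
         c * ((t - l) * Er d t + (t - l) * (Er d t + (t - l) * Er (shift d) t))).
      { intros t. rewrite (Er_ext _ _ t (shift_scal c _)), Er_scal. f_equal.
        rewrite (Er_shift_mulLin l _ _ _ t P1), (Er_shift_mulLin l _ _ _ t D1),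
          (Er_mulLin l _ _ t (polyb_coefb _ _ _ D1)). reflexivity. }
      split; [|split; [|split]].
      * assert (Hc : Rabs c <= / (g * g)).
        { unfold c. rewrite Rabs_inv, Rabs_mult. apply Rinv_le_contravar; [nra|]. apply Rmult_le_compat; lra. }
        assert (Hab : Rabs a + Rabs (b - 2 * a / (u - l)) <= (1 + 2 / g) * (Rabs a + Rabs b)).
        { assert (Rabs (2 * a / (u - l)) <= 2 / g * Rabs a).
          { unfold Rdiv. rewrite !Rabs_mult, Rabs_inv, (Rabs_pos_eq 2) by lra.
            assert (/ Rabs (u - l) <= / g) by (apply Rinv_le_contravar; lra).
            pose proof (Rabs_pos a). nra. }
          pose proof (Rabs_triang b (- (2 * a / (u - l)))) as HT. rewrite Rabs_Ropp in HT.
          change (b + - (2 * a / (u - l))) with (b - 2 * a / (u - l)) in HT.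
          pose proof (Rabs_pos a). pose proof (Rabs_pos b).
          assert (0 <= 2 / g * Rabs b) by (apply Rmult_le_pos; lra). lra. }
        set (S0 := Rabs a + Rabs (b - 2 * a / (u - l))) in *.
        set (S1 := Rabs a + Rabs b) in *.
        assert (HS0 : 0 <= S0) by (unfold S0; pose proof (Rabs_pos a); pose proof (Rabs_pos (b - 2 * a / (u - l))); lra).
        assert (HS1 : 0 <= S1) by (unfold S1; pose proof (Rabs_pos a); pose proof (Rabs_pos b); lra).
        destruct P2 as [Q1 Q2]. split.
        -- intros k Hk. rewrite Q1 by lia. ring.
        -- intros k. rewrite Rabs_mult.
           assert (HQ : Rabs (mulLin l (mulLin l d) k) <= (1 + Rb) * ((1 + Rb) * (K * ((1 + 2 / g) * S1)))).
           { eapply Rle_trans; [apply Q2|]. pose proof (Rabs_pos l).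
             assert (0 <= K * S0) by (apply Rmult_le_pos; auto).
             apply Rmult_le_compat; try lra. apply Rmult_le_pos; lra.
             apply Rmult_le_compat; try lra. apply Rmult_le_compat_l; auto. }
           eapply Rle_trans; [apply Rmult_le_compat; [apply Rabs_pos|apply Rabs_pos|exact Hc|exact HQ]|].
           replace (/ (g * g) * ((1 + Rb) * ((1 + Rb) * (K * ((1 + 2 / g) * S1))))) with (K2 * S1)
             by (unfold K2; field; lra).
           nra.
      * intros t [<-|Ht].
        -- split; [rewrite V0|rewrite V1]; ring.
        -- destruct (D2 t Ht) as [F1 F2]. split; [rewrite V0, F1|rewrite V1, F1, F2]; ring.
      * rewrite V0, D3. unfold c. field. exact Hne.
      * rewrite V1, D3, D4. unfold c. field. exact Hne.
Qed.

Lemma hermite_point_small g Rb N eta : 0 < g -> 0 <= Rb -> 0 < eta -> exists del, 0 < del /\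
  forall L u a b, (length L <= N)%nat -> (forall l, In l L -> Rabs l <= Rb /\ g <= Rabs (u - l)) ->
  Rabs u <= Rb -> Rabs a <= del -> Rabs b <= del ->
  exists d, coefb d eta /\ (forall l, In l L -> flat d l) /\ Er d u = a /\ Er (shift d) u = b.
Proof.
  intros Hg HR He. destruct (hermite_point g Rb N Hg HR) as (K & HK & HH).
  set (F := INR (fact (2 * N + 1))). assert (HF : 0 < F) by apply INR_fact_lt_0.
  assert (HKF : 0 <= K * F) by nra.
  exists (eta / (2 * (K * F) + 1)). split; [apply Rdiv_lt_0_compat; lra|].
  intros L u a b HL HLl Hu Ha Hb. destruct (HH L u a b HL HLl Hu) as (d & D1 & D2).
  exists d. split; [|exact D2]. intros k.
  eapply Rle_trans; [apply (polyb_coefb _ _ _ D1)|]. apply Rmult_le_compat_r; [apply Rlt_le, inv_fact_pos|].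
  fold F. replace (K * (Rabs a + Rabs b) * F) with (K * F * (Rabs a + Rabs b)) by ring.
  apply Rle_trans with (K * F * (2 * (eta / (2 * (K * F) + 1)))).
  - apply Rmult_le_compat_l; lra.
  - apply (Rmult_le_reg_r (2 * (K * F) + 1)); [lra|].
    replace (K * F * (2 * (eta / (2 * (K * F) + 1))) * (2 * (K * F) + 1)) with (K * F * 2 * eta) by (field; lra).
    nra.
Qed.

(** One node at a time: the inductive polynomial is flat at the new node, and the polynomial added
    for the new node is flat at all others, so data already achieved are not disturbed. Each node
    costs one [eta]. *)
Lemma hermite_many g Rb N eta : 0 < g -> 0 <= Rb -> 0 < eta -> exists del, 0 < del /\
  forall (nu a b : R -> R) X L, (length L + length X <= N)%nat ->
  (forall l, In l L -> Rabs l <= Rb) -> (forall x, In x X -> Rabs (nu x) <= Rb) ->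
  (forall l x, In l L -> In x X -> g <= Rabs (nu x - l)) ->
  NoDup X -> (forall x y, In x X -> In y X -> x <> y -> g <= Rabs (nu x - nu y)) ->
  (forall x, In x X -> Rabs (a x) <= del /\ Rabs (b x) <= del) ->
  exists d, coefb d (eta * INR (length X)) /\ (forall l, In l L -> flat d l) /\
    forall x, In x X -> Er d (nu x) = a x /\ Er (shift d) (nu x) = b x.
Proof.
  intros Hg HR He. destruct (hermite_point_small g Rb N eta Hg HR He) as (del & Hdel & HH).
  exists del. split; [exact Hdel|]. intros nu a b. induction X as [|x X IH]; intros L HN HL HX HLX ND HXX Hab.
  - exists (fun _ => 0). split; [|split].
    + intros k. rewrite Rabs_R0. simpl. lra.
    + assert (H0 : forall t, Er (fun _ => 0) t = 0).
      { intros t. transitivity (0 * Er (fun _ => 0) t); [|ring].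
        rewrite <- (Er_scal 0 (fun _ => 0) t). apply Er_ext. intros; ring. }
      intros l _. split; [apply H0|]. transitivity (Er (fun _ => 0) l); [|apply H0].
      apply Er_ext. intros k. unfold shift. ring.
    + intros x [].
  - inversion ND as [|x' X' NX NDX]; subst. simpl in HN.
    destruct (IH (nu x :: L)) as (d & D1 & D2 & D3).
    + simpl. lia.
    + intros l [<-|Hl]; [apply HX; left; reflexivity|apply HL, Hl].
    + intros y Hy. apply HX. right. exact Hy.
    + intros l y [<-|Hl] Hy; [|apply HLX; simpl; auto].
      apply HXX; simpl; auto. intros ->. contradiction.
    + exact NDX.
    + intros y z Hy Hz. apply HXX; simpl; auto.
    + intros y Hy. apply Hab. right. exact Hy.
    + destruct (HH (L ++ map nu X) (nu x) (a x) (b x)) as (c & C1 & C2 & C3 & C4).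
      * rewrite length_app, length_map. lia.
      * intros l Hl. apply in_app_or in Hl. destruct Hl as [Hl|Hl].
        -- split; [apply HL, Hl|]. apply HLX; simpl; auto.
        -- apply in_map_iff in Hl. destruct Hl as (y & <- & Hy). split; [apply HX; simpl; auto|].
           apply HXX; simpl; auto. intros ->. contradiction.
      * apply HX. left; reflexivity.
      * apply Hab. left; reflexivity.
      * apply Hab. left; reflexivity.
      * assert (S0 : forall t, Er (fun k => c k + d k) t = Er c t + Er d t) by (intros; eapply Er_plus; eassumption).
        assert (S1 : forall t, Er (shift (fun k => c k + d k)) t = Er (shift c) t + Er (shift d) t)
          by (intros; eapply Er_shift_plus; eassumption).
        exists (fun k => c k + d k). split; [|split].
        -- change (length (x :: X)) with (S (length X)). rewrite S_INR.
           replace (eta * (INR (length X) + 1)) with (eta + eta * INR (length X)) by ring. apply coefb_plus; auto.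
        -- intros l Hl. destruct (C2 l) as [F1 F2]; [apply in_or_app; auto|].
           destruct (D2 l (or_intror Hl)) as [G1 G2]. split; [rewrite S0, F1, G1|rewrite S1, F2, G2]; ring.
        -- intros y [<-|Hy].
           ++ destruct (D2 (nu x) (or_introl eq_refl)) as [G1 G2]. rewrite S0, S1, C3, C4, G1, G2. split; ring.
           ++ destruct (C2 (nu y)) as [F1 F2]; [apply in_or_app; right; apply in_map, Hy|].
              destruct (D3 y Hy) as [G1 G2]. rewrite S0, S1, F1, F2, G1, G2. split; ring.
Qed.

Lemma list_gap (P : list R) : exists g, 0 < g /\ forall a b, In a P -> In b P -> a <> b -> g <= Rabs (a - b).
Proof.
  assert (H1 : forall (P : list R) a, exists g, 0 < g /\ forall b, In b P -> a <> b -> g <= Rabs (a - b)).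
  { clear. intros P a. induction P as [|b P (g & Hg & IH)]. exists 1. split; [lra|intros b []].
    destruct (Req_dec a b) as [<-|Hab].
    - exists g. split; auto. intros c [<-|Hc] Hne; auto. contradiction.
    - assert (0 < Rabs (a - b)) by (apply Rabs_pos_lt; lra).
      exists (Rmin g (Rabs (a - b))). split; [apply Rmin_pos; auto|].
      intros c [<-|Hc] Hne; [apply Rmin_r|]. eapply Rle_trans; [apply Rmin_l|auto]. }
  induction P as [|a P (g & Hg & IH)]. exists 1. split; [lra|intros a b []].
  destruct (H1 P a) as (g' & Hg' & Ha). exists (Rmin g g'). split; [apply Rmin_pos; auto|].
  intros x y [<-|Hx] [<-|Hy] Hne; try contradiction.
  - eapply Rle_trans; [apply Rmin_r|auto].
  - rewrite Rabs_minus_sym. eapply Rle_trans; [apply Rmin_r|auto].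
  - eapply Rle_trans; [apply Rmin_l|auto].
Qed.

Lemma list_bound (P : list R) : exists B, 0 <= B /\ forall a, In a P -> Rabs a <= B.
Proof.
  induction P as [|a P (B & HB & IH)]. exists 0. split; [lra|intros a []].
  exists (Rmax B (Rabs a)). split; [eapply Rle_trans; [exact HB|apply Rmax_l]|].
  intros x [<-|Hx]; [apply Rmax_r|]. eapply Rle_trans; [apply IH, Hx|apply Rmax_l].
Qed.

Lemma gap_perturb g a b a' b' : g <= Rabs (a - b) -> Rabs (a' - a) <= g / 4 -> Rabs (b' - b) <= g / 4 ->
  g / 2 <= Rabs (a' - b').
Proof. unfold Rabs. repeat destruct (Rcase_abs _); lra. Qed.

(** The tolerance [del] is fixed before the actual nodes [nu] are known: moving each by at most a
    quarter of the gap leaves half of it. This order of quantifiers breaks the circularity in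
    [treat_word], where the data depend on the choice of nodes. *)
Lemma hermite_perturb (L X : list R) (base : R -> R) eta : 0 < eta -> NoDup X ->
  (forall x, In x X -> ~ In (base x) L) ->
  (forall x y, In x X -> In y X -> base x = base y -> x = y) ->
  exists del, 0 < del /\ forall nu a b : R -> R,
    (forall x, In x X -> Rabs (nu x - base x) <= del /\ Rabs (a x) <= del /\ Rabs (b x) <= del) ->
    exists d, coefb d eta /\ (forall l, In l L -> flat d l) /\
      forall x, In x X -> Er d (nu x) = a x /\ Er (shift d) (nu x) = b x.
Proof.
  intros He ND HXL Hinj.
  destruct (list_gap (L ++ map base X)) as (g & Hg & Hgap).
  destruct (list_bound (L ++ map base X)) as (B & HB & Hbd).
  assert (HS : 0 < INR (length X) + 1) by (pose proof (pos_INR (length X)); lra).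
  destruct (hermite_many (g / 2) (B + g) (length L + length X) (eta / (INR (length X) + 1))) as (del & Hdel & HH);
    try lra. { apply Rdiv_lt_0_compat; lra. }
  exists (Rmin del (g / 4)). split; [apply Rmin_pos; lra|]. intros nu a b Hab.
  assert (Hnu : forall x, In x X -> Rabs (nu x - base x) <= g / 4).
  { intros x Hx. destruct (Hab x Hx) as [H1 _]. eapply Rle_trans; [exact H1|apply Rmin_r]. }
  assert (inL : forall l, In l L -> In l (L ++ map base X)) by (intros; apply in_or_app; auto).
  assert (inX : forall x, In x X -> In (base x) (L ++ map base X)) by (intros; apply in_or_app; right; apply in_map; auto).
  destruct (HH nu a b X L) as (d & D1 & D2 & D3).
  - lia.
  - intros l Hl. pose proof (Hbd l (inL l Hl)). lra.
  - intros x Hx. pose proof (Hbd _ (inX x Hx)). pose proof (Hnu x Hx).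
    pose proof (Rabs_triang (nu x - base x) (base x)) as HT.
    replace (nu x - base x + base x) with (nu x) in HT by ring. lra.
  - intros l x Hl Hx.
    assert (Hne : base x <> l) by (intros <-; apply (HXL x Hx Hl)).
    apply (gap_perturb g (base x) l); auto. replace (l - l) with 0 by ring. rewrite Rabs_R0. lra.
  - exact ND.
  - intros x y Hx Hy Hne. apply (gap_perturb g (base x) (base y)); auto.
  - intros x Hx. destruct (Hab x Hx) as (_ & H1 & H2). pose proof (Rmin_l del (g / 4)). split; lra.
  - exists d. split; [|auto]. intros k. eapply Rle_trans; [apply D1|].
    apply Rmult_le_compat_r; [apply Rlt_le, inv_fact_pos|].
    apply (Rmult_le_reg_r (INR (length X) + 1)); auto.
    replace (eta / (INR (length X) + 1) * INR (length X) * (INR (length X) + 1)) with (eta * INR (length X)) by (field; lra).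
    pose proof (pos_INR (length X)). nra.
Qed.

(** * Making the arithmetic data rational one step at a time *)

Definition treated (e : nat -> R) (L : list R) : Prop :=
  forall u, In u L -> (exists q, RQ q /\ u = q * q) /\ RQ (Er e u) /\ RQ (Er (shift e) u).

Definition agree (e e' : nat -> R) (L : list R) : Prop :=
  forall u, In u L -> Er e' u = Er e u /\ Er (shift e') u = Er (shift e) u.

(** Requiring the squares of the orbit points to lie in [L] makes the orbit survive every later
    correction, since those are flat on [L]. *)
Definition rational_orbit (e : nat -> R) (L : list R) (n : nat) (s : nat -> bool) : Prop :=
  exists y, Nat.iter n (fr e) y = y /\ forall i, (i < n)%nat ->
    let yi := Nat.iter i (fr e) y in
    RQ yi /\ In (yi * yi) L /\ Rabs yi < 1 /\ if s i then 0 < yi else yi < 0.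

Lemma iter_agree e e' L n y : agree e e' L ->
  (forall i, (i < n)%nat -> In (Nat.iter i (fr e) y * Nat.iter i (fr e) y) L) ->
  forall i, (i <= n)%nat -> Nat.iter i (fr e') y = Nat.iter i (fr e) y.
Proof.
  intros HA HI. induction i; intros Hi; [reflexivity|]. simpl. rewrite IHi by lia.
  unfold fr at 1, hr. rewrite (proj1 (HA _ (HI i ltac:(lia)))). reflexivity.
Qed.

Lemma rational_orbit_agree e e' L L' n s : (1 <= n)%nat -> agree e e' L -> incl L L' ->
  rational_orbit e L n s -> rational_orbit e' L' n s.
Proof.
  intros Hn HA HL (y & Hy & Hi). exists y.
  assert (HI := iter_agree e e' L n y HA (fun i h => proj1 (proj2 (Hi i h)))).
  split; [rewrite HI; auto|]. intros i Hin. simpl. rewrite HI by lia.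
  destruct (Hi i Hin) as (H1 & H2 & H3 & H4). auto.
Qed.

Lemma agree_perturb e d M eta L : coefb e M -> coefb d eta -> (forall l, In l L -> flat d l) ->
  agree e (fun k => e k + d k) L.
Proof.
  intros He Hd HF u Hu. destruct (HF u Hu) as [F1 F2].
  rewrite (Er_plus _ _ _ _ _ He Hd), (Er_shift_plus _ _ _ _ _ He Hd), F1, F2. split; ring.
Qed.

Lemma treated_agree e e' L : agree e e' L -> treated e L -> treated e' L.
Proof. intros HA HT u Hu. destruct (HA u Hu) as [-> ->]. apply HT, Hu. Qed.

(** An untreated square receives nearby rational values of E and E' by a small flat correction; a
    treated one needs none. *)
Lemma treat_rational e M L q eta : coefb e M -> 0 < eta -> RQ q -> treated e L ->
  exists d L', coefb d eta /\ incl L L' /\ agree e (fun k => e k + d k) L /\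
    treated (fun k => e k + d k) L' /\ In (q * q) L'.
Proof.
  intros He Heta Hq HT.
  destruct (classic (In (q * q) L)) as [Hin|Hin].
  - assert (G0 : coefb (fun _ => 0) eta).
    { intros k. rewrite Rabs_R0. pose proof (inv_fact_pos k). nra. }
    assert (HA : agree e (fun k => e k + 0) L).
    { intros u _. split; apply Er_ext; intros k; unfold shift; ring. }
    exists (fun _ => 0), L. split; [exact G0|]. split; [apply incl_refl|]. split; [exact HA|].
    split; [apply (treated_agree _ _ _ HA HT)|exact Hin].
  - destruct (hermite_perturb L (q :: nil) (fun x => x * x) eta Heta) as (del & Hdel & HH).
    + constructor; [intros []|constructor].
    + intros x [<-|[]]. exact Hin.
    + intros x y [<-|[]] [<-|[]] _. reflexivity.
    + destruct (RQ_dense (Er e (q * q)) del Hdel) as (a & Ha & Ha').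
      destruct (RQ_dense (Er (shift e) (q * q)) del Hdel) as (b & Hb & Hb').
      destruct (HH (fun x => x * x) (fun _ => a - Er e (q * q)) (fun _ => b - Er (shift e) (q * q))) as (d & D1 & D2 & D3).
      { intros x _. replace (x * x - x * x) with 0 by ring. rewrite Rabs_R0. lra. }
      assert (HA := agree_perturb e d M eta L He D1 D2).
      exists d, (q * q :: L). split; [exact D1|]. split; [apply incl_tl, incl_refl|]. split; [exact HA|].
      split; [|left; reflexivity].
      intros u [<-|Hu]; [|apply (treated_agree _ _ _ HA HT u Hu)].
      destruct (D3 q (or_introl eq_refl)) as [E1 E2].
      rewrite (Er_plus _ _ _ _ _ He D1), (Er_shift_plus _ _ _ _ _ He D1), E1, E2.
      split; [exists q; auto|]. split; [replace (_ + _) with a by ring|replace (_ + _) with b by ring]; auto.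
Qed.

(** Slope 8 plus the Lipschitz constant 1/2 of E, rounded up. *)
Lemma hr_lip e x y : adm e -> Rabs x <= 1 -> Rabs y <= 1 -> Rabs (hr e x - hr e y) <= 9 * Rabs (x - y).
Proof.
  intros H Hx Hy. unfold hr.
  pose proof (adm_Es_lip e (RtoC x) (RtoC y) H) as HL.
  rewrite !Cmod_R, !Es_real, <- !RtoC_minus, !Cmod_R in HL. specialize (HL Hx Hy).
  replace (8 * x - 4 + Er e x - (8 * y - 4 + Er e y)) with (8 * (x - y) + (Er e x - Er e y)) by ring.
  eapply Rle_trans; [apply Rabs_triang|]. rewrite Rabs_mult, (Rabs_pos_eq 8) by lra.
  pose proof (Rabs_pos (x - y)). lra.
Qed.

Lemma RQ_hr e x : RQ x -> RQ (Er e x) -> RQ (hr e x).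
Proof.
  intros H1 H2. apply RQ_plus; [|exact H2].
  apply RQ_minus; [apply RQ_mult; [apply (RQ_IZR 8)|exact H1]|apply (RQ_IZR 4)].
Qed.

(** The points x_i of the cycle with itinerary [s] are replaced by nearby rationals r(x_i), and E is
    corrected so that r(x_i) is sent exactly to r(x_(i+1)). The derivatives there are made rational
    at the same time. *)
Lemma treat_word e L n s eta : adm e -> 0 < eta -> (1 <= n)%nat -> treated e L ->
  exists d L', coefb d eta /\ incl L L' /\ agree e (fun k => e k + d k) L /\
    treated (fun k => e k + d k) L' /\ rational_orbit (fun k => e k + d k) L' n s.
Proof.
  intros He Heta Hn HT. pose proof (adm_coefb e He) as Hg.
  destruct (itinerary_exists e n s He Hn) as (x0 & Hx0 & Hs).
  set (x := fun i => Nat.iter i (fr e) x0).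
  assert (Hper : forall i, x (i + n)%nat = x i).
  { intros i. unfold x. rewrite Nat.iter_add, Hx0. reflexivity. }
  assert (Hred : forall i, exists j, (j < n)%nat /\ x i = x j).
  { intros i. induction i as [i IH] using (well_founded_induction Nat.lt_wf_0). destruct (le_lt_dec n i) as [Hi|Hi]; [|exists i; auto].
    destruct (IH (i - n)%nat ltac:(lia)) as (j & Hj & E). exists j. split; auto. rewrite <- E, <- (Hper (i - n)%nat). f_equal. lia. }
  assert (Hb : forall i, Rabs (x i) < 1) by (apply (periodic_bounded e n x0 He Hn Hx0)).
  assert (Hb2 : forall i, Rabs (x i) * Rabs (x i) <= 11 / 16 /\ / 2 < Rabs (x i)).
  { intros i. pose proof (fC_region e (RtoC (x i)) He) as HR. rewrite fC_real, !Cmod_R in HR.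
    apply HR; apply Rlt_le; [apply Hb|apply (Hb (S i))]. }
  (* Distinct points of the cycle have distinct squares: equal squares give equal images, and going
     once around the cycle gives equal points. So the interpolation nodes are distinct. *)
  assert (Hinj : forall i j, x i * x i = x j * x j -> x i = x j).
  { intros i j E.
    assert (E1 : forall m, x (S m + i)%nat = x (S m + j)%nat).
    { induction m. simpl. unfold fr. fold (x i) (x j). rewrite E. reflexivity.
      change (fr e (x (S m + i)%nat) = fr e (x (S m + j)%nat)). rewrite IHm. reflexivity. }
    rewrite <- (Hper i), <- (Hper j). specialize (E1 (pred n)).
    replace (S (pred n)) with n in E1 by lia. rewrite !(Nat.add_comm n) in E1. exact E1. }
  set (X := nodup Req_dec_T (map x (seq 0 n))).
  assert (HX : forall t, In t X <-> exists i, t = x i).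
  { intros t. unfold X. rewrite nodup_In, in_map_iff. split.
    - intros (i & <- & _). exists i. reflexivity.
    - intros (i & ->). destruct (Hred i) as (j & Hj & ->). exists j. split; auto. apply in_seq. lia. }
  assert (Hdec : forall t, {In (t * t) L} + {~ In (t * t) L}) by (intros; apply excluded_middle_informative).
  (* Points whose squares are treated are left out: E may no longer change there, and such points
     are already rational. *)
  set (X' := filter (fun t => if Hdec t then false else true) X).
  assert (HX' : forall t, In t X' <-> In t X /\ ~ In (t * t) L).
  { intros t. unfold X'. rewrite filter_In. destruct (Hdec t); intuition congruence. }
  destruct (hermite_perturb L X' (fun t => t * t) eta Heta) as (del & Hdel & HH).
  { apply NoDup_filter, NoDup_nodup. }
  { intros t Ht. apply HX', Ht. }
  { intros t t' Ht Ht' E. apply HX' in Ht. apply HX' in Ht'.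
    destruct (proj1 (HX t) (proj1 Ht)) as [i ->]. destruct (proj1 (HX t') (proj1 Ht')) as [j ->]. apply Hinj, E. }
  (* Since 1/2 < |x_i| <= 5/6, a shift by 1/12 keeps points in the disk and preserves signs. The
     prescribed change of E is at most rho + 9 (2 rho) = 19 rho, below [del]. *)
  set (rho := Rmin (/ 12) (del / 20)).
  assert (Hrho : 0 < rho) by (apply Rmin_pos; lra).
  assert (Hrho1 : rho <= / 12) by apply Rmin_l.
  assert (Hrho2 : rho <= del / 20) by apply Rmin_r.
  (* Rational points must be fixed: the orbit may pass through treated points, whose images cannot
     be adjusted. *)
  assert (Happ : forall t, exists r, RQ r /\ Rabs (r - t) < rho /\ (RQ t -> r = t)).
  { intros t. destruct (classic (RQ t)) as [Ht|Ht].
    - exists t. replace (t - t) with 0 by ring. rewrite Rabs_R0. auto.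
    - destruct (RQ_dense t rho Hrho) as (r & R1 & R2). exists r. intuition. }
  apply choice in Happ. destruct Happ as [r Hr].
  assert (Hder : forall t, exists b, RQ (Er (shift e) (r t * r t) + b) /\ Rabs b <= del).
  { intros t. destruct (RQ_dense (Er (shift e) (r t * r t)) del Hdel) as (b & B1 & B2).
    exists (b - Er (shift e) (r t * r t)). split; [|lra].
    replace (Er (shift e) (r t * r t) + (b - Er (shift e) (r t * r t))) with b by ring. exact B1. }
  apply choice in Hder. destruct Hder as [b Hbb].
  assert (Hrx : forall i, Rabs (r (x i) - x i) <= rho /\ Rabs (r (x i)) <= 1 /\ Rabs (r (x i)) < 1 /\
     Rabs (r (x i) * r (x i) - x i * x i) <= 2 * rho).
  { intros i. destruct (Hr (x i)) as (_ & R2 & _). destruct (Hb2 i) as [B1 B2].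
    pose proof (Rabs_triang (r (x i) - x i) (x i)) as HT3.
    replace (r (x i) - x i + x i) with (r (x i)) in HT3 by ring.
    assert (Rabs (x i) <= 5 / 6) by nra.
    repeat split; try lra.
    replace (r (x i) * r (x i) - x i * x i) with ((r (x i) - x i) * (r (x i) + x i)) by ring.
    rewrite Rabs_mult. pose proof (Rabs_triang (r (x i)) (x i)). pose proof (Rabs_pos (r (x i) - x i)).
    pose proof (Rabs_pos (r (x i) + x i)). nra. }
  destruct (HH (fun t => r t * r t) (fun t => r (fr e t) - hr e (r t * r t)) b) as (d & D1 & D2 & D3).
  { intros t Ht. apply HX' in Ht. destruct (proj1 (HX t) (proj1 Ht)) as [i ->].
    destruct (Hrx i) as (R1 & R2 & R3 & R4). split; [lra|]. split; [|apply Hbb].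
    change (fr e (x i)) with (x (S i)).
    destruct (Hrx (S i)) as (S1 & _).
    assert (HL : Rabs (hr e (x i * x i) - hr e (r (x i) * r (x i))) <= 9 * (2 * rho)).
    { eapply Rle_trans; [apply (hr_lip e _ _ He)|].
      - rewrite Rabs_mult. pose proof (Hb i). pose proof (Rabs_pos (x i)). nra.
      - rewrite Rabs_mult. pose proof (Rabs_pos (r (x i))). nra.
      - rewrite Rabs_minus_sym. lra. }
    change (hr e (x i * x i)) with (x (S i)) in HL.
    pose proof (Rabs_triang (r (x (S i)) - x (S i)) (x (S i) - hr e (r (x i) * r (x i)))) as HT3.
    replace (r (x (S i)) - x (S i) + (x (S i) - hr e (r (x i) * r (x i)))) with (r (x (S i)) - hr e (r (x i) * r (x i))) in HT3 by ring.
    lra. }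
  set (e' := fun k => e k + d k).
  assert (HA : agree e e' L) by (apply (agree_perturb e d _ eta L Hg D1 D2)).
  (* At a treated point E is unchanged and both the point and its image are rational, hence fixed by
     [r]; at the other points the interpolated value gives the claim. *)
  assert (Hf' : forall i, In (r (x i) * r (x i)) (L ++ map (fun t => r t * r t) X') /\ fr e' (r (x i)) = r (x (S i))).
  { intros i. destruct (Hdec (x i)) as [Hi|Hi].
    - destruct (HT _ Hi) as ((q & Hq & Eq) & Hv & _).
      assert (Hxi : RQ (x i)).
      { assert (Hz : (x i - q) * (x i + q) = 0) by lra. apply Rmult_integral in Hz. destruct Hz as [Hz|Hz].
        - replace (x i) with q by lra. exact Hq.
        - replace (x i) with (- q) by lra. apply RQ_opp, Hq. }
      destruct (Hr (x i)) as (_ & _ & Ri). rewrite (Ri Hxi). split; [apply in_or_app; auto|].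
      unfold fr, hr. rewrite (proj1 (HA _ Hi)). change (x (S i) = r (x (S i))).
      symmetry. apply Hr. apply RQ_hr; [apply RQ_mult|]; auto.
    - assert (Hi' : In (x i) X') by (apply HX'; split; auto; apply HX; eauto).
      split; [apply in_or_app; right; apply (in_map (fun t => r t * r t)), Hi'|].
      unfold fr, hr, e'. rewrite (Er_plus _ _ _ _ _ Hg D1), (proj1 (D3 _ Hi')).
      unfold hr. change (fr e (x i)) with (x (S i)). ring. }
  exists d, (L ++ map (fun t => r t * r t) X').
  split; [exact D1|]. split; [apply incl_appl, incl_refl|]. split; [exact HA|]. split.
  - intros u Hu. apply in_app_or in Hu. destruct Hu as [Hu|Hu]; [apply (treated_agree _ _ _ HA HT u Hu)|].
    apply in_map_iff in Hu. destruct Hu as (t & <- & Ht).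
    split; [exists (r t); split; auto; apply Hr|].
    fold e'. split.
    + assert (Ht2 := proj1 (HX' t) Ht). destruct (proj1 (HX t) (proj1 Ht2)) as [i ->].
      pose proof (proj2 (Hf' i)) as Hf. unfold fr, hr in Hf.
      replace (Er e' (r (x i) * r (x i))) with (r (x (S i)) - (8 * (r (x i) * r (x i)) - 4)) by lra.
      apply RQ_minus; [apply Hr|]. apply RQ_minus; [apply RQ_mult; [apply (RQ_IZR 8)|apply RQ_mult; apply Hr]|apply (RQ_IZR 4)].
    + unfold e'. rewrite (Er_shift_plus _ _ _ _ _ Hg D1), (proj2 (D3 t Ht)). apply Hbb.
  - exists (r x0).
    assert (HI : forall i, Nat.iter i (fr e') (r x0) = r (x i)).
    { induction i; [reflexivity|]. simpl. rewrite IHi. apply Hf'. }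
    fold e'. split.
    + rewrite HI. f_equal. exact Hx0.
    + intros i Hi. rewrite HI. split; [apply Hr|]. split; [apply Hf'|].
      destruct (Hrx i) as (R1 & R2 & R3 & R4). split; [exact R3|].
      (* The side gives |x_i| > 1/2, so a shift by at most 1/12 does not change the sign. *)
      specialize (Hs i Hi). fold (x i) in Hs. apply Rabs_le_between in R1.
      destruct (s i); simpl in Hs; lra.
Qed.

(** * Enumeration of all tasks and the limit of the corrections *)

(** Words of length [n] are encoded by the binary digits of a number, so that pairs of naturals
    enumerate all finite itineraries. *)
Lemma testbit_realize n (s : nat -> bool) : exists N, forall i, (i < n)%nat -> Nat.testbit N i = s i.
Proof.
  revert s. induction n; intros s. exists O. lia.
  destruct (IHn (fun i => s (S i))) as [N HN].
  exists (if s O then 2 * N + 1 else 2 * N)%nat. intros [|i] Hi.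
  - destruct (s O); [apply Nat.testbit_odd_0|apply Nat.testbit_even_0].
  - destruct (s O); [rewrite Nat.testbit_odd_succ|rewrite Nat.testbit_even_succ]; try apply HN; lia.
Qed.

(** Midpoint of the band in [adm], whose half-width is 1/128 in units of 1/k!. *)
Definition center (k : nat) : R := 3 / 128 * / INR (fact k).

Definition state : Type := ((nat -> R) * list R)%type.

Definition stage_inv (m : nat) (st : state) : Prop :=
  coefb (fun k => fst st k - center k) (/ 128 * (1 - (/ 2) ^ m)) /\ treated (fst st) (snd st).

(** The Cantor decoding (p, N) of [m] serves twice: as the rational p / (N + 1) and as the word of
    length p with the digits of N. Nonnegative rationals suffice because only q^2 occurs. *)
Definition stage (m : nat) (st st' : state) : Prop :=
  coefb (fun k => fst st' k - fst st k) (/ 128 * (/ 2) ^ S m) /\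
  incl (snd st) (snd st') /\ agree (fst st) (fst st') (snd st) /\ treated (fst st') (snd st') /\
  (let q := INR (fst (of_nat m)) * / INR (S (snd (of_nat m))) in In (q * q) (snd st')) /\
  let n := fst (of_nat m) in
  (1 <= n)%nat -> rational_orbit (fst st') (snd st') n (Nat.testbit (snd (of_nat m))).

Lemma coefb_le e M M' : M <= M' -> coefb e M -> coefb e M'.
Proof.
  intros HM H k. eapply Rle_trans; [apply H|]. apply Rmult_le_compat_r; [apply Rlt_le, inv_fact_pos|exact HM].
Qed.

Lemma coefb_ext e e' M : (forall k, e k = e' k) -> coefb e M -> coefb e' M.
Proof. intros HE H k. rewrite <- HE. apply H. Qed.

Lemma adm_center e M : M <= / 128 -> coefb (fun k => e k - center k) M -> adm e.
Proof.
  intros HM H k. specialize (H k). pose proof (inv_fact_pos k). unfold center in H.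
  assert (M * / INR (fact k) <= / 128 * / INR (fact k)) by (apply Rmult_le_compat_r; lra).
  apply Rabs_le_between in H. lra.
Qed.

Lemma agree_trans e e' e'' L L' : incl L L' -> agree e e' L -> agree e' e'' L' -> agree e e'' L.
Proof.
  intros HL H1 H2 u Hu. destruct (H1 u Hu) as [E1 E2]. destruct (H2 u (HL u Hu)) as [E3 E4].
  split; congruence.
Qed.

Lemma stage_exists m st : stage_inv m st -> exists st', stage m st st'.
Proof.
  destruct st as [e L]. intros [Hc HT]. simpl in Hc, HT.
  pose proof (half_pow_pos m) as Hp.
  assert (Ha : adm e) by (apply (adm_center e (/ 128 * (1 - (/ 2) ^ m))); [nra|exact Hc]).
  set (q := INR (fst (of_nat m)) * / INR (S (snd (of_nat m)))).
  assert (Hq : RQ q).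
  { apply RQ_mult; [rewrite INR_IZR_INZ; apply RQ_IZR|apply RQ_inv_INR]. }
  (* The budget of the stage is shared equally between the rational and the word. *)
  assert (Heta : 0 < / 128 * (/ 2) ^ S m / 2) by (simpl; lra).
  destruct (treat_rational e _ L q _ (adm_coefb e Ha) Heta Hq HT) as (d & L1 & D1 & D2 & D3 & D4 & D5).
  set (e1 := fun k => e k + d k) in *.
  destruct (le_lt_dec 1 (fst (of_nat m))) as [Hn|Hn].
  - assert (Ha1 : adm e1).
    { apply (adm_center e1 (/ 128 * (1 - (/ 2) ^ m) + / 128 * (/ 2) ^ S m / 2)). simpl; lra.
      eapply coefb_ext; [|apply (coefb_plus _ _ _ _ Hc D1)]. intros k. unfold e1. ring. }
    destruct (treat_word e1 L1 (fst (of_nat m)) (Nat.testbit (snd (of_nat m))) _ Ha1 Heta Hn D4)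
      as (d' & L2 & E1 & E2 & E3 & E4 & E5).
    exists (fun k => e1 k + d' k, L2). split; [|split; [|split; [|split; [|split]]]]; simpl fst; simpl snd.
    + replace (/ 128 * (/ 2) ^ S m) with (/ 128 * (/ 2) ^ S m / 2 + / 128 * (/ 2) ^ S m / 2) by lra.
      eapply coefb_ext; [|apply (coefb_plus _ _ _ _ D1 E1)]. intros k. unfold e1. simpl. ring.
    + apply (incl_tran D2 E2).
    + apply (agree_trans _ _ _ _ _ D2 D3 E3).
    + exact E4.
    + apply E2, D5.
    + cbv zeta. intros _. exact E5.
  - exists (e1, L1). split; [|split; [|split; [|split; [|split]]]]; simpl fst; simpl snd; auto.
    + eapply coefb_le; [|eapply coefb_ext; [|exact D1]]; [lra|]. intros k. unfold e1. simpl. ring.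
    + cbv zeta. intros H. lia.
Qed.

Lemma arithmetic_series : exists e, adm e /\
  (forall q, RQ q -> RQ (Er e (q * q)) /\ RQ (Er (shift e) (q * q))) /\
  (forall n s, (1 <= n)%nat -> exists L, rational_orbit e L n s).
Proof.
  (* [choice] needs a successor for every pair; where the invariant fails, the state itself serves
     as a default. *)
  assert (Hstep : forall p : nat * state, exists st', stage_inv (fst p) (snd p) -> stage (fst p) (snd p) st').
  { intros [m st]. destruct (classic (stage_inv m st)) as [H|H].
    - destruct (stage_exists m st H) as [st' H']. exists st'. auto.
    - exists st. intros H'. contradiction. }
  apply choice in Hstep. destruct Hstep as [next Hnext].
  set (st := fix st m := match m with O => (center, nil) : state | S m => next (m, st m) end).
  assert (Hinv : forall m, stage_inv m (st m)).
  { induction m as [|m [I1 I2]].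
    - split; [|intros u []]. intros k. simpl. replace (center k - center k) with 0 by ring. rewrite Rabs_R0. lra.
    - destruct (Hnext (m, st m) (conj I1 I2)) as (S1 & _ & _ & S4 & _). simpl in S1, S4. split; [|exact S4].
      replace (/ 128 * (1 - (/ 2) ^ S m)) with (/ 128 * (1 - (/ 2) ^ m) + / 128 * (/ 2) ^ S m) by (simpl; lra).
      eapply coefb_ext; [|apply (coefb_plus _ _ _ _ I1 S1)]. intros k. simpl. ring. }
  assert (Hst : forall m, stage m (st m) (st (S m))) by (intros m; apply (Hnext (m, st m)), Hinv).
  (* The corrections from stage [m] on telescope, which gives both convergence and the distance to
     the limit. *)
  assert (Hcau : forall m j, coefb (fun k => fst (st (m + j)%nat) k - fst (st m) k) (/ 128 * ((/ 2) ^ m - (/ 2) ^ (m + j)))).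
  { intros m. induction j.
    - rewrite Nat.add_0_r. intros k. replace (_ - _) with 0 by ring. rewrite Rabs_R0. lra.
    - rewrite Nat.add_succ_r. destruct (Hst (m + j)%nat) as [S1 _].
      replace (/ 128 * ((/ 2) ^ m - (/ 2) ^ S (m + j))) with
        (/ 128 * ((/ 2) ^ m - (/ 2) ^ (m + j)) + / 128 * (/ 2) ^ S (m + j)) by (simpl; lra).
      eapply coefb_ext; [|apply (coefb_plus _ _ _ _ IHj S1)]. intros k. simpl. ring. }
  assert (Hagr : forall m j, agree (fst (st m)) (fst (st (m + j)%nat)) (snd (st m)) /\ incl (snd (st m)) (snd (st (m + j)%nat))).
  { intros m. induction j as [|j [J1 J2]].
    - rewrite Nat.add_0_r. split; [intros u _; auto|apply incl_refl].
    - rewrite Nat.add_succ_r. destruct (Hst (m + j)%nat) as (_ & S2 & S3 & _). split.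
      + apply (agree_trans _ _ _ _ _ J2 J1 S3).
      + apply (incl_tran J2 S2). }
  assert (Hlim : forall k, exists l : R, is_lim_seq (fun m => fst (st m) k) l).
  { intros k. apply ex_lim_seq_cauchy_corr. intros [eps He].
    destruct (half_pow_small 1 eps Rle_0_1 He) as [N HN].
    assert (HNb : forall n, (N <= n)%nat -> Rabs (fst (st n) k - fst (st N) k) < eps / 2).
    { intros n Hn. replace n with (N + (n - N))%nat by lia.
      eapply Rle_lt_trans; [apply (Hcau N (n - N)%nat k)|].
      pose proof (half_pow_pos N). pose proof (half_pow_pos (N + (n - N))).
      assert (/ INR (fact k) <= 1).
      { rewrite <- Rinv_1. apply Rinv_le_contravar; [lra|]. apply (le_INR 1). pose proof (lt_O_fact k). lia. }
      pose proof (inv_fact_pos k). nra. }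
    exists N. intros n n' Hn Hn'. simpl. pose proof (HNb n Hn). pose proof (HNb n' Hn') as H2.
    pose proof (Rabs_triang (fst (st n) k - fst (st N) k) (fst (st N) k - fst (st n') k)) as HT.
    rewrite (Rabs_minus_sym (fst (st N) k) (fst (st n') k)) in HT.
    replace (fst (st n) k - fst (st N) k + (fst (st N) k - fst (st n') k)) with (fst (st n) k - fst (st n') k) in HT by ring.
    lra. }
  apply choice in Hlim. destruct Hlim as [e He].
  assert (Hclose : forall m, coefb (fun k => e k - fst (st m) k) (/ 128 * (/ 2) ^ m)).
  { intros m k.
    assert (HL : is_lim_seq (fun j => Rabs (fst (st (m + j)%nat) k - fst (st m) k)) (Rabs (e k - fst (st m) k))).
    { apply (is_lim_seq_abs _ (e k - fst (st m) k)). apply is_lim_seq_minus'; [|apply is_lim_seq_const].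
      apply (is_lim_seq_ext (fun j => fst (st (j + m)%nat) k)); [intros j; rewrite Nat.add_comm; reflexivity|].
      apply (proj1 (is_lim_seq_incr_n (fun j => fst (st j) k) m (e k))). apply He. }
    apply (is_lim_seq_le _ (fun _ => / 128 * (/ 2) ^ m * / INR (fact k)) (Rabs (e k - fst (st m) k)) (/ 128 * (/ 2) ^ m * / INR (fact k))) in HL; auto.
    - intros j. eapply Rle_trans; [apply (Hcau m j k)|]. pose proof (half_pow_pos (m + j)).
      apply Rmult_le_compat_r; [apply Rlt_le, inv_fact_pos|lra].
    - apply is_lim_seq_const. }
  assert (Ha : adm e).
  { apply (adm_center e (/ 128)); [lra|]. apply (coefb_le _ (/ 128 * (/ 2) ^ 0)); [simpl; lra|]. apply (Hclose O). }
  assert (Hstm : forall m, adm (fst (st m))).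
  { intros m. destruct (Hinv m) as [I1 _]. eapply (adm_center _ _); [|exact I1]. pose proof (half_pow_pos m). lra. }
  (* On the list of stage [m], every later stage agrees exactly with stage [m]. The difference to
     the limit therefore equals that of stage [m + j] for each [j], which tends to 0. *)
  assert (Hfin : forall m, agree (fst (st m)) e (snd (st m))).
  { intros m u Hu.
    assert (HK : forall j, Rabs (Er e u - Er (fst (st m)) u) <= / 128 * (/ 2) ^ j * exp (Rabs u) /\
       Rabs (Er (shift e) u - Er (shift (fst (st m))) u) <= / 128 * (/ 2) ^ j * exp (Rabs u)).
    { intros j. destruct (proj1 (Hagr m j) u Hu) as [<- <-].
      assert (Hd : coefb (fun k => e k - fst (st (m + j)%nat) k) (/ 128 * (/ 2) ^ j)).
      { eapply coefb_le; [|apply Hclose]. rewrite pow_add.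
        assert ((/ 2) ^ m <= 1) by (rewrite <- (pow1 m); apply pow_incr; lra). pose proof (half_pow_pos j). nra. }
      assert (Hx : forall k, e k = fst (st (m + j)%nat) k + (e k - fst (st (m + j)%nat) k)) by (intros; ring).
      set (e1 := fst (st (m + j)%nat)) in *. set (d := fun k => e k - e1 k) in *.
      assert (E1 : Er e u = Er e1 u + Er d u).
      { rewrite (Er_ext _ _ u Hx). apply (Er_plus e1 d _ _ u (adm_coefb _ (Hstm (m + j)%nat)) Hd). }
      assert (E2 : Er (shift e) u = Er (shift e1) u + Er (shift d) u).
      { rewrite (Er_ext (shift e) (shift (fun k => e1 k + d k)) u) by (intros k; unfold shift, d; ring).
        apply (Er_shift_plus e1 d _ _ u (adm_coefb _ (Hstm (m + j)%nat)) Hd). }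
      rewrite E1, E2. split.
      - replace (_ + _ - _) with (Er d u) by ring. apply Er_bound, Hd.
      - replace (_ + _ - _) with (Er (shift d) u) by ring.
        apply Er_bound, coefb_shift, Hd. }
    assert (Hz : forall t, (forall j, Rabs t <= / 128 * (/ 2) ^ j * exp (Rabs u)) -> t = 0).
    { intros t Ht. apply Rabs_eq_0, Rle_antisym; [|apply Rabs_pos]. apply Rle_eps0. intros eps Heps.
      pose proof (exp_pos (Rabs u)).
      destruct (half_pow_small (exp (Rabs u)) eps) as [N HN]; try lra.
      specialize (Ht N). pose proof (half_pow_pos N).
      assert (0 < (/ 2) ^ N * exp (Rabs u)) by (apply Rmult_lt_0_compat; auto). lra. }
    pose proof (Hz _ (fun j => proj1 (HK j))). pose proof (Hz _ (fun j => proj2 (HK j))). split; lra. }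
  exists e. split; [exact Ha|]. split.
  - intros q Hq.
    assert (Hm : exists m, In (q * q) (snd (st (S m)))).
    { destruct Hq as [[a b] ->].
      (* The sign of the numerator is lost in q^2, and the denominator is lowered by one to match p
         / (N + 1). *)
      exists (to_nat (Z.abs_nat a, pred (Pos.to_nat b))).
      destruct (Hst (to_nat (Z.abs_nat a, pred (Pos.to_nat b)))) as (_ & _ & _ & _ & S5 & _).
      rewrite cancel_of_to in S5. cbv zeta in S5. cbn [fst snd] in S5.
      replace (Q2R (a # b) * Q2R (a # b)) with
        (INR (Z.abs_nat a) * / INR (S (pred (Pos.to_nat b))) * (INR (Z.abs_nat a) * / INR (S (pred (Pos.to_nat b))))); [exact S5|].
      replace (S (pred (Pos.to_nat b))) with (Pos.to_nat b) by lia.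
      replace (INR (Z.abs_nat a)) with (Rabs (IZR a)) by (rewrite <- abs_IZR, INR_IZR_INZ; f_equal; lia).
      replace (INR (Pos.to_nat b)) with (IZR (Z.pos b)) by (rewrite INR_IZR_INZ; f_equal; lia).
      unfold Q2R. simpl.
      assert (HS : Rabs (IZR a) * Rabs (IZR a) = IZR a * IZR a) by (rewrite <- Rabs_mult; apply Rabs_pos_eq, Rle_0_sqr).
      transitivity (Rabs (IZR a) * Rabs (IZR a) * (/ IZR (Z.pos b) * / IZR (Z.pos b))); [ring|].
      rewrite HS. ring. }
    destruct Hm as [m Hm]. destruct (Hfin (S m) _ Hm) as [-> ->].
    apply (proj2 (Hinv (S m)) _ Hm).
  - intros n s Hn. destruct (testbit_realize n s) as [N HN].
    set (m := to_nat (n, N)). exists (snd (st (S m))).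
    destruct (Hst m) as (_ & _ & _ & _ & _ & S6). unfold m in S6. rewrite cancel_of_to in S6. fold m in S6. cbv zeta in S6. cbn [fst snd] in S6.
    apply (rational_orbit_agree (fst (st (S m))) e (snd (st (S m)))); auto using incl_refl.
    destruct (S6 Hn) as (y & Y1 & Y2). exists y. split; [exact Y1|].
    intros i Hi. rewrite <- (HN i Hi). apply Y2, Hi.
Qed.

(** * Goursat's theorem on rectangles *)

Notation dC := (@ex_derive C_AbsRing C_NormedModule).

Lemma dC_const (c z : C) : dC (fun _ => c) z.
Proof.
  exists (RtoC 0). apply is_derive_C. intros e He. exists 1. split; [lra|]. intros y _.
  replace (c - c - 0 * (y - z))%C with (RtoC 0) by ring. rewrite Cmod_0. pose proof (Cmod_ge_0 (y - z)). nra.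
Qed.

Lemma dC_affine (a b z : C) : dC (fun u => a * u + b)%C z.
Proof. exists a. apply isdC_affine. Qed.

Lemma dC_ext (f g : C -> C) (z : C) : (forall u, f u = g u) -> dC f z -> dC g z.
Proof. intros H [l Hl]. exists l. eapply is_derive_ext; [|exact Hl]. exact H. Qed.

Lemma dC_plus (f g : C -> C) (z : C) : dC f z -> dC g z -> dC (fun u => f u + g u)%C z.
Proof. intros [a Ha] [b Hb]. exists (a + b)%C. apply isdC_plus; auto. Qed.

Lemma dC_comp (f g : C -> C) (z : C) : dC f (g z) -> dC g z -> dC (fun u => f (g u)) z.
Proof. intros [a Ha] [b Hb]. exists (a * b)%C. apply isdC_comp; auto. Qed.

Lemma dC_scal (c : C) (f : C -> C) (z : C) : dC f z -> dC (fun u => c * f u)%C z.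
Proof.
  intros H. apply (dC_ext (fun u => c * f u + 0)%C); [intros; ring|].
  apply (dC_comp (fun u => c * u + 0)%C f z); auto. apply dC_affine.
Qed.

Lemma dC_minus (f g : C -> C) (z : C) : dC f z -> dC g z -> dC (fun u => f u - g u)%C z.
Proof.
  intros Hf Hg. apply (dC_ext (fun u => f u + - (1) * g u)%C); [intros; ring|].
  apply dC_plus; auto. apply dC_scal, Hg.
Qed.

Lemma isdC_mult (f g : C -> C) (z a b : C) :
  isdC f z a -> isdC g z b -> isdC (fun u => f u * g u)%C z (a * g z + f z * b)%C.
Proof.
  intros [_ Hf] [_ Hg].
  destruct (@is_derive_mult C_AbsRing f g z a b (conj (is_linear_scal_l _) Hf) (conj (is_linear_scal_l _) Hg) Cmult_comm)
    as [_ H].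
  split; [apply is_linear_scal_l|exact H].
Qed.

Lemma dC_mult (f g : C -> C) (z : C) : dC f z -> dC g z -> dC (fun u => f u * g u)%C z.
Proof. intros [a Ha] [b Hb]. eexists. apply isdC_mult; eassumption. Qed.

Lemma isdC_inv (z : C) : z <> 0 -> isdC Cinv z (- / (z * z))%C.
Proof.
  intros Hz. apply is_derive_C. intros e He. pose proof (proj1 (Cmod_gt_0 z) Hz) as Hm.
  set (m := Cmod z) in *.
  exists (Rmin (m / 2) (e * (m * m * m) / 2)).
  assert (0 < m * m * m) by (repeat apply Rmult_lt_0_compat; lra).
  split; [apply Rmin_pos; [lra|]; apply Rdiv_lt_0_compat; [apply Rmult_lt_0_compat; lra|lra]|].
  intros y Hy. pose proof (Rlt_le_trans _ _ _ Hy (Rmin_l _ _)) as Hy1.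
  pose proof (Rlt_le_trans _ _ _ Hy (Rmin_r _ _)) as Hy2.
  pose proof (Cmod_triangle_inv z y) as HT. rewrite (Cmod_minus_sym z y) in HT. fold m in HT.
  assert (Hym : m / 2 < Cmod y) by lra.
  assert (Hy0 : y <> 0) by (apply Cmod_gt_0; lra).
  replace (/ y - / z - - / (z * z) * (y - z))%C with ((y - z) * (y - z) / (z * z * y))%C by (field; auto).
  rewrite Cmod_div by (repeat apply Cmult_neq_0; auto). rewrite !Cmod_mult. fold m.
  pose proof (Cmod_ge_0 (y - z)) as H0. set (t := Cmod (y - z)) in *.
  assert (Hd : m * m * (m / 2) <= m * m * Cmod y) by (apply Rmult_le_compat_l; [nra|lra]).
  apply (Rmult_le_reg_r (m * m * Cmod y)); [nra|].
  replace (t * t / (m * m * Cmod y) * (m * m * Cmod y)) with (t * t) by (field; lra).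
  apply Rle_trans with (e * t * (m * m * (m / 2))); [|apply Rmult_le_compat_l; [nra|exact Hd]]. nra.
Qed.

Lemma dC_inv (f : C -> C) (z : C) : f z <> 0 -> dC f z -> dC (fun u => / f u)%C z.
Proof.
  intros H0 Hf. apply (dC_comp Cinv f z); auto. eexists. apply isdC_inv, H0.
Qed.

Lemma dC_pow (f : C -> C) n (z : C) : dC f z -> dC (fun u => Cpow (f u) n) z.
Proof.
  intros H. induction n. apply (dC_const (RtoC 1) z). apply (dC_mult f (fun u => Cpow (f u) n)); auto.
Qed.

Lemma dC_continuous (f : C -> C) (z : C) : dC f z -> continuous f z.
Proof. intros [l Hl]. eapply derive_continuous_C, Hl. Qed.

(** * Integrals over the boundary of a rectangle *)

Definition CI (g : R -> C) (a b : R) : C := (RInt (fun t => Re (g t)) a b, RInt (fun t => Im (g t)) a b).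

Definition cR (g : R -> C) (a b : R) : Prop := forall t, a <= t <= b ->
  continuous (fun s => Re (g s)) t /\ continuous (fun s => Im (g s)) t.

Lemma cR_ex (g : R -> C) a b : a <= b -> cR g a b ->
  ex_RInt (fun t => Re (g t)) a b /\ ex_RInt (fun t => Im (g t)) a b.
Proof.
  intros Hab H. split; apply (@ex_RInt_continuous R_CompleteNormedModule); intros z;
  rewrite Rmin_left, Rmax_right by lra; intros Hz; apply H, Hz.
Qed.

Lemma CI_ext g h a b : a <= b -> (forall t, a <= t <= b -> g t = h t) -> CI g a b = CI h a b.
Proof.
  intros Hab H. unfold CI. f_equal; apply RInt_ext; intros t; rewrite Rmin_left, Rmax_right by lra;
  intros Ht; rewrite H by lra; reflexivity.
Qed.

Lemma CI_plus g h a b : a <= b -> cR g a b -> cR h a b -> CI (fun t => g t + h t)%C a b = (CI g a b + CI h a b)%C.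
Proof.
  intros Hab Hg Hh. destruct (cR_ex g a b Hab Hg). destruct (cR_ex h a b Hab Hh).
  unfold CI, Cplus; simpl. f_equal.
  - apply (RInt_plus (fun t => Re (g t)) (fun t => Re (h t))); auto.
  - apply (RInt_plus (fun t => Im (g t)) (fun t => Im (h t))); auto.
Qed.

Lemma CI_scal (c : C) g a b : a <= b -> cR g a b -> CI (fun t => c * g t)%C a b = (c * CI g a b)%C.
Proof.
  intros Hab Hg. destruct (cR_ex g a b Hab Hg) as [H1 H2].
  destruct c as [x y].
  assert (HS : forall h w, ex_RInt h a b -> is_RInt (fun t => w * h t) a b (w * RInt h a b)).
  { intros h w Hh. apply (@is_RInt_scal R_NormedModule h a b w (RInt h a b)).
    apply (@RInt_correct R_CompleteNormedModule), Hh. }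
  unfold CI, Cmult; simpl. f_equal; apply is_RInt_unique.
  - apply (@is_RInt_minus R_NormedModule _ _ a b _ _ (HS _ x H1) (HS _ y H2)).
  - apply (@is_RInt_plus R_NormedModule _ _ a b _ _ (HS _ x H2) (HS _ y H1)).
Qed.

Lemma CI_chasles g a m b : a <= m <= b -> cR g a b -> CI g a b = (CI g a m + CI g m b)%C.
Proof.
  intros Hm Hg.
  destruct (cR_ex g a m) as [H1 H2]; [lra|intros t Ht; apply Hg; lra|].
  destruct (cR_ex g m b) as [H3 H4]; [lra|intros t Ht; apply Hg; lra|].
  unfold CI, Cplus; simpl. f_equal; symmetry; apply (@RInt_Chasles R_CompleteNormedModule); auto.
Qed.

Lemma Cmod_le_abs (z : C) : Cmod z <= Rabs (Re z) + Rabs (Im z).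
Proof.
  destruct z as [x y]. replace ((x, y) : C) with (RtoC x + Ci * RtoC y)%C.
  - eapply Rle_trans; [apply Cmod_triangle|]. rewrite Cmod_mult, Cmod_Ci, !Cmod_R. simpl.
    rewrite Rmult_1_l, ?Rmult_0_l, ?Rmult_1_l, ?Rplus_0_r, ?Rplus_0_l, ?Rminus_0_r. apply Req_le.
    f_equal; f_equal; ring.
  - unfold Cplus, Cmult, RtoC, Ci; simpl. f_equal; ring.
Qed.

(** Real and imaginary parts are bounded separately, whence the factor 2; sharp constants do not
    matter below. *)
Lemma CI_bound g a b M : a <= b -> cR g a b -> (forall t, a <= t <= b -> Cmod (g t) <= M) ->
  Cmod (CI g a b) <= 2 * M * (b - a).
Proof.
  intros Hab Hg HM. destruct (cR_ex g a b Hab Hg) as [H1 H2].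
  eapply Rle_trans; [apply Cmod_le_abs|]. unfold CI. simpl.
  assert (HB : forall h, ex_RInt h a b -> (forall t, a <= t <= b -> Rabs (h t) <= M) -> Rabs (RInt h a b) <= M * (b - a)).
  { intros h Hh Hb. rewrite Rmult_comm. apply (@norm_RInt_le_const R_NormedModule h a b (RInt h a b) M Hab); auto.
    apply (@RInt_correct R_CompleteNormedModule), Hh. }
  pose proof (HB _ H1 (fun t Ht => Rle_trans _ _ _ (re_le_Cmod (g t)) (HM t Ht))).
  pose proof (HB _ H2 (fun t Ht => Rle_trans _ _ _ (im_le_Cmod (g t)) (HM t Ht))). lra.
Qed.

Lemma CI_ftc (G g : R -> C) a b : a <= b -> cR g a b ->
  (forall t, a <= t <= b -> is_derive (fun s => Re (G s)) t (Re (g t)) /\ is_derive (fun s => Im (G s)) t (Im (g t))) ->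
  CI g a b = (G b - G a)%C.
Proof.
  intros Hab Hg HG. unfold CI, Cminus, Cplus, Copp. simpl. f_equal; apply is_RInt_unique.
  - apply (is_RInt_derive (fun s => Re (G s)) (fun s => Re (g s))); intros t; rewrite Rmin_left, Rmax_right by lra;
    intros Ht; [apply HG|apply Hg]; lra.
  - apply (is_RInt_derive (fun s => Im (G s)) (fun s => Im (g s))); intros t; rewrite Rmin_left, Rmax_right by lra;
    intros Ht; [apply HG|apply Hg]; lra.
Qed.

(** Restricting to a line reduces complex differentiation to real calculus, so that the real
    fundamental theorem applies to each component. *)
Lemma line_derive (F : C -> C) (p v l : C) t : isdC F (p + RtoC t * v)%C l ->
  is_derive (fun s => Re (F (p + RtoC s * v)%C)) t (Re (l * v)%C) /\
  is_derive (fun s => Im (F (p + RtoC s * v)%C)) t (Im (l * v)%C).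
Proof.
  intros H. rewrite is_derive_C in H.
  assert (HK : forall eps, 0 < eps -> exists d, 0 < d /\ forall h, h <> 0 -> Rabs h < d ->
    Cmod (F (p + RtoC (t + h) * v)%C - F (p + RtoC t * v)%C - RtoC h * (l * v)) < eps * Rabs h).
  { intros eps He. set (V := Cmod v + 1). assert (HV : 0 < V) by (unfold V; pose proof (Cmod_ge_0 v); lra).
    destruct (H (eps / V)) as (d & Hd & Hy); [apply Rdiv_lt_0_compat; auto|].
    exists (d / V). split; [apply Rdiv_lt_0_compat; auto|]. intros h Hh Hhd.
    assert (Hm : Cmod (p + RtoC (t + h) * v - (p + RtoC t * v)) = Rabs h * Cmod v).
    { rewrite RtoC_plus. replace (p + (RtoC t + RtoC h) * v - (p + RtoC t * v))%C with (RtoC h * v)%C by ring.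
      rewrite Cmod_mult, Cmod_R. reflexivity. }
    apply Rlt_div_r in Hhd; [|exact HV].
    pose proof (Rabs_pos_lt h Hh) as Hhp.
    specialize (Hy (p + RtoC (t + h) * v)%C). rewrite Hm in Hy.
    replace (RtoC h * (l * v))%C with (l * (p + RtoC (t + h) * v - (p + RtoC t * v)))%C by (rewrite RtoC_plus; ring).
    eapply Rle_lt_trans; [apply Hy; unfold V in Hhd; nra|].
    replace (eps / V * (Rabs h * Cmod v)) with (eps * Rabs h * (Cmod v / V)) by (field; lra).
    rewrite <- (Rmult_1_r (eps * Rabs h)) at 2. apply Rmult_lt_compat_l; [nra|].
    apply (Rmult_lt_reg_r V); auto. replace (Cmod v / V * V) with (Cmod v) by (field; lra). unfold V. lra. }
  (* [Re] and [Im] are treated together as real-linear maps not exceeding [Cmod]. *)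
  assert (HP : forall P : C -> R, (forall u, Rabs (P u) <= Cmod u) ->
    (forall u w h w', P (u - w - RtoC h * w')%C = P u - P w - h * P w') ->
    is_derive (fun s => P (F (p + RtoC s * v)%C)) t (P (l * v)%C)).
  { intros P P1 P2. apply is_derive_Reals. intros eps He. destruct (HK eps He) as (d & Hd & Hh).
    exists (mkposreal d Hd). intros h Hh0 Hhd. specialize (Hh h Hh0 Hhd). pose proof (Rabs_pos_lt h Hh0).
    match goal with |- Rabs ?e < _ => replace e with
      (P (F (p + RtoC (t + h) * v)%C - F (p + RtoC t * v)%C - RtoC h * (l * v))%C / h) end.
    2:{ rewrite P2. field. exact Hh0. }
    unfold Rdiv. rewrite Rabs_mult, Rabs_inv. apply (Rmult_lt_reg_r (Rabs h)); auto.
    rewrite Rmult_assoc, Rinv_l, Rmult_1_r by lra. eapply Rle_lt_trans; [apply P1|exact Hh]. }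
  split; apply HP; try apply re_le_Cmod; try apply im_le_Cmod; intros; unfold Re, Im; simpl; ring.
Qed.

Lemma hline (y t : R) : (t, y) = ((0, y) + RtoC t * 1)%C.
Proof. unfold Cplus, Cmult, RtoC; simpl. f_equal; ring. Qed.

Lemma vline (x t : R) : (x, t) = ((x, 0) + RtoC t * Ci)%C.
Proof. unfold Cplus, Cmult, RtoC, Ci; simpl. f_equal; ring. Qed.

Lemma continuous_line (k : C -> C) (p v : C) t : continuous k (p + RtoC t * v)%C ->
  continuous (fun s => Re (k (p + RtoC s * v)%C)) t /\ continuous (fun s => Im (k (p + RtoC s * v)%C)) t.
Proof.
  intros H. rewrite continuous_C in H.
  assert (HK : forall eps, 0 < eps -> exists d, 0 < d /\ forall s, Rabs (s - t) < d ->
    Cmod (k (p + RtoC s * v)%C - k (p + RtoC t * v)%C) < eps).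
  { intros eps He. set (V := Cmod v + 1). assert (HV : 0 < V) by (unfold V; pose proof (Cmod_ge_0 v); lra).
    destruct (H eps He) as (d & Hd & Hy). exists (d / V). split; [apply Rdiv_lt_0_compat; auto|].
    intros s Hs. apply Hy. replace (p + RtoC s * v - (p + RtoC t * v))%C with (RtoC (s - t) * v)%C by (rewrite RtoC_minus; ring).
    rewrite Cmod_mult, Cmod_R. apply Rlt_div_r in Hs; [|exact HV]. pose proof (Rabs_pos (s - t)). unfold V in Hs. nra. }
  split; intros P [[eps He] HP]; destruct (HK eps He) as (d & Hd & Hs); exists (mkposreal d Hd); intros s Hsd; apply HP.
  - eapply Rle_lt_trans; [|apply (Hs s Hsd)]. apply (re_le_Cmod (k (p + RtoC s * v)%C - k (p + RtoC t * v)%C)).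
  - eapply Rle_lt_trans; [|apply (Hs s Hsd)]. apply (im_le_Cmod (k (p + RtoC s * v)%C - k (p + RtoC t * v)%C)).
Qed.

Lemma cR_ext g h a b : (forall t, g t = h t) -> cR g a b -> cR h a b.
Proof.
  intros E H t Ht. destruct (H t Ht) as [H1 H2]. split.
  - apply (continuous_ext (fun s => Re (g s))); [intros s; rewrite E; reflexivity|exact H1].
  - apply (continuous_ext (fun s => Im (g s))); [intros s; rewrite E; reflexivity|exact H2].
Qed.

Lemma cR_h (k : C -> C) y a b : (forall t, a <= t <= b -> continuous k (t, y)) -> cR (fun t => k (t, y)) a b.
Proof.
  intros H. apply (cR_ext (fun t => k ((0, y) + RtoC t * 1)%C)); [intros t; rewrite <- hline; reflexivity|].
  intros t Ht. apply continuous_line. rewrite <- hline. apply H, Ht.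
Qed.

Lemma cR_v (k : C -> C) x a b : (forall t, a <= t <= b -> continuous k (x, t)) -> cR (fun t => k (x, t)) a b.
Proof.
  intros H. apply (cR_ext (fun t => k ((x, 0) + RtoC t * Ci)%C)); [intros t; rewrite <- vline; reflexivity|].
  intros t Ht. apply continuous_line. rewrite <- vline. apply H, Ht.
Qed.

(** Counterclockwise contour integral: bottom, right, top, left, with dz = dt on horizontal sides
    and dz = i dt on vertical ones. *)
Definition bint (k : C -> C) (a b c d : R) : C :=
  (CI (fun t => k (t, c)) a b + Ci * CI (fun t => k (b, t)) c d
   - CI (fun t => k (t, d)) a b - Ci * CI (fun t => k (a, t)) c d)%C.

Definition bd (a b c d : R) (z : C) : Prop :=
  (a <= Re z <= b /\ (Im z = c \/ Im z = d)) \/ (c <= Im z <= d /\ (Re z = a \/ Re z = b)).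

Definition cB (k : C -> C) (a b c d : R) : Prop := forall z, bd a b c d z -> continuous k z.

Section Rectangle.
Variables a b c d : R.
Hypothesis (Hab : a <= b) (Hcd : c <= d).

Lemma cB_sides k : cB k a b c d ->
  cR (fun t => k (t, c)) a b /\ cR (fun t => k (b, t)) c d /\ cR (fun t => k (t, d)) a b /\ cR (fun t => k (a, t)) c d.
Proof.
  intros H. split; [|split; [|split]]; [apply cR_h|apply cR_v|apply cR_h|apply cR_v]; intros t Ht; apply H;
  unfold bd; simpl; auto.
Qed.

Lemma bint_ext k k' : (forall z, bd a b c d z -> k z = k' z) -> bint k a b c d = bint k' a b c d.
Proof.
  intros H. unfold bint.
  rewrite (CI_ext (fun t => k (t, c)) (fun t => k' (t, c))), (CI_ext (fun t => k (b, t)) (fun t => k' (b, t))),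
   (CI_ext (fun t => k (t, d)) (fun t => k' (t, d))), (CI_ext (fun t => k (a, t)) (fun t => k' (a, t))); auto;
  intros t Ht; apply H; unfold bd; simpl; auto.
Qed.

Lemma bint_plus k k' : cB k a b c d -> cB k' a b c d ->
  bint (fun z => k z + k' z)%C a b c d = (bint k a b c d + bint k' a b c d)%C.
Proof.
  intros H H'. destruct (cB_sides k H) as (H1 & H2 & H3 & H4). destruct (cB_sides k' H') as (H1' & H2' & H3' & H4').
  unfold bint. rewrite !CI_plus; auto. ring.
Qed.

Lemma bint_scal w k : cB k a b c d -> bint (fun z => w * k z)%C a b c d = (w * bint k a b c d)%C.
Proof.
  intros H. destruct (cB_sides k H) as (H1 & H2 & H3 & H4).
  unfold bint. rewrite !CI_scal; auto. ring.
Qed.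

Lemma bint_bound k M : cB k a b c d -> (forall z, bd a b c d z -> Cmod (k z) <= M) ->
  Cmod (bint k a b c d) <= 4 * M * ((b - a) + (d - c)).
Proof.
  intros H HM. destruct (cB_sides k H) as (H1 & H2 & H3 & H4).
  assert (B1 := CI_bound _ a b M Hab H1 (fun t Ht => HM (t, c) (or_introl (conj Ht (or_introl eq_refl))))).
  assert (B2 := CI_bound _ c d M Hcd H2 (fun t Ht => HM (b, t) (or_intror (conj Ht (or_intror eq_refl))))).
  assert (B3 := CI_bound _ a b M Hab H3 (fun t Ht => HM (t, d) (or_introl (conj Ht (or_intror eq_refl))))).
  assert (B4 := CI_bound _ c d M Hcd H4 (fun t Ht => HM (a, t) (or_intror (conj Ht (or_introl eq_refl))))).
  unfold bint, Cminus.
  eapply Rle_trans; [apply Cmod_triangle|]. eapply Rle_trans; [apply Rplus_le_compat_r, Cmod_sum3|].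
  rewrite !Cmod_opp, !Cmod_mult, !Cmod_Ci. lra.
Qed.

Lemma bint_ftc F k : cB k a b c d -> (forall z, bd a b c d z -> isdC F z (k z)) ->
  bint k a b c d = 0.
Proof.
  intros H HF. destruct (cB_sides k H) as (H1 & H2 & H3 & H4).
  assert (Hh : forall y, y = c \/ y = d -> cR (fun t => k (t, y)) a b ->
     CI (fun t => k (t, y)) a b = (F (b, y) - F (a, y))%C).
  { intros y Hy Hc. apply (CI_ftc (fun t => F (t, y))); auto. intros t Ht.
    assert (HD := HF (t, y) (or_introl (conj Ht Hy))).
    rewrite hline in HD at 1. destruct (line_derive _ _ _ _ _ HD) as [D1 D2]. rewrite Cmult_1_r in D1, D2.
    split; [eapply is_derive_ext; [|exact D1]|eapply is_derive_ext; [|exact D2]]; intros s; simpl; rewrite <- hline; reflexivity. }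
  assert (Hv : forall x, x = a \/ x = b -> cR (fun t => k (x, t)) c d ->
     (Ci * CI (fun t => k (x, t)) c d)%C = (F (x, d) - F (x, c))%C).
  { intros x Hx Hc. rewrite <- CI_scal; auto. apply (CI_ftc (fun t => F (x, t))); auto.
    - apply (cR_v (fun z => Ci * k z)%C). intros t Ht.
      assert (Hk : continuous k (x, t)) by (apply H; right; simpl; auto).
      rewrite continuous_C in *. intros eps He. destruct (Hk eps He) as (r & Hr & Hy). exists r. split; auto.
      intros y Hyr. replace (Ci * k y - Ci * k (x, t))%C with (Ci * (k y - k (x, t)))%C by ring.
      rewrite Cmod_mult, Cmod_Ci, Rmult_1_l. auto.
    - intros t Ht. assert (HD := HF (x, t) (or_intror (conj Ht Hx))).
      rewrite vline in HD at 1. destruct (line_derive _ _ _ _ _ HD) as [D1 D2]. rewrite Cmult_comm in D1, D2.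
      split; [eapply is_derive_ext; [|exact D1]|eapply is_derive_ext; [|exact D2]]; intros s; simpl; rewrite <- vline; reflexivity. }
  unfold bint. rewrite (Hh c), (Hh d), (Hv b), (Hv a); auto. ring.
Qed.
End Rectangle.

Lemma bint_split_x k a m b c d : a <= m <= b -> c <= d -> cB k a b c d ->
  bint k a b c d = (bint k a m c d + bint k m b c d)%C.
Proof.
  intros Hm Hcd H. destruct (cB_sides a b c d k H) as (H1 & H2 & H3 & H4).
  unfold bint. rewrite (CI_chasles _ a m b Hm H1), (CI_chasles _ a m b Hm H3). ring.
Qed.

Lemma bint_split_y k a b c m d : c <= m <= d -> cB k a b c d ->
  bint k a b c d = (bint k a b c m + bint k a b m d)%C.
Proof.
  intros Hm H. destruct (cB_sides a b c d k H) as (H1 & H2 & H3 & H4).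
  unfold bint. rewrite (CI_chasles _ c m d Hm H2), (CI_chasles _ c m d Hm H4). ring.
Qed.

Definition rect (a b c d : R) (z : C) : Prop := a <= Re z <= b /\ c <= Im z <= d.

Lemma bd_rect a b c d z : a <= b -> c <= d -> bd a b c d z -> rect a b c d z.
Proof. unfold bd, rect. lra. Qed.

(** The bound K (width + height)^2 is divided by 4 upon halving the sides, while the integral is the
    sum over four quarters; so one quarter still violates the bound. *)
Lemma quarter (k : C -> C) K a b c d : a <= b -> c <= d -> (forall z, rect a b c d z -> continuous k z) ->
  K * ((b - a) + (d - c)) ^ 2 < Cmod (bint k a b c d) ->
  exists a' c', a <= a' /\ a' + (b - a) / 2 <= b /\ c <= c' /\ c' + (d - c) / 2 <= d /\
    K * ((b - a) / 2 + (d - c) / 2) ^ 2 < Cmod (bint k a' (a' + (b - a) / 2) c' (c' + (d - c) / 2)).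
Proof.
  intros Hab Hcd Hk HK.
  assert (HB : forall a' b' c' d', a <= a' -> a' <= b' -> b' <= b -> c <= c' -> c' <= d' -> d' <= d -> cB k a' b' c' d').
  { intros a' b' c' d' ? ? ? ? ? ? z Hz. apply Hk. apply bd_rect in Hz; auto. unfold rect in *. lra. }
  set (m := a + (b - a) / 2). set (n := c + (d - c) / 2).
  rewrite (bint_split_x k a m b c d) in HK by (try (apply HB); unfold m; lra).
  rewrite (bint_split_y k a m c n d), (bint_split_y k m b c n d) in HK by (try (apply HB); unfold m, n; lra).
  replace (K * ((b - a) + (d - c)) ^ 2) with (4 * (K * ((b - a) / 2 + (d - c) / 2) ^ 2)) in HK by field.
  set (T := K * ((b - a) / 2 + (d - c) / 2) ^ 2) in *.
  pose proof (Cmod_triangle (bint k a m c n + bint k a m n d) (bint k m b c n + bint k m b n d)).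
  pose proof (Cmod_triangle (bint k a m c n) (bint k a m n d)).
  pose proof (Cmod_triangle (bint k m b c n) (bint k m b n d)).
  assert (Eb : m + (b - a) / 2 = b) by (unfold m; field).
  assert (Ed : n + (d - c) / 2 = d) by (unfold n; field).
  destruct (Rlt_or_le T (Cmod (bint k a m c n))); [exists a, c; fold m n; repeat split; auto; unfold m, n; lra|].
  destruct (Rlt_or_le T (Cmod (bint k a m n d))); [exists a, n; fold m; rewrite Ed; repeat split; auto; unfold m, n; lra|].
  destruct (Rlt_or_le T (Cmod (bint k m b c n))); [exists m, c; fold n; rewrite Eb; repeat split; auto; unfold m, n; lra|].
  destruct (Rlt_or_le T (Cmod (bint k m b n d))); [exists m, n; rewrite Eb, Ed; repeat split; auto; unfold m, n; lra|].
  lra.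
Qed.

(** The affine part of [k] at [z0] has a quadratic primitive and integrates to 0; the remainder is
    at most [e] times width plus height on the boundary. *)
Lemma goursat_local (k : C -> C) (l z0 : C) e r a b c d : a <= b -> c <= d -> 0 <= e ->
  rect a b c d z0 -> cB k a b c d -> (b - a) + (d - c) < r ->
  (forall y, Cmod (y - z0) < r -> Cmod (k y - k z0 - l * (y - z0)) <= e * Cmod (y - z0)) ->
  Cmod (bint k a b c d) <= 4 * e * ((b - a) + (d - c)) ^ 2.
Proof.
  intros Hab Hcd He Hz0 Hk Hr HL.
  set (A := fun z => (l * z + (k z0 - l * z0))%C).
  assert (HA : cB A a b c d) by (intros z _; apply dC_continuous, dC_affine).
  assert (HA0 : bint A a b c d = 0).
  { apply (bint_ftc a b c d Hab Hcd (fun z => / RtoC 2 * l * (z * z) + (k z0 - l * z0) * z)%C); auto.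
    intros z _. unfold A. 
    replace (l * z + (k z0 - l * z0))%C with (/ RtoC 2 * l * (RtoC 2 * z) + (k z0 - l * z0))%C
      by field.
    apply isdC_plus.
    - apply (is_derive_ext (fun u => (/ RtoC 2 * l) * (u * u) + 0)%C). { intros t. simpl. ring. }
      apply (isdC_comp (fun u => (/ RtoC 2 * l) * u + 0)%C (fun u => u * u)%C).
      apply isdC_affine. apply isdC_sqr.
    - apply (is_derive_ext (fun u => (k z0 - l * z0) * u + 0)%C). { intros t. simpl. ring. }
      apply isdC_affine. }
  assert (HmA : cB (fun z => - (1) * A z)%C a b c d) by (intros z _; apply dC_continuous, dC_scal, dC_affine).
  assert (HD : cB (fun z => k z + - (1) * A z)%C a b c d).
  { intros z Hz. apply (@continuous_plus C_UniformSpace C_AbsRing C_NormedModule k (fun z => - (1) * A z)%C); [apply Hk, Hz|apply HmA, Hz]. }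
  replace (bint k a b c d) with (bint (fun z => k z + - (1) * A z)%C a b c d).
  2:{ rewrite bint_plus, bint_scal, HA0; auto. ring. }
  replace (4 * e * ((b - a) + (d - c)) ^ 2) with (4 * (e * ((b - a) + (d - c))) * ((b - a) + (d - c))) by ring.
  apply bint_bound; auto.
  intros z Hz. apply bd_rect in Hz; auto. unfold rect in *.
  assert (Hzz : Cmod (z - z0) <= (b - a) + (d - c)).
  { eapply Rle_trans; [apply Cmod_le_abs|]. apply Rplus_le_compat; apply Rabs_le; unfold Re, Im in *; simpl; lra. }
  unfold A. replace (k z + - (1) * (l * z + (k z0 - l * z0)))%C with (k z - k z0 - l * (z - z0))%C by ring.
  eapply Rle_trans; [apply HL; lra|]. apply Rmult_le_compat_l; auto.
Qed.

Lemma goursat (k : C -> C) a b c d : a <= b -> c <= d -> (forall z, rect a b c d z -> dC k z) ->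
  bint k a b c d = 0.
Proof.
  intros Hab Hcd Hk. apply NNPP. intros Hne. apply Cmod_gt_0 in Hne.
  set (S0 := (b - a) + (d - c)). assert (HS0 : 0 <= S0) by (unfold S0; lra).
  (* The added 1 covers a degenerate rectangle and makes the inequality strict. *)
  assert (HKex : exists K, 0 < K /\ K * S0 ^ 2 < Cmod (bint k a b c d)).
  { exists (Cmod (bint k a b c d) / (S0 ^ 2 + 1)). pose proof (pow2_ge_0 S0). split.
    - apply Rdiv_lt_0_compat; lra.
    - apply (Rmult_lt_reg_r (S0 ^ 2 + 1)); [lra|].
      replace (Cmod (bint k a b c d) / (S0 ^ 2 + 1) * S0 ^ 2 * (S0 ^ 2 + 1)) with (Cmod (bint k a b c d) * S0 ^ 2) by (field; lra). nra. }
  destruct HKex as (K & HK & HKb).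
  set (W := fun n => (b - a) / 2 ^ n). set (H := fun n => (d - c) / 2 ^ n).
  assert (HW : forall n, 0 <= W n).
  { intros n. unfold W. apply Rmult_le_pos; [lra|apply Rlt_le, Rinv_0_lt_compat, pow_lt; lra]. }
  assert (HH : forall n, 0 <= H n).
  { intros n. unfold H. apply Rmult_le_pos; [lra|apply Rlt_le, Rinv_0_lt_compat, pow_lt; lra]. }
  assert (HWS : forall n, W (S n) = W n / 2) by (intros n; unfold W; simpl; field; apply pow_nonzero; lra).
  assert (HHS : forall n, H (S n) = H n / 2) by (intros n; unfold H; simpl; field; apply pow_nonzero; lra).
  set (P := fun n (p : R * R) => a <= fst p /\ fst p + W n <= b /\ c <= snd p /\ snd p + H n <= d /\
    K * (W n + H n) ^ 2 < Cmod (bint k (fst p) (fst p + W n) (snd p) (snd p + H n))).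
  assert (Hnext : forall q : nat * (R * R), exists p', P (fst q) (snd q) ->
     P (S (fst q)) p' /\ fst (snd q) <= fst p' /\ fst p' + W (S (fst q)) <= fst (snd q) + W (fst q) /\
     snd (snd q) <= snd p' /\ snd p' + H (S (fst q)) <= snd (snd q) + H (fst q)).
  { intros [n p]. simpl fst. simpl snd. destruct (classic (P n p)) as [HP|HP]; [|exists p; intros; contradiction].
    destruct HP as (P1 & P2 & P3 & P4 & P5). pose proof (HW n). pose proof (HH n).
    destruct (quarter k K (fst p) (fst p + W n) (snd p) (snd p + H n)) as (a' & c' & A1 & A2 & A3 & A4 & A5); try lra.
    { intros z Hz. apply dC_continuous, Hk. unfold rect in *. lra. }
    replace (fst p + W n - fst p) with (W n) in * by ring. replace (snd p + H n - snd p) with (H n) in * by ring.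
    exists (a', c'). intros _. unfold P. simpl. rewrite HWS, HHS. repeat split; lra. }
  apply choice in Hnext. destruct Hnext as [next Hnext].
  set (p := fix p n := match n with O => (a, c) | S n => next (n, p n) end).
  assert (HP : forall n, P n (p n)).
  { induction n.
    - unfold P. simpl. unfold W, H. simpl. rewrite !Rdiv_1_r.
      replace (a + (b - a)) with b by ring. replace (c + (d - c)) with d by ring. fold S0. repeat split; lra || auto.
    - apply (Hnext (n, p n)), IHn. }
  assert (Hmono : forall n, fst (p n) <= fst (p (S n)) /\ fst (p (S n)) + W (S n) <= fst (p n) + W n /\
      snd (p n) <= snd (p (S n)) /\ snd (p (S n)) + H (S n) <= snd (p n) + H n).
  { intros n. apply (Hnext (n, p n)), HP. }
  assert (Hnest : forall n m, fst (p n) <= fst (p (n + m)%nat) /\ fst (p (n + m)%nat) + W (n + m)%nat <= fst (p n) + W n /\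
      snd (p n) <= snd (p (n + m)%nat) /\ snd (p (n + m)%nat) + H (n + m)%nat <= snd (p n) + H n).
  { intros n. induction m. rewrite Nat.add_0_r. lra. rewrite Nat.add_succ_r. pose proof (Hmono (n + m)%nat). lra. }
  assert (Hnest2 : forall n m, (n <= m)%nat -> fst (p n) <= fst (p m) <= fst (p n) + W n /\ snd (p n) <= snd (p m) <= snd (p n) + H n).
  { intros n m Hm. replace m with (n + (m - n))%nat by lia. pose proof (Hnest n (m - n)%nat).
    pose proof (HW (n + (m - n))%nat). pose proof (HH (n + (m - n))%nat). lra. }
  assert (Hsmall : forall e, 0 < e -> exists N, W N + H N < e).
  { intros e He. destruct (half_pow_small S0 e HS0 He) as [N HN]. exists N.
    unfold W, H, Rdiv. rewrite <- pow_inv. unfold S0 in HN. lra. }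
  destruct (C_complete (fun n => (fst (p n), snd (p n)))) as [z0 Hz0].
  { intros e He. destruct (Hsmall (e / 2)) as [N HN]; [lra|]. exists N. intros n m Hn Hm.
    pose proof (Hnest2 N n Hn). pose proof (Hnest2 N m Hm).
    eapply Rle_lt_trans; [apply Cmod_le_abs|]. simpl.
    assert (Rabs (fst (p n) + - fst (p m)) <= W N) by (apply Rabs_le; lra).
    assert (Rabs (snd (p n) + - snd (p m)) <= H N) by (apply Rabs_le; lra). lra. }
  assert (Hin : forall n, rect (fst (p n)) (fst (p n) + W n) (snd (p n)) (snd (p n) + H n) z0).
  { intros n.
    assert (HA : forall e, 0 < e -> exists m, (n <= m)%nat /\ Rabs (fst (p m) - Re z0) < e /\ Rabs (snd (p m) - Im z0) < e).
    { intros e He. destruct (Hz0 e He) as [N HN]. exists (max n N). split; [lia|].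
      specialize (HN (max n N) ltac:(lia)).
      split; eapply Rle_lt_trans; [|exact HN| |exact HN].
      apply (re_le_Cmod ((fst (p (max n N)), snd (p (max n N))) - z0)).
      apply (im_le_Cmod ((fst (p (max n N)), snd (p (max n N))) - z0)). }
    split; split; apply le_epsilon; intros e He; destruct (HA e He) as (m & Hm & E1 & E2);
    pose proof (Hnest2 n m Hm); apply Rabs_def2 in E1; apply Rabs_def2 in E2; lra. }
  assert (Hz0in : rect a b c d z0). { pose proof (Hin O) as H0. pose proof (HP O) as (Q1 & Q2 & Q3 & Q4 & _). unfold rect in *. lra. }
  destruct (Hk z0 Hz0in) as [l Hl]. rewrite is_derive_C in Hl.
  (* With this error the local bound becomes K (width + height)^2, exactly what every nested
     rectangle violates. *)
  destruct (Hl (K / 4)) as (r & Hr & Hy); [lra|].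
  destruct (Hsmall r Hr) as [N HN]. destruct (HP N) as (Q1 & Q2 & Q3 & Q4 & Q5).
  pose proof (HW N). pose proof (HH N).
  pose proof (goursat_local k l z0 (K / 4) r (fst (p N)) (fst (p N) + W N) (snd (p N)) (snd (p N) + H N)) as HG.
  replace (fst (p N) + W N - fst (p N)) with (W N) in HG by ring.
  replace (snd (p N) + H N - snd (p N)) with (H N) in HG by ring.
  assert (Cmod (bint k (fst (p N)) (fst (p N) + W N) (snd (p N)) (snd (p N) + H N)) <= 4 * (K / 4) * (W N + H N) ^ 2).
  { apply HG; auto; try lra. intros z Hz. apply bd_rect in Hz; [|lra|lra]. apply dC_continuous, Hk. unfold rect in *. lra. }
  lra.
Qed.

(** A square of half-side [h] around [w] is cut out. The four remaining rectangles avoid [w] and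
    contribute 0; the square contributes at most 16 B h, with [h] arbitrarily small. *)
Lemma goursat_punctured (k : C -> C) (w : C) B r a b c d : a < Re w < b -> c < Im w < d -> 0 < r -> 0 <= B ->
  (forall z, rect a b c d z -> z <> w -> dC k z) ->
  (forall z, z <> w -> Cmod (z - w) < r -> Cmod (k z) <= B) ->
  bint k a b c d = 0.
Proof.
  intros Hx Hy Hr HB Hk Hbd. apply Cmod_zero_le. apply Rle_eps0. intros e He.
  assert (Hex : forall x y, 0 < x -> 0 < y -> exists h, 0 < h /\ h <= x /\ h <= y).
  { intros x y H1 H2. exists (Rmin x y). split; [apply Rmin_pos; auto|]. split; [apply Rmin_l|apply Rmin_r]. }
  destruct (Hex (Re w - a) (b - Re w)) as (h1 & P1 & H1 & H2); try lra.
  destruct (Hex (Im w - c) (d - Im w)) as (h2 & P2 & H3 & H4); try lra.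
  destruct (Hex (r / 4) (e / (16 * B + 1))) as (h3 & P3 & H5 & H6); try lra.
  { apply Rdiv_lt_0_compat; lra. }
  destruct (Hex h1 h2) as (h4 & P4 & Q1 & Q2); auto. destruct (Hex h4 h3) as (h & Hh & Q3 & Q4); auto.
  apply Rle_div_r in H6; [|lra].
  assert (H7 : h * (16 * B + 1) <= h3 * (16 * B + 1)) by (apply Rmult_le_compat_r; lra).
  set (a' := Re w - h). set (b' := Re w + h). set (c' := Im w - h). set (d' := Im w + h).
  assert (HcB : forall a1 b1 c1 d1, a <= a1 -> a1 <= b1 -> b1 <= b -> c <= c1 -> c1 <= d1 -> d1 <= d ->
     (forall z, bd a1 b1 c1 d1 z -> z <> w) -> cB k a1 b1 c1 d1).
  { intros a1 b1 c1 d1 ? ? ? ? ? ? Hn z Hz. apply dC_continuous, Hk; auto. apply bd_rect in Hz; auto. unfold rect in *. lra. }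
  assert (HG : forall a1 b1 c1 d1, a <= a1 -> a1 <= b1 -> b1 <= b -> c <= c1 -> c1 <= d1 -> d1 <= d ->
     (b1 < Re w \/ Re w < a1 \/ d1 < Im w \/ Im w < c1) -> bint k a1 b1 c1 d1 = 0).
  { intros a1 b1 c1 d1 ? ? ? ? ? ? Hn. apply goursat; auto. intros z Hz. apply Hk; [unfold rect in *; lra|].
    intros ->. unfold rect in Hz. lra. }
  rewrite (bint_split_x k a a' b c d) by
    (try (apply HcB; try lra; intros z Hz ->; unfold bd in Hz; lra); unfold a'; lra).
  rewrite (HG a a' c d) by (unfold a'; lra).
  rewrite (bint_split_x k a' b' b c d) by
    (try (apply HcB; unfold a'; try lra; intros z Hz ->; unfold bd in Hz; lra); unfold a', b'; lra).
  rewrite (HG b' b c d) by (unfold b'; lra).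
  rewrite (bint_split_y k a' b' c c' d) by
    (try (apply HcB; unfold a', b'; try lra; intros z Hz ->; unfold bd in Hz; lra); unfold c'; lra).
  rewrite (HG a' b' c c') by (unfold a', b', c'; lra).
  rewrite (bint_split_y k a' b' c' d' d) by
    (try (apply HcB; unfold a', b', c'; try lra; intros z Hz ->; unfold bd in Hz; lra); unfold c', d'; lra).
  rewrite (HG a' b' d' d) by (unfold a', b', d'; lra).
  replace (0 + (0 + (bint k a' b' c' d' + 0) + 0))%C with (bint k a' b' c' d') by ring.
  eapply Rle_trans.
  { apply (bint_bound a' b' c' d') with (M := B); try (unfold a', b', c', d'; lra).
    - apply HcB; unfold a', b', c', d'; try lra. intros z Hz ->. unfold bd in Hz. lra.
    - intros z Hz. apply Hbd.
      + intros ->. unfold bd, a', b', c', d' in Hz. lra.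
      + apply bd_rect in Hz; try (unfold a', b', c', d'; lra).
        eapply Rle_lt_trans; [apply Cmod_le_abs|]. unfold rect, a', b', c', d' in Hz.
        assert (Rabs (Re (z - w)%C) <= h) by (apply Rabs_le; unfold Re, Im in *; simpl; lra).
        assert (Rabs (Im (z - w)%C) <= h) by (apply Rabs_le; unfold Re, Im in *; simpl; lra). lra. }
  unfold a', b', c', d'. replace (4 * B * (Re w + h - (Re w - h) + (Im w + h - (Im w - h)))) with (16 * B * h) by ring.
  nra.
Qed.

(** * Local structure of holomorphic functions *)

Section Square.
Variable rho : R.
Hypothesis Hrho : 0 < rho.

Notation sq k := (bint k (- rho) rho (- rho) rho).
Notation bds := (bd (- rho) rho (- rho) rho).
Notation cBs k := (cB k (- rho) rho (- rho) rho).

Lemma bds_Cmod z : bds z -> rho <= Cmod z /\ Cmod z <= 2 * rho.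
Proof.
  intros H. split.
  - unfold bd in H. destruct H as [[_ [E|E]]|[_ [E|E]]].
    + eapply Rle_trans; [|apply im_le_Cmod]. rewrite E, Rabs_Ropp. apply Rle_abs.
    + eapply Rle_trans; [|apply im_le_Cmod]. rewrite E. apply Rle_abs.
    + eapply Rle_trans; [|apply re_le_Cmod]. rewrite E, Rabs_Ropp. apply Rle_abs.
    + eapply Rle_trans; [|apply re_le_Cmod]. rewrite E. apply Rle_abs.
  - apply bd_rect in H; try lra. unfold rect in H. eapply Rle_trans; [apply Cmod_le_abs|].
    assert (Rabs (Re z) <= rho) by (apply Rabs_le; lra). assert (Rabs (Im z) <= rho) by (apply Rabs_le; lra). lra.
Qed.

Lemma bds_far z w : bds z -> Cmod w <= rho / 2 -> rho / 2 <= Cmod (z - w) /\ (z - w)%C <> 0 /\ z <> 0.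
Proof.
  intros Hz Hw. destruct (bds_Cmod z Hz) as [H1 _].
  pose proof (Cmod_triangle_inv z w). split; [lra|]. split; apply Cmod_gt_0; lra.
Qed.

Lemma dC_cauchy_kernel z w : bds z -> Cmod w <= rho / 2 -> dC (fun u => / (u - w))%C z.
Proof.
  intros Hz Hw. apply (dC_inv (fun u => u - w)%C).
  - apply (bds_far z w Hz Hw).
  - apply (dC_ext (fun u => 1 * u + - w)%C); [intros; ring|]. apply dC_affine.
Qed.

Lemma sq_bound k M : cBs k -> (forall z, bds z -> Cmod (k z) <= M) -> Cmod (sq k) <= 16 * rho * M.
Proof.
  intros Hk HM. eapply Rle_trans; [apply (bint_bound _ _ _ _) with (M := M); auto; lra|]. lra.
Qed.

Definition winding (w : C) : C := sq (fun z => / (z - w))%C.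

(* Each side contributes the integral of rho/(t^2+rho^2) to the imaginary part. *)
Lemma winding_neq_0 : winding 0 <> 0.
Proof.
  set (J := RInt (fun t => rho / (t ^ 2 + rho ^ 2)) (- rho) rho).
  assert (Hp : forall t, 0 < t ^ 2 + rho ^ 2) by (intros; nra).
  assert (HJ : 0 < J).
  { apply RInt_gt_0; [lra| |].
    - intros t _. apply Rdiv_lt_0_compat; auto.
    - intros t _. apply (@ex_derive_continuous R_AbsRing R_NormedModule). auto_derive. pose proof (Hp t). lra. }
  assert (HIm : Im (winding 0) = 4 * J).
  { unfold winding, bint, CI, Cminus, Cplus, Copp, Cmult, Cinv, Ci, Im, Re. simpl.
    assert (E : forall h, (forall t, h t = rho / (t ^ 2 + rho ^ 2)) -> RInt h (- rho) rho = J).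
    { intros h Hh. apply RInt_ext. intros t _. apply Hh. }
    assert (E' : forall h, (forall t, h t = - (rho / (t ^ 2 + rho ^ 2))) -> RInt h (- rho) rho = - J).
    { intros h Hh. rewrite (RInt_ext _ (fun t => - (rho / (t ^ 2 + rho ^ 2)))).
      - apply (@RInt_opp R_CompleteNormedModule (fun t => rho / (t ^ 2 + rho ^ 2))). apply (@ex_RInt_continuous R_CompleteNormedModule). intros t _.
        apply (@ex_derive_continuous R_AbsRing R_NormedModule). auto_derive. pose proof (Hp t). lra.
      - intros t _. apply Hh. }
    rewrite (E (fun t => - (- rho + - 0) / _)); [|intros t; field; pose proof (Hp t); nra].
    rewrite (E (fun t => (rho + - 0) / _)); [|intros t; field; pose proof (Hp t); nra].
    rewrite (E' (fun t => - (rho + - 0) / _)); [|intros t; field; pose proof (Hp t); nra].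
    rewrite (E' (fun t => (- rho + - 0) / _)); [|intros t; field; pose proof (Hp t); nra].
    ring. }
  intros H0. rewrite H0 in HIm. simpl in HIm. lra.
Qed.

Section Integrals.
Variable phi : C -> C.
Hypothesis Hphi : forall z, Cmod z <= 2 * rho -> dC phi z.

(** At [w = 0] this is the n-th Taylor coefficient times the integral of dz/z; at general [w] it is
    the corresponding factor in the Taylor remainder. *)
Definition cint (n : nat) (w : C) : C := sq (fun z => phi z * (Cpow (/ z) n * / (z - w)))%C.

Lemma cint_dC n w z : Cmod w <= rho / 2 -> bds z -> dC (fun z => phi z * (Cpow (/ z) n * / (z - w)))%C z.
Proof.
  intros Hw Hz. apply (dC_mult phi (fun z => Cpow (/ z) n * / (z - w))%C).
  - apply Hphi, bds_Cmod, Hz.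
  - apply (dC_mult (fun z => Cpow (/ z) n) (fun z => / (z - w))%C); [|apply dC_cauchy_kernel; auto].
    apply (dC_pow Cinv). eexists. apply isdC_inv. apply (bds_far z w Hz Hw).
Qed.

Lemma Cmod_0_le_half : Cmod 0 <= rho / 2.
Proof. rewrite Cmod_0. lra. Qed.

(** Integrates 1 / (z - w) = 1/z + w / (z (z - w)). *)
Lemma cint_step n w : Cmod w <= rho / 2 -> cint n w = (cint n 0 + w * cint (S n) w)%C.
Proof.
  intros Hw.
  assert (E : cint n w = sq (fun z => phi z * (Cpow (/ z) n * / (z - 0)) + w * (phi z * (Cpow (/ z) (S n) * / (z - w))))%C).
  { unfold cint. apply bint_ext; try lra. intros z Hz.
    destruct (bds_far z w Hz Hw) as (_ & N1 & N0). rewrite Cpow_S. replace (z - 0)%C with z by ring. generalize (Cpow (/ z) n). intros p. field. auto. }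
  rewrite E, bint_plus, bint_scal; try lra; auto.
  - intros z Hz. apply dC_continuous, cint_dC; auto.
  - intros z Hz. apply dC_continuous, cint_dC; auto using Cmod_0_le_half.
  - intros z Hz. apply dC_continuous, dC_scal, cint_dC; auto.
Qed.

Lemma bds_inv z w : bds z -> Cmod w <= rho / 2 -> Cmod (/ z) <= / rho /\ Cmod (/ (z - w)) <= 2 / rho.
Proof.
  intros Hz Hw. destruct (bds_Cmod z Hz) as [B1 _]. destruct (bds_far z w Hz Hw) as (F1 & N1 & N0).
  rewrite !Cmod_inv by auto. split; [apply Rinv_le_contravar; lra|].
  replace (2 / rho) with (/ (rho / 2)) by (field; lra). apply Rinv_le_contravar; lra.
Qed.

Variable M : R.
Hypothesis HM : forall z, bds z -> Cmod (phi z) <= M.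

Lemma cint_bound n w : Cmod w <= rho / 2 -> Cmod (cint n w) <= 32 * M * (/ rho) ^ n.
Proof.
  intros Hw. unfold cint. replace (32 * M * (/ rho) ^ n) with (16 * rho * (M * ((/ rho) ^ n * (2 / rho)))) by (field; lra).
  apply sq_bound.
  - intros z Hz. apply dC_continuous, cint_dC; auto.
  - intros z Hz. destruct (bds_inv z w Hz Hw) as [I1 I2]. rewrite !Cmod_mult, Cmod_pow.
    apply Rmult_le_compat; [apply Cmod_ge_0|apply Rmult_le_pos; [apply pow_le|]; apply Cmod_ge_0|apply HM, Hz|].
    apply Rmult_le_compat; [apply pow_le, Cmod_ge_0|apply Cmod_ge_0|apply pow_incr; split; [apply Cmod_ge_0|auto]|auto].
Qed.

(** Resolvent identity: 1 / (z - w) = 1 / (z - v) + (w - v) / ((z - w)(z - v)). *)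
Lemma cint_lip n : exists K, forall w v, Cmod w <= rho / 2 -> Cmod v <= rho / 2 ->
  Cmod (cint n w - cint n v) <= K * Cmod (w - v).
Proof.
  exists (16 * rho * (M * ((/ rho) ^ n * (2 / rho)) * (2 / rho))). intros w v Hw Hv.
  assert (HD : forall z, bds z -> dC (fun z => phi z * (Cpow (/ z) n * / (z - w)) * / (z - v))%C z).
  { intros z Hz. apply (dC_mult (fun z => phi z * (Cpow (/ z) n * / (z - w)))%C (fun z => / (z - v))%C).
    apply cint_dC; auto. apply dC_cauchy_kernel; auto. }
  assert (E : cint n w = sq (fun z => phi z * (Cpow (/ z) n * / (z - v)) +
     (w - v) * (phi z * (Cpow (/ z) n * / (z - w)) * / (z - v)))%C).
  { unfold cint. apply bint_ext; try lra. intros z Hz.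
    destruct (bds_far z w Hz Hw) as (_ & N1 & N0). destruct (bds_far z v Hz Hv) as (_ & N2 & _).
    generalize (Cpow (/ z) n). intros p. field. auto. }
  rewrite E, bint_plus, bint_scal; try lra; auto.
  - fold (cint n v).
    match goal with |- Cmod (?x + (w - v) * ?y - ?x) <= _ => replace (x + (w - v) * y - x)%C with ((w - v) * y)%C by ring end.
    rewrite Cmod_mult, Rmult_comm. apply Rmult_le_compat_r; [apply Cmod_ge_0|].
    apply sq_bound.
    + intros z Hz. apply dC_continuous; auto.
    + intros z Hz. destruct (bds_inv z w Hz Hw) as [I1 I2]. destruct (bds_inv z v Hz Hv) as [_ I3].
      rewrite !Cmod_mult, Cmod_pow.
      assert (0 <= Cmod (/ z) ^ n) by (apply pow_le, Cmod_ge_0).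
      apply Rmult_le_compat; [apply Rmult_le_pos; [apply Cmod_ge_0|apply Rmult_le_pos; auto; apply Cmod_ge_0]|apply Cmod_ge_0| |auto].
      apply Rmult_le_compat; [apply Cmod_ge_0|apply Rmult_le_pos; auto; apply Cmod_ge_0|apply HM, Hz|].
      apply Rmult_le_compat; [auto|apply Cmod_ge_0|apply pow_incr; split; [apply Cmod_ge_0|auto]|auto].
  - intros z Hz. apply dC_continuous; auto.
  - intros z Hz. apply dC_continuous, cint_dC; auto.
  - intros z Hz. apply dC_continuous, dC_scal; auto.
Qed.

Lemma cint_taylor n : (forall j, (1 <= j < S n)%nat -> cint j 0 = 0) ->
  forall w, Cmod w <= rho / 2 -> cint 0 w = (cint 0 0 + Cpow w (S n) * cint (S n) w)%C.
Proof.
  induction n; intros Hj w Hw.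
  - rewrite (cint_step 0 w Hw). simpl. ring.
  - rewrite (IHn (fun j h => Hj j ltac:(lia)) w Hw), (cint_step (S n) w Hw), (Hj (S n)) by lia.
    rewrite !(Cpow_S w (S n)). ring.
Qed.

(** With all coefficients of positive index zero, only the remainder is left; it is bounded by a
    constant times (|w| / rho)^N, and |w| / rho <= 1/2. *)
Lemma cint_flat w : (forall j, (1 <= j)%nat -> cint j 0 = 0) -> Cmod w <= rho / 2 -> cint 0 w = cint 0 0.
Proof.
  intros HZ Hw. apply Cminus_eq_0, Cmod_zero_le, Rle_eps0. intros e He.
  assert (HM0 : 0 <= M).
  { eapply Rle_trans; [apply (Cmod_ge_0 (phi (rho, 0)))|]. apply HM. right. simpl. lra. }
  destruct (half_pow_small (32 * M) e) as [N HN]; try lra.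
  rewrite (cint_taylor N) by (auto; intros j Hj; apply HZ; lia).
  replace (cint 0 0 + Cpow w (S N) * cint (S N) w - cint 0 0)%C with (Cpow w (S N) * cint (S N) w)%C by ring.
  rewrite Cmod_mult, Cmod_pow.
  apply Rle_trans with ((rho / 2) ^ S N * (32 * M * (/ rho) ^ S N)).
  - apply Rmult_le_compat; [apply pow_le, Cmod_ge_0|apply Cmod_ge_0|apply pow_incr; split; [apply Cmod_ge_0|auto]|apply cint_bound; auto].
  - replace ((rho / 2) ^ S N * (32 * M * (/ rho) ^ S N)) with ((/ 2) ^ S N * (32 * M)).
    + pose proof (half_pow_pos N). simpl. nra.
    + replace (/ 2) with (rho / 2 * / rho) by (field; lra). rewrite Rpow_mult_distr. ring.
Qed.
End Integrals.

(** Apply [cint_flat] to the constant 1: its coefficients are integrals of z^(-j-1) with j >= 1,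
    which have the primitive -z^(-j) / j. *)
Lemma winding_const w : Cmod w <= rho / 2 -> winding w = winding 0.
Proof.
  intros Hw.
  assert (E : forall v, winding v = cint (fun _ => RtoC 1) 0 v).
  { intros v. unfold winding, cint. apply bint_ext; try lra. intros z _. simpl. ring. }
  rewrite !E. apply cint_flat with (M := 1); auto.
  - intros z _. apply dC_const.
  - intros z _. rewrite Cmod_1. lra.
  - assert (Hpow : forall j (z : C), z <> 0 -> isdC (fun u => Cpow (/ u) (S j)) z
      (- RtoC (INR (S j)) * Cpow (/ z) (S (S j)))%C).
    { intros j z Hz. induction j.
      - apply (is_derive_ext Cinv). { intros t. simpl. ring. }
        replace (- RtoC (INR 1) * Cpow (/ z) 2)%C with (- / (z * z))%C by (simpl; field; auto).
        apply isdC_inv, Hz.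
      - replace (- RtoC (INR (S (S j))) * Cpow (/ z) (S (S (S j))))%C with
          (- / (z * z) * Cpow (/ z) (S j) + / z * (- RtoC (INR (S j)) * Cpow (/ z) (S (S j))))%C.
        + apply (isdC_mult Cinv (fun u => Cpow (/ u) (S j))); [apply isdC_inv, Hz|exact IHj].
        + rewrite (S_INR (S j)), RtoC_plus, !(Cpow_S (/ z)). generalize (Cpow (/ z) j). intros p. field. exact Hz. }
    intros [|j] Hj; [lia|]. set (k := RtoC (INR (S j))).
    assert (Hk : k <> 0) by (apply RtoC_neq_0; pose proof (lt_0_INR (S j) ltac:(lia)); lra).
    unfold cint. apply (bint_ftc (- rho) rho (- rho) rho ltac:(lra) ltac:(lra) (fun z => - / k * Cpow (/ z) (S j) + 0)%C).
    + intros z Hz. apply dC_continuous, cint_dC; auto using Cmod_0_le_half. intros u _. apply dC_const.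
    + intros z Hz. destruct (bds_far z 0 Hz Cmod_0_le_half) as (_ & _ & N0).
      replace (1 * (Cpow (/ z) (S j) * / (z - 0)))%C with (- / k * (- k * Cpow (/ z) (S (S j))))%C.
      * apply (isdC_comp (fun u => - / k * u + 0)%C (fun u => Cpow (/ u) (S j))); [apply isdC_affine|apply Hpow, N0].
      * rewrite (Cpow_S (/ z) (S j)). replace (z - 0)%C with z by ring.
        generalize (Cpow (/ z) (S j)). intros p. field. auto.
Qed.

Variable phi : C -> C.
Hypothesis Hphi : forall z, Cmod z <= 2 * rho -> dC phi z.
Variable M : R.
Hypothesis HM : forall z, bds z -> Cmod (phi z) <= M.
Notation ci := (cint phi).

(** The difference quotient of [phi] at [w] is bounded near [w], so its integral vanishes. The
    constant 2 pi i appears as [winding 0]; its value is never computed, only that it is nonzero. *)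
Lemma cauchy_formula w : Cmod w <= rho / 2 -> (winding 0 * phi w)%C = ci 0 w.
Proof.
  intros Hw.
  assert (Hex : dC phi w) by (apply Hphi; lra).
  assert (H0 : sq (fun z => (phi z - phi w) * / (z - w))%C = 0).
  { destruct Hex as [l Hl]. rewrite is_derive_C in Hl. destruct (Hl 1 Rlt_0_1) as (r & Hr & Hy).
    pose proof (re_le_Cmod w) as Hre. pose proof (im_le_Cmod w) as Him.
    apply (Rle_trans _ _ _ Hre) in Hw as Hre'. apply (Rle_trans _ _ _ Him) in Hw as Him'.
    apply Rabs_le_between in Hre'. apply Rabs_le_between in Him'.
    apply (goursat_punctured _ w (1 + Cmod l) r); try lra.
    - pose proof (Cmod_ge_0 l). lra.
    - intros z Hz Hne.
      assert (Hne' : (z - w)%C <> 0) by (intros E; apply Hne, Cminus_eq_0, E).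
      apply (dC_mult (fun z => phi z - phi w)%C (fun z => / (z - w))%C).
      + apply dC_minus; [|apply dC_const]. apply Hphi. unfold rect in Hz.
        eapply Rle_trans; [apply Cmod_le_abs|].
        assert (Rabs (Re z) <= rho) by (apply Rabs_le; lra). assert (Rabs (Im z) <= rho) by (apply Rabs_le; lra). lra.
      + apply (dC_inv (fun u => u - w)%C); auto.
        apply (dC_ext (fun u => 1 * u + - w)%C); [intros; ring|]. apply dC_affine.
    - intros z Hne Hzr.
      assert (Hne' : (z - w)%C <> 0) by (intros E; apply Hne, Cminus_eq_0, E).
      pose proof (proj1 (Cmod_gt_0 _) Hne') as Hpos.
      replace ((phi z - phi w) * / (z - w))%C with ((phi z - phi w - l * (z - w)) * / (z - w) + l)%C by (field; auto).
      eapply Rle_trans; [apply Cmod_triangle|]. apply Rplus_le_compat_r.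
      rewrite Cmod_mult, Cmod_inv by auto. specialize (Hy z Hzr).
      apply (Rmult_le_reg_r (Cmod (z - w))); auto. rewrite Rmult_assoc, Rinv_l, Rmult_1_r by lra. lra. }
  assert (E : ci 0 w = sq (fun z => (phi z - phi w) * / (z - w) + phi w * / (z - w))%C).
  { unfold cint. apply bint_ext; try lra. intros z Hz. simpl. ring. }
  assert (D1 : cBs (fun z => / (z - w))%C) by (intros z Hz; apply dC_continuous, dC_cauchy_kernel; auto).
  rewrite E, bint_plus, bint_scal, H0; try lra; auto.
  - fold (winding w). rewrite (winding_const w Hw). ring.
  - intros z Hz. apply dC_continuous. apply (dC_mult (fun z => phi z - phi w)%C (fun z => / (z - w))%C);
      [|apply dC_cauchy_kernel; auto].
    apply dC_minus; [|apply dC_const]. apply Hphi, bds_Cmod, Hz.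
  - intros z Hz. apply dC_continuous, dC_scal, dC_cauchy_kernel; auto.
Qed.

(** The exponent is the index of the first nonvanishing coefficient; if there is none, [phi] is
    constant nearby. A Lipschitz bound for the cofactor is enough for the sequel. *)
Lemma power_at_0 :
  (forall w, Cmod w <= rho / 2 -> phi w = phi 0) \/
  exists n (G : C -> C) K, (1 <= n)%nat /\ G 0 <> 0 /\
    (forall w, Cmod w <= rho / 2 -> (phi w - phi 0)%C = (Cpow w n * G w)%C) /\
    (forall w v, Cmod w <= rho / 2 -> Cmod v <= rho / 2 -> Cmod (G w - G v) <= K * Cmod (w - v)).
Proof.
  assert (HW := winding_neq_0). pose proof (proj1 (Cmod_gt_0 _) HW) as HWp.
  assert (HPhi : forall w, Cmod w <= rho / 2 -> (phi w - phi 0)%C = (/ winding 0 * (ci 0 w - ci 0 0))%C).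
  { intros w Hw. rewrite <- !cauchy_formula by (auto using Cmod_0_le_half). field. exact HW. }
  destruct (classic (exists j, (1 <= j)%nat /\ ci j 0 <> 0)) as [Hex|Hno].
  - right.
    assert (Hmin : exists n, (1 <= n)%nat /\ ci n 0 <> 0 /\ forall j, (1 <= j < n)%nat -> ci j 0 = 0).
    { destruct Hex as (j & Hj). revert Hj. induction j as [j IH] using (well_founded_induction Nat.lt_wf_0). intros [Hj1 Hj2].
      destruct (classic (exists i, (i < j)%nat /\ (1 <= i)%nat /\ ci i 0 <> 0)) as [(i & Hi & Hi')|Hn].
      - apply (IH i Hi Hi').
      - exists j. split; [auto|]. split; [auto|]. intros i Hi. apply NNPP. intros Hc. apply Hn. exists i. split; [lia|]. split; [lia|auto]. }
    destruct Hmin as (n & Hn & Hne & Hj). destruct (cint_lip phi Hphi M HM n) as [K HK].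
    exists n, (fun w => / winding 0 * ci n w)%C, (/ Cmod (winding 0) * K). split; [exact Hn|]. split; [|split].
    + apply Cmult_neq_0; auto. intros E. apply C1_nz. rewrite <- (Cinv_l _ HW), E. ring.
    + intros w Hw. rewrite (HPhi w Hw). destruct n as [|n]; [lia|]. rewrite (cint_taylor phi Hphi n Hj w Hw). ring.
    + intros w v Hw Hv. replace (/ winding 0 * ci n w - / winding 0 * ci n v)%C with (/ winding 0 * (ci n w - ci n v))%C by ring.
      rewrite Cmod_mult, Cmod_inv, Rmult_assoc by auto.
      apply Rmult_le_compat_l; [apply Rlt_le, Rinv_0_lt_compat, HWp|]. auto.
  - left. intros w Hw. apply Cminus_eq_0, Cmod_zero_le.
    assert (HZ : forall j, (1 <= j)%nat -> ci j 0 = 0) by (intros j Hj; apply NNPP; intros Hc; apply Hno; eauto).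
    replace (phi w - phi 0)%C with (/ winding 0 * (ci 0 w - ci 0 0))%C by (symmetry; auto).
    rewrite (cint_flat phi Hphi M HM w HZ Hw), Cmod_mult.
    replace (ci 0 0 - ci 0 0)%C with (RtoC 0) by ring. rewrite Cmod_0. lra.
Qed.

End Square.

(** Bernoulli's inequality weakened to a bound independent of [n]. *)
Lemma pow_1t n t : (1 <= n)%nat -> 0 < t -> t <= (1 + t) ^ n - 1.
Proof.
  intros Hn Ht. destruct n as [|n]; [lia|]. simpl.
  assert (1 <= (1 + t) ^ n) by (apply pow_R1_Rle; lra). nra.
Qed.

(** Write phi(p + u) - phi(p) = u^n G(u) and move radially from u to (1 + t) u. The power changes by
    at least t |u|^n while G, being Lipschitz, changes much less, so the increment is of order t
    |u|^n and the derivative at p + u cannot be 0. *)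
Lemma derive_zeros_isolated (phi : C -> C) (p : C) r : 0 < r ->
  (forall z, Cmod (z - p) < r -> dC phi z) ->
  (forall e, 0 < e -> exists w, Cmod (w - p) < e /\ phi w <> phi p) ->
  exists d, 0 < d /\ forall w, 0 < Cmod (w - p) < d -> ~ isdC phi w (RtoC 0).
Proof.
  intros Hr Hphi Hnc.
  assert (Hcp : continuous phi p) by (apply dC_continuous, Hphi; replace (p - p)%C with (RtoC 0) by ring; rewrite Cmod_0; exact Hr).
  rewrite continuous_C in Hcp. destruct (Hcp 1 Rlt_0_1) as (r' & Hr' & Hb).
  set (rho := Rmin r r' / 3). assert (Hrr : 0 < Rmin r r') by (apply Rmin_pos; auto).
  pose proof (Rmin_l r r') as Hrl. pose proof (Rmin_r r r') as Hrl'.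
  assert (Hrho : 0 < rho) by (unfold rho; lra).
  set (psi := fun z => phi (p + z)%C).
  assert (Hpsi : forall z, Cmod z <= 2 * rho -> dC psi z).
  { intros z Hz. apply (dC_comp phi (fun z => p + z)%C).
    - apply Hphi. replace (p + z - p)%C with z by ring. unfold rho in Hz. lra.
    - apply (dC_ext (fun u => 1 * u + p)%C); [intros; ring|]. apply dC_affine. }
  assert (HM : forall z, bd (- rho) rho (- rho) rho z -> Cmod (psi z) <= 1 + Cmod (phi p)).
  { intros z Hz. apply (bds_Cmod rho Hrho) in Hz. unfold psi.
    assert (Hz' : Cmod (p + z - p) < r') by (replace (p + z - p)%C with z by ring; unfold rho in Hz; lra).
    pose proof (Hb _ Hz'). pose proof (Cmod_triangle_inv (phi (p + z)%C) (phi p)). lra. }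
  assert (E0 : psi 0 = phi p) by (unfold psi; f_equal; ring).
  destruct (power_at_0 rho Hrho psi Hpsi _ HM) as [Hc|(n & G & K & Hn & HG0 & HG & HL)].
  - exfalso. destruct (Hnc (rho / 2)) as (w & Hw & Hne); [lra|]. apply Hne.
    rewrite <- E0, <- (Hc (w - p)%C) by lra. unfold psi. f_equal. ring.
  - pose proof (proj1 (Cmod_gt_0 _) HG0) as Hg. set (g := Cmod (G 0)) in *.
    set (K' := Rabs K + 1). assert (HK' : 0 < K') by (unfold K'; pose proof (Rabs_pos K); lra).
    assert (HL' : forall w v, Cmod w <= rho / 2 -> Cmod v <= rho / 2 -> Cmod (G w - G v) <= K' * Cmod (w - v)).
    { intros w v Hw Hv. eapply Rle_trans; [apply HL; auto|]. apply Rmult_le_compat_r; [apply Cmod_ge_0|].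
      unfold K'. pose proof (Rle_abs K). lra. }
    exists (Rmin (rho / 4) (g / (8 * K'))). split; [apply Rmin_pos; [lra|apply Rdiv_lt_0_compat; lra]|].
    intros w [Hw0 Hw] HD. pose proof (Rlt_le_trans _ _ _ Hw (Rmin_l _ _)) as Hw1.
    pose proof (Rlt_le_trans _ _ _ Hw (Rmin_r _ _)) as Hw2.
    set (u := (w - p)%C) in *. set (m := Cmod u) in *.
    assert (HKm : K' * m < g / 8).
    { apply (Rmult_lt_compat_l K') in Hw2; auto. replace (K' * (g / (8 * K'))) with (g / 8) in Hw2 by (field; lra). exact Hw2. }
    destruct n as [|n]; [lia|].
    assert (Hmn : 0 < m ^ n) by (apply pow_lt, Hw0).
    (* Here the exponent is n + 1. In units of t m^(n+1) g the main term is at least 1/2, while the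
       variation of [G] and the assumed zero derivative account for at most 1/8 each. *)
    rewrite is_derive_C in HD. destruct (HD (m ^ n * (g / 8))) as (d & Hd & HDd).
    { apply Rmult_lt_0_compat; lra. }
    set (t := Rmin (/ 2) (d / (2 * m))).
    assert (Ht : 0 < t) by (apply Rmin_pos; [lra|apply Rdiv_lt_0_compat; lra]).
    assert (Ht1 : t <= / 2) by apply Rmin_l.
    assert (Ht2 : t * m < d).
    { assert (t <= d / (2 * m)) by apply Rmin_r. apply (Rmult_le_compat_r m) in H; [|lra].
      replace (d / (2 * m) * m) with (d / 2) in H by (field; lra). lra. }
    set (v := (RtoC (1 + t) * u)%C).
    assert (Hvu : (v - u)%C = (RtoC t * u)%C) by (unfold v; rewrite RtoC_plus; ring).
    assert (Hcu : Cmod u <= rho / 2) by (fold m; lra).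
    assert (Hcv : Cmod v <= rho / 2).
    { unfold v. rewrite Cmod_mult, Cmod_R, Rabs_pos_eq by lra. fold m. nra. }
    assert (Hcvu : Cmod (v - u) = t * m) by (rewrite Hvu, Cmod_mult, Cmod_R, Rabs_pos_eq by lra; reflexivity).
    assert (H1 : Cmod (psi v - psi u) <= m ^ n * (g / 8) * (t * m)).
    { specialize (HDd (p + v)%C). replace (p + v - w)%C with (v - u)%C in HDd by (unfold u; ring).
      rewrite Hcvu in HDd. specialize (HDd Ht2). unfold psi.
      replace (p + u)%C with w by (unfold u; ring).
      replace (phi (p + v)%C - phi w - 0 * (v - u))%C with (phi (p + v)%C - phi w)%C in HDd by ring. exact HDd. }
    assert (H2 : (psi v - psi u)%C = (RtoC ((1 + t) ^ S n - 1) * Cpow u (S n) * G v + Cpow u (S n) * (G v - G u))%C).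
    { replace (psi v - psi u)%C with ((psi v - psi 0) - (psi u - psi 0))%C by ring. rewrite (HG v Hcv), (HG u Hcu).
      unfold v at 1. rewrite Cpow_mult_l, <- RtoC_pow, RtoC_minus. ring. }
    pose proof (HL' v u Hcv Hcu) as H3. rewrite Hcvu in H3.
    assert (H4 : g / 2 <= Cmod (G v)).
    { assert (Z0 : Cmod 0 <= rho / 2) by (rewrite Cmod_0; lra).
      pose proof (HL' 0 v Z0 Hcv) as H4. pose proof (Cmod_triangle_inv (G 0) (G v)) as H5. fold g in H5.
      assert (Cmod (0 - v) <= 2 * m).
      { replace (0 - v)%C with (- v)%C by ring. rewrite Cmod_opp. unfold v. rewrite Cmod_mult, Cmod_R, Rabs_pos_eq by lra. fold m. nra. }
      assert (K' * Cmod (0 - v) <= K' * (2 * m)) by (apply Rmult_le_compat_l; lra). lra. }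
    pose proof (pow_1t (S n) t ltac:(lia) Ht) as H5.
    pose proof (Cmod_triangle_inv (RtoC ((1 + t) ^ S n - 1) * Cpow u (S n) * G v) (- (Cpow u (S n) * (G v - G u)))) as H6.
    rewrite Cmod_opp in H6.
    replace (RtoC ((1 + t) ^ S n - 1) * Cpow u (S n) * G v - - (Cpow u (S n) * (G v - G u)))%C with (psi v - psi u)%C in H6
      by (rewrite H2; ring).
    rewrite !Cmod_mult, Cmod_R, Cmod_pow, Rabs_pos_eq in H6 by lra. fold m in H6.
    change (m ^ S n) with (m * m ^ n) in H6.
    assert (Hmm : 0 < m * m ^ n) by (apply Rmult_lt_0_compat; auto).
    assert (A1 : t * (m * m ^ n) * (g / 2) <= ((1 + t) ^ S n - 1) * (m * m ^ n) * Cmod (G v)).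
    { apply Rmult_le_compat; try lra. apply Rmult_le_pos; lra. apply Rmult_le_compat_r; lra. }
    assert (A2 : m * m ^ n * Cmod (G v - G u) <= m * m ^ n * (t * (g / 8))).
    { apply Rmult_le_compat_l; [lra|]. eapply Rle_trans; [exact H3|]. nra. }
    assert (A3 : 0 < t * (m * m ^ n) * g) by (apply Rmult_lt_0_compat; auto; apply Rmult_lt_0_compat; auto).
    lra.
Qed.

(** * Rigidity: the map is not conjugate to an affine one *)

Definition clamp (lo hi t : R) : R := Rmax lo (Rmin hi t).

Lemma clamp_in lo hi t : lo <= hi -> lo <= clamp lo hi t <= hi.
Proof.
  intros H. unfold clamp. split; [apply Rmax_l|]. apply Rmax_lub; [exact H|apply Rmin_l].
Qed.

Lemma clamp_id lo hi t : lo <= t <= hi -> clamp lo hi t = t.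
Proof. intros H. unfold clamp. rewrite Rmin_right, Rmax_right; lra. Qed.

Lemma clamp_lip lo hi t s : Rabs (clamp lo hi t - clamp lo hi s) <= Rabs (t - s).
Proof.
  unfold clamp, Rmax, Rmin. repeat destruct (Rle_dec _ _); unfold Rabs; repeat destruct (Rcase_abs _); lra.
Qed.

(** A separation of the curve would give a continuous function with values 0 and 1 only, against the
    intermediate value theorem. *)
Lemma connected_curve (g : R -> C) lo hi : lo <= hi ->
  (forall t, lo <= t <= hi -> forall e, 0 < e -> exists d, 0 < d /\ forall s, lo <= s <= hi -> Rabs (s - t) < d -> Cmod (g s - g t) < e) ->
  connected_set (fun w => exists t, lo <= t <= hi /\ w = g t).
Proof.
  intros Hlh Hg O1 O2 H1 H2 Hcov Hdis.
  destruct (classic (forall w, (exists t, lo <= t <= hi /\ w = g t) -> O1 w)) as [|N1]; [left; assumption|].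
  destruct (classic (forall w, (exists t, lo <= t <= hi /\ w = g t) -> O2 w)) as [|N2]; [right; assumption|].
  exfalso. apply not_all_ex_not in N1. destruct N1 as [w1 N1]. apply imply_to_and in N1. destruct N1 as [(t1 & T1 & ->) N1].
  apply not_all_ex_not in N2. destruct N2 as [w2 N2]. apply imply_to_and in N2. destruct N2 as [(t2 & T2 & ->) N2].
  (* Clamping the parameter extends the curve to all of R, where [IVT_gen] asks for continuity. *)
  set (c := clamp lo hi). assert (Hc : forall t, lo <= c t <= hi) by (intros; apply clamp_in, Hlh).
  set (h := fun t => if excluded_middle_informative (O1 (g (c t))) then 0 else 1).
  assert (Hloc : forall (O : C -> Prop) t, open O -> O (g (c t)) -> exists d, 0 < d /\ forall s, Rabs (s - t) < d -> O (g (c s))).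
  { intros O t HO Ht. destruct (proj1 (locally_Cmod _ _) (HO _ Ht)) as (e & He & HB).
    destruct (Hg (c t) (Hc t) e He) as (d & Hd & Hs). exists d. split; [exact Hd|].
    intros s Hst. apply HB, Hs; auto. eapply Rle_lt_trans; [apply clamp_lip|exact Hst]. }
  assert (Hcont : Ranalysis1.continuity h).
  { intros t. apply continuity_pt_locally. intros e.
    assert (HE : exists d, 0 < d /\ forall s, Rabs (s - t) < d -> h s = h t).
    { destruct (Hcov (g (c t))) as [Ho|Ho]; [exists (c t); auto| |].
      - destruct (Hloc O1 t H1 Ho) as (d & Hd & Hs). exists d. split; auto. intros s Hst. unfold h.
        destruct (excluded_middle_informative (O1 (g (c s)))) as [|n]; [|exfalso; apply n, Hs, Hst].
        destruct (excluded_middle_informative (O1 (g (c t)))) as [|n]; [reflexivity|contradiction].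
      - destruct (Hloc O2 t H2 Ho) as (d & Hd & Hs). exists d. split; auto. intros s Hst. unfold h.
        destruct (excluded_middle_informative (O1 (g (c s)))) as [y|].
        { exfalso. apply (Hdis (g (c s))); auto. exists (c s); auto. }
        destruct (excluded_middle_informative (O1 (g (c t)))) as [y|]; [|reflexivity].
        exfalso. apply (Hdis (g (c t))); auto. exists (c t); auto. }
    destruct HE as (d & Hd & Hs). exists (mkposreal d Hd). intros s Hst. rewrite (Hs s Hst).
    replace (h t - h t) with 0 by ring. rewrite Rabs_R0. apply cond_pos. }
  assert (E1 : h t1 = 1).
  { unfold h, c. rewrite clamp_id by exact T1. destruct (excluded_middle_informative _); [contradiction|reflexivity]. }
  assert (E2 : h t2 = 0).
  { unfold h, c. rewrite clamp_id by exact T2. destruct (excluded_middle_informative _) as [|n]; [reflexivity|].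
    exfalso. destruct (Hcov (g t2)) as [Ho|Ho]; [exists t2; auto|apply n, Ho|apply N2, Ho]. }
  destruct (IVT_gen h t1 t2 (/ 2) Hcont) as (x & _ & Hx).
  { rewrite E1, E2, Rmin_right, Rmax_left; lra. }
  unfold h in Hx. destruct (excluded_middle_informative _); lra.
Qed.

(** A complex derivative is determined by the restriction to a real interval, so the functional
    equation of [phi] is only needed at real points. *)
Lemma derive_eq_on_reals (F G : C -> C) (x : R) (a b : C) d : 0 < d ->
  isdC F (RtoC x) a -> isdC G (RtoC x) b ->
  (forall t, Rabs (t - x) < d -> F (RtoC t) = G (RtoC t)) -> a = b.
Proof.
  intros Hd HF HG HE.
  assert (E : forall t, RtoC t = (0 + RtoC t * 1)%C) by (intros; ring).
  rewrite E in HF, HG. apply line_derive in HF. apply line_derive in HG. rewrite Cmult_1_r in HF, HG.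
  destruct HF as [F1 F2]. destruct HG as [G1 G2].
  assert (HL : forall P : R -> Prop, (forall t, Rabs (t - x) < d -> P t) -> locally x P) by (intros P HP; exists (mkposreal d Hd); exact HP).
  assert (E1 : Re a = Re b).
  { rewrite <- (is_derive_unique _ _ _ G1), <- (is_derive_unique _ _ _ F1).
    apply Derive_ext_loc, HL. intros t Ht. rewrite <- E, HE by exact Ht. reflexivity. }
  assert (E2 : Im a = Im b).
  { rewrite <- (is_derive_unique _ _ _ G2), <- (is_derive_unique _ _ _ F2).
    apply Derive_ext_loc, HL. intros t Ht. rewrite <- E, HE by exact Ht. reflexivity. }
  destruct a, b. unfold Re, Im in *. simpl in *. congruence.
Qed.

Definition rside (s : bool) (x : R) : Prop := if s then 0 < x else x < 0.

(** The real trace of one component of the domain, an interval by [rdom_between]. *)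
Definition rdom (e : nat -> R) (s : bool) (x : R) : Prop := Rabs x < 1 /\ Rabs (fr e x) < 1 /\ rside s x.

Lemma rdom_domain e s x : rdom e s x -> domain e (RtoC x).
Proof. intros (H1 & H2 & _). split; unfold unit_disk; rewrite ?fC_real, Cmod_R; auto. Qed.

Lemma fr_mono_abs e x y : adm e -> Rabs x <= Rabs y -> fr e x <= fr e y.
Proof.
  intros H Hxy. rewrite <- (fr_Rabs e x), <- (fr_Rabs e y). destruct Hxy as [Hxy| ->]; [|lra].
  apply Rlt_le, fr_incr; auto. split; [apply Rabs_pos|auto].
Qed.

Lemma rdom_between e s x y t : adm e -> rdom e s x -> rdom e s y -> Rmin x y <= t <= Rmax x y -> rdom e s t.
Proof.
  intros H (X1 & X2 & X3) (Y1 & Y2 & Y3) Ht.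
  assert (HT : rside s t /\ Rmin (Rabs x) (Rabs y) <= Rabs t <= Rmax (Rabs x) (Rabs y)).
  { destruct s; simpl in *.
    - rewrite (Rabs_pos_eq x), (Rabs_pos_eq y) by lra. revert Ht. unfold Rmin, Rmax.
      destruct (Rle_dec x y); intros; rewrite Rabs_pos_eq; lra.
    - rewrite (Rabs_left x), (Rabs_left y) by lra. revert Ht. unfold Rmin, Rmax.
      destruct (Rle_dec x y), (Rle_dec (- x) (- y)); intros; rewrite (Rabs_left t); lra. }
  destruct HT as [HT1 HT2].
  assert (HW : (Rabs x <= Rabs t <= Rabs y) \/ (Rabs y <= Rabs t <= Rabs x)).
  { revert HT2. unfold Rmin, Rmax. destruct (Rle_dec (Rabs x) (Rabs y)); intros; lra. }
  split; [|split; [|exact HT1]].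
  - lra.
  - apply Rabs_def2 in X2. apply Rabs_def2 in Y2. apply Rabs_def1;
    destruct HW as [[W1 W2]|[W1 W2]]; pose proof (fr_mono_abs e _ _ H W1); pose proof (fr_mono_abs e _ _ H W2); lra.
Qed.

Lemma rdom_nbhd e s x : adm e -> rdom e s x -> exists d, 0 < d /\ forall t, Rabs (t - x) < d -> rdom e s t.
Proof.
  intros H Hx. destruct (proj1 (locally_Cmod _ _) (open_domain e H _ (rdom_domain e s x Hx))) as (d & Hd & HB).
  destruct Hx as (_ & _ & Hx).
  assert (Hx0 : 0 < Rabs x) by (apply Rabs_pos_lt; destruct s; simpl in Hx; lra).
  exists (Rmin d (Rabs x)). split; [apply Rmin_pos; auto|]. intros t Ht.
  pose proof (Rlt_le_trans _ _ _ Ht (Rmin_l _ _)) as Ht1. pose proof (Rlt_le_trans _ _ _ Ht (Rmin_r _ _)) as Ht2.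
  destruct (HB (RtoC t)) as [B1 B2]; [rewrite <- RtoC_minus, Cmod_R; exact Ht1|].
  unfold unit_disk in *. rewrite fC_real, Cmod_R in B2. rewrite Cmod_R in B1. split; [|split]; auto.
  destruct s; simpl in *; unfold Rabs in Ht2; destruct (Rcase_abs (t - x)), (Rcase_abs x); lra.
Qed.

Lemma rside_of_side s x : side s (RtoC x) -> rside s x.
Proof. destruct s; simpl; lra. Qed.

(** By uniqueness the branch commutes with conjugation, hence sends reals to reals. The last clause
    makes backward orbits contract by 7. *)
Lemma real_branch e s y : adm e -> Rabs y < 1 -> exists x, rdom e s x /\ fr e x = y /\
  forall x', rdom e s x' -> 7 * Rabs (x - x') <= Rabs (y - fr e x').
Proof.
  intros H Hy. assert (Hyc : Cmod (RtoC y) <= 1) by (rewrite Cmod_R; lra).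
  destruct (branch_spec e s (RtoC y) H Hyc) as (B1 & B2 & B3). set (z := branch e s (RtoC y)) in *.
  assert (Hz : z = RtoC (Re z)).
  { apply Im_0_real, Cconj_fixed.
    assert (Hcz : fC e (Cconj z) = RtoC y) by (rewrite fC_conj, B3; apply Cconj_RtoC).
    unfold z at 2. rewrite <- Hcz. symmetry.
    apply branch_unique; [exact H|rewrite Cmod_conj; lra|apply side_conj, B2|rewrite Hcz; exact Hyc]. }
  assert (Hf : fr e (Re z) = y) by (apply RtoC_inj; rewrite <- fC_real, <- Hz; exact B3).
  assert (Hd : rdom e s (Re z)).
  { split; [rewrite <- Cmod_R, <- Hz; exact B1|]. split; [rewrite Hf; exact Hy|].
    apply rside_of_side. rewrite <- Hz. exact B2. }
  exists (Re z). split; [exact Hd|]. split; [exact Hf|].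
  intros x' (X1 & X2 & X3).
  assert (Hs : side s (RtoC x')).
  { pose proof (fC_region e (RtoC x') H) as HR. rewrite fC_real, !Cmod_R in HR.
    destruct (HR ltac:(lra) ltac:(lra)) as [_ HR2]. rewrite re_RtoC in HR2.
    destruct s; simpl in *; unfold Rabs in HR2; destruct (Rcase_abs x'); lra. }
  pose proof (fC_expand e s z (RtoC x') H ltac:(lra) ltac:(rewrite Cmod_R; lra) B2 Hs) as HE.
  rewrite B3, fC_real, Hz, <- !RtoC_minus, !Cmod_R in HE. exact HE.
Qed.

Lemma rdom_periodic e n x (s : nat -> bool) : adm e -> (1 <= n)%nat -> Nat.iter n (fr e) x = x ->
  (forall k, (k < n)%nat -> side (s k) (RtoC (Nat.iter k (fr e) x))) ->
  forall k, (k < n)%nat -> rdom e (s k) (Nat.iter k (fr e) x).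
Proof.
  intros H Hn Hx Hs k Hk. split; [apply (periodic_bounded e n x H Hn Hx)|].
  split; [apply (periodic_bounded e n x H Hn Hx (S k))|]. apply rside_of_side, Hs, Hk.
Qed.

Section Rigidity.
Variable e : nat -> R.
Hypothesis He : adm e.
Variable phi : C -> C.
Hypothesis Huni : univalent_on unit_disk phi.
Hypothesis Haff : forall z0, domain e z0 -> exists a b : C,
  forall z, domain e z ->
    same_component (fun w => exists u, domain e u /\ w = phi u) (phi z0) (phi z) ->
    phi (fC e z) = Cplus (Cmult a (phi z)) b.

Let Dphi (x : R) (l : C) : Prop := isdC phi (RtoC x) l.

Lemma disk_real x : Rabs x < 1 -> unit_disk (RtoC x).
Proof. intros H. unfold unit_disk. rewrite Cmod_R. exact H. Qed.

Lemma Dphi_exists x : Rabs x < 1 -> exists l, Dphi x l.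
Proof. intros H. apply (proj1 Huni), disk_real, H. Qed.

(** Two real points of one side are joined by a real interval inside the domain, and its image under
    [phi] is connected. So they lie in one component, without any description of the components in
    the plane. *)
Lemma affine_on_reals s : exists a b : C, forall x, rdom e s x -> phi (RtoC (fr e x)) = (a * phi (RtoC x) + b)%C.
Proof.
  destruct (real_branch e s 0 He) as (x0 & Hx0 & _); [rewrite Rabs_R0; lra|].
  destruct (Haff (RtoC x0) (rdom_domain e s x0 Hx0)) as (a & b & Hab). exists a, b.
  intros x Hx. rewrite <- fC_real. apply Hab; [apply (rdom_domain e s), Hx|].
  assert (Hb : forall t, Rmin x0 x <= t <= Rmax x0 x -> rdom e s t) by (intros t; apply (rdom_between e s x0 x t He Hx0 Hx)).
  exists (fun w => exists t, Rmin x0 x <= t <= Rmax x0 x /\ w = phi (RtoC t)). split; [|split; [|split]].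
  - apply (connected_curve (fun t => phi (RtoC t))); [apply Rminmax|].
    intros t Ht eps Heps. destruct (Hb t Ht) as (Ht1 & _).
    destruct (Dphi_exists t Ht1) as [l Hl]. pose proof (derive_continuous_C _ _ _ Hl) as Hc. rewrite continuous_C in Hc.
    destruct (Hc eps Heps) as (d & Hd & Hy). exists d. split; auto. intros s' _ Hs'. apply Hy.
    rewrite <- RtoC_minus, Cmod_R. exact Hs'.
  - intros w (t & Ht & ->). exists (RtoC t). split; auto. apply (rdom_domain e s), Hb, Ht.
  - exists x0. split; auto. split; [apply Rmin_l|apply Rmax_l].
  - exists x. split; auto. split; [apply Rmin_r|apply Rmax_r].
Qed.

(** Differentiating phi(f(x)) = a phi(x) + b. As [a] and f'(x) are nonzero, the relation carries
    zeros of phi' along [f] in both directions. *)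
Lemma derivative_relation s a b x l l' : 
  (forall x, rdom e s x -> phi (RtoC (fr e x)) = (a * phi (RtoC x) + b)%C) ->
  rdom e s x -> Dphi x l -> Dphi (fr e x) l' -> (l' * RtoC (dfr e x))%C = (a * l)%C.
Proof.
  intros Hab Hx Hl Hl'. destruct (rdom_nbhd e s x He Hx) as (d & Hd & Hn).
  apply (derive_eq_on_reals (fun z => phi (fC e z)) (fun z => a * phi z + b)%C x _ _ d Hd).
  - apply isdC_comp; [rewrite fC_real; exact Hl'|apply (fC_derive_real e _ x (adm_coefb e He))].
  - apply (isdC_comp (fun u => a * u + b)%C phi); [apply isdC_affine|exact Hl].
  - intros t Ht. rewrite fC_real. apply Hab, Hn, Ht.
Qed.

(** If a = 0, then [phi] takes the value b at both 0 and 1/2, which are values of f on the side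
    [s]. *)
Lemma multiplier_neq_0 s a b : 
  (forall x, rdom e s x -> phi (RtoC (fr e x)) = (a * phi (RtoC x) + b)%C) -> a <> 0.
Proof.
  intros Hab ->. destruct (real_branch e s 0 He) as (x & Hx & E & _); [rewrite Rabs_R0; lra|].
  destruct (real_branch e s (/ 2) He) as (y & Hy & E' & _); [rewrite Rabs_pos_eq; lra|].
  pose proof (Hab x Hx) as H1. pose proof (Hab y Hy) as H2. rewrite E in H1. rewrite E' in H2.
  assert (HC : RtoC 0 = RtoC (/ 2)).
  { apply (proj2 Huni); [apply disk_real; rewrite Rabs_R0; lra|apply disk_real; rewrite Rabs_pos_eq; lra|].
    rewrite H1, H2. ring. }
  apply RtoC_inj in HC. lra.
Qed.

Lemma dfr_neq_0 s x : rdom e s x -> dfr e x <> 0.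
Proof.
  intros (_ & _ & Hx). destruct s; simpl in Hx.
  - pose proof (dfr_incr e 0 x He ltac:(lra)). lra.
  - pose proof (dfr_incr e 0 (- x) He ltac:(lra)) as HD. rewrite dfr_odd in HD. lra.
Qed.

Lemma critical_backward s x l : rdom e s x -> Dphi (fr e x) (RtoC 0) -> Dphi x l -> l = 0.
Proof.
  intros Hx H0 Hl. destruct (affine_on_reals s) as (a & b & Hab).
  pose proof (derivative_relation s a b x l (RtoC 0) Hab Hx Hl H0) as HR.
  pose proof (multiplier_neq_0 s a b Hab) as Ha. rewrite Cmult_0_l in HR.
  replace l with (/ a * (a * l))%C by (field; exact Ha). rewrite <- HR. ring.
Qed.

Lemma critical_forward s x l : rdom e s x -> Dphi x (RtoC 0) -> Dphi (fr e x) l -> l = 0.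
Proof.
  intros Hx H0 Hl. destruct (affine_on_reals s) as (a & b & Hab).
  pose proof (derivative_relation s a b x (RtoC 0) l Hab Hx H0 Hl) as HR. rewrite Cmult_0_r in HR.
  pose proof (RtoC_neq_0 _ (dfr_neq_0 s x Hx)) as Hd.
  replace l with (l * RtoC (dfr e x) * / RtoC (dfr e x))%C by (field; exact Hd). rewrite HR. ring.
Qed.

(* A zero of phi' at a point of period two would propagate to -x, which has the
   same image, and then along backward orbits accumulating at x. *)
Lemma not_critical s0 s1 x : rdom e s0 x -> rdom e s1 (fr e x) -> fr e (fr e x) = x -> ~ Dphi x (RtoC 0).
Proof.
  intros H0 H1 Hper HD.
  assert (Hx1 : Rabs x < 1) by apply H0.
  destruct (derive_zeros_isolated phi (RtoC x) (1 - Rabs x)) as (d & Hd & Hiso).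
  - lra.
  - intros z Hz. apply (proj1 Huni). unfold unit_disk.
    pose proof (Cmod_triangle_inv z (RtoC x)) as HT. rewrite Cmod_R in HT. lra.
  - intros eps Heps. set (h := Rmin (eps / 2) ((1 - Rabs x) / 2)).
    assert (Hh : 0 < h) by (apply Rmin_pos; lra).
    assert (Hh1 : h <= eps / 2) by apply Rmin_l. assert (Hh2 : h <= (1 - Rabs x) / 2) by apply Rmin_r.
    exists (RtoC (x + h)). split.
    + rewrite <- RtoC_minus, Cmod_R. replace (x + h - x) with h by ring. rewrite Rabs_pos_eq; lra.
    + intros E. apply (proj2 Huni) in E.
      * apply RtoC_inj in E. lra.
      * apply disk_real. eapply Rle_lt_trans; [apply Rabs_triang|]. rewrite (Rabs_pos_eq h); lra.
      * apply disk_real, Hx1.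
  - assert (Hneg : rdom e (negb s0) (- x)).
    { destruct H0 as (A1 & A2 & A3). split; [rewrite Rabs_Ropp; auto|]. split; [rewrite fr_even; auto|].
      destruct s0; simpl in *; lra. }
    assert (Hpull : forall s y, Rabs y < 1 -> Dphi y (RtoC 0) -> exists t, rdom e s t /\ fr e t = y /\ Dphi t (RtoC 0) /\
      forall x', rdom e s x' -> 7 * Rabs (t - x') <= Rabs (y - fr e x')).
    { intros s y Hy Hyd. destruct (real_branch e s y He Hy) as (t & T1 & T2 & T3). exists t.
      split; [exact T1|]. split; [exact T2|]. split; [|exact T3].
      destruct (Dphi_exists t (proj1 T1)) as [l Hl].
      rewrite <- (critical_backward s t l T1 ltac:(rewrite T2; exact Hyd) Hl). exact Hl. }
    assert (Hseq : forall n, exists y, Rabs y < 1 /\ y <> x /\ Dphi y (RtoC 0) /\ Rabs (y - x) <= 2 * (/ 2) ^ n).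
    { induction n as [|n (y & Y1 & Y2 & Y3 & Y4)].
      - exists (- x). split; [apply Hneg|]. split; [|split].
        + destruct s0, H0 as (_ & _ & Hs); simpl in Hs; lra.
        + destruct (Dphi_exists (fr e x) (proj1 (proj2 H0))) as [l Hl].
          rewrite (critical_forward s0 x l H0 HD Hl) in Hl.
          destruct (Dphi_exists (- x) (proj1 Hneg)) as [l' Hl'].
          rewrite <- (critical_backward (negb s0) (- x) l' Hneg ltac:(rewrite fr_even; exact Hl) Hl'). exact Hl'.
        + replace (- x - x) with (- (x + x)) by ring. rewrite Rabs_Ropp.
          eapply Rle_trans; [apply Rabs_triang|]. simpl. lra.
      - destruct (Hpull s1 y Y1 Y3) as (t & T1 & T2 & T3 & T4).
        destruct (Hpull s0 t (proj1 T1) T3) as (u & U1 & U2 & U3 & U4).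
        exists u. split; [apply U1|]. split; [|split; [exact U3|]].
        + intros ->. apply Y2. rewrite <- T2, <- U2. exact Hper.
        + specialize (T4 _ H1). rewrite Hper in T4. specialize (U4 _ H0). simpl.
          pose proof (Rabs_pos (t - fr e x)). lra. }
    destruct (half_pow_small 2 d ltac:(lra) Hd) as [N HN].
    destruct (Hseq N) as (y & Y1 & Y2 & Y3 & Y4). apply (Hiso (RtoC y)); [|exact Y3].
    rewrite <- RtoC_minus, Cmod_R. split; [apply Rabs_pos_lt; lra|lra].
Qed.

(** Apply [derivative_relation] at both points of the cycle and cancel phi'(x). A fixed point is
    covered by taking both sides equal. *)
Lemma period_two_multiplier s0 s1 a0 b0 a1 b1 x :
  (forall x, rdom e s0 x -> phi (RtoC (fr e x)) = (a0 * phi (RtoC x) + b0)%C) ->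
  (forall x, rdom e s1 x -> phi (RtoC (fr e x)) = (a1 * phi (RtoC x) + b1)%C) ->
  rdom e s0 x -> rdom e s1 (fr e x) -> fr e (fr e x) = x ->
  RtoC (dfr e x * dfr e (fr e x)) = (a0 * a1)%C.
Proof.
  intros A0 A1 H0 H1 Hper.
  destruct (Dphi_exists x (proj1 H0)) as [l Hl]. destruct (Dphi_exists (fr e x) (proj1 H1)) as [l' Hl'].
  pose proof (derivative_relation s0 a0 b0 x l l' A0 H0 Hl Hl') as R0.
  assert (Hl2 : Dphi (fr e (fr e x)) l) by (rewrite Hper; exact Hl).
  pose proof (derivative_relation s1 a1 b1 (fr e x) l' l A1 H1 Hl' Hl2) as R1.
  assert (Hne : l <> 0). { intros ->. apply (not_critical s0 s1 x H0 H1 Hper Hl). }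
  assert (E : (l * (RtoC (dfr e x) * RtoC (dfr e (fr e x))))%C = (l * (a0 * a1))%C).
  { transitivity (l * RtoC (dfr e (fr e x)) * RtoC (dfr e x))%C; [ring|]. rewrite R1.
    transitivity (a1 * (l' * RtoC (dfr e x)))%C; [ring|]. rewrite R0. ring. }
  rewrite RtoC_mult. 
  replace (RtoC (dfr e x) * RtoC (dfr e (fr e x)))%C with (/ l * (l * (RtoC (dfr e x) * RtoC (dfr e (fr e x)))))%C by (field; exact Hne).
  rewrite E. field. exact Hne.
Qed.

Lemma rigidity_contradiction : False.
Proof.
  destruct (affine_on_reals true) as (a & b & Hp). destruct (affine_on_reals false) as (a' & b' & Hm).
  destruct (itinerary_exists e 1 (fun _ => true) He (le_n _)) as (p & Ep & Sp).
  destruct (itinerary_exists e 1 (fun _ => false) He (le_n _)) as (m & Em & Sm).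
  set (s := fun k => match k with O => true | _ => false end).
  destruct (itinerary_exists e 2 s He ltac:(lia)) as (q & Eq & Sq).
  pose proof (rdom_periodic e 1 p _ He (le_n _) Ep Sp 0%nat ltac:(lia)) as Dp.
  pose proof (rdom_periodic e 1 m _ He (le_n _) Em Sm 0%nat ltac:(lia)) as Dm.
  pose proof (rdom_periodic e 2 q s He ltac:(lia) Eq Sq 0%nat ltac:(lia)) as Dq.
  pose proof (rdom_periodic e 2 q s He ltac:(lia) Eq Sq 1%nat ltac:(lia)) as Dr.
  simpl in Ep, Em, Eq, Dp, Dm, Dq, Dr.
  assert (Mp := period_two_multiplier true true a b a b p Hp Hp Dp ltac:(rewrite Ep; exact Dp) ltac:(rewrite !Ep; reflexivity)).
  assert (Mm := period_two_multiplier false false a' b' a' b' m Hm Hm Dm ltac:(rewrite Em; exact Dm) ltac:(rewrite !Em; reflexivity)).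
  assert (Mq := period_two_multiplier true false a b a' b' q Hp Hm Dq Dr Eq).
  rewrite Ep in Mp. rewrite Em in Mm. set (r := fr e q) in *.
  (* Squares are compared, because the fixed points only determine the squares of the two slopes. *)
  assert (E : (dfr e q * dfr e r) * (dfr e q * dfr e r) = (dfr e p * dfr e p) * (dfr e m * dfr e m)).
  { apply RtoC_inj. rewrite RtoC_mult, Mq, RtoC_mult, Mp, Mm. ring. }
  assert (P0 : 0 < p) by apply Dp. assert (M0 : m < 0) by apply Dm.
  assert (Q0 : 0 < q) by apply Dq. assert (R0 : r < 0) by apply Dr.
  assert (Emm : fr e (- m) = m) by (rewrite fr_even; exact Em).
  assert (Err : fr e (- r) = q) by (rewrite fr_even; exact Eq).
  assert (Hlt : forall x y, 0 < x -> 0 < y -> fr e x < fr e y -> x < y).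
  { intros x y Hx Hy Hf. destruct (Rlt_or_le x y) as [|[Hyx| ->]]; auto; [|lra].
    pose proof (fr_incr e y x He ltac:(lra)). lra. }
  (* Since f increases on positive numbers, points are compared through the values f(-m) = m, f(-r)
     = q, f(q) = r, f(p) = p. The order matters: [L1] gives r < m, used for [L2], and [L3] is used
     for [L4]. *)
  assert (L1 : - m < - r) by (apply Hlt; rewrite ?Emm, ?Err; lra).
  assert (L2 : q < - m) by (apply Hlt; rewrite ?Emm; fold r; lra).
  assert (L3 : q < p) by (apply Hlt; fold r; lra).
  assert (L4 : - r < p) by (apply Hlt; rewrite ?Err; lra).
  pose proof (dfr_incr e q (- m) He ltac:(lra)) as D1. pose proof (dfr_incr e (- r) p He ltac:(lra)) as D2.
  pose proof (dfr_incr e 0 q He ltac:(lra)) as D3. pose proof (dfr_incr e 0 (- r) He ltac:(lra)) as D4.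
  assert (HX : dfr e q * dfr e (- r) < dfr e (- m) * dfr e p) by (apply Rmult_le_0_lt_compat; lra).
  rewrite !dfr_odd in *.
  assert (0 < dfr e q * - dfr e r) by (apply Rmult_lt_0_compat; lra). nra.
Qed.
End Rigidity.

Lemma fC_not_affine e : adm e -> ~ conj_to_affine_eql (domain e) unit_disk (fC e).
Proof. intros H (phi & Hu & Ha). apply (rigidity_contradiction e H phi Hu Ha). Qed.

(** * Rationality of cycles and multipliers, and assembly of the theorem *)

Lemma isQ_RtoC x : RQ x -> isQ (RtoC x).
Proof. intros [q ->]. exists q. reflexivity. Qed.

Lemma itinerary_of_orbit e n z : adm e ->
  (forall k, (k < n)%nat -> domain e (Nat.iter k (fC e) z)) ->
  exists s, forall k, (k < n)%nat -> Cmod (Nat.iter k (fC e) z) <= 1 /\ side (s k) (Nat.iter k (fC e) z).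
Proof.
  intros H Hk.
  assert (HE : forall k, exists s, (k < n)%nat -> side s (Nat.iter k (fC e) z)).
  { intros k. destruct (le_lt_dec n k); [exists true; lia|].
    destruct (domain_side e _ H (Hk k l)) as [s Hs]. exists s. auto. }
  apply choice in HE. destruct HE as [s Hs]. exists s. intros k Hkn. split; auto.
  apply Rlt_le, (Hk k Hkn).
Qed.

Lemma iter_fr_domain e n x : adm e -> (1 <= n)%nat -> Nat.iter n (fr e) x = x ->
  forall k, domain e (Nat.iter k (fC e) (RtoC x)).
Proof.
  intros H Hn Hx k. pose proof (periodic_bounded e n x H Hn Hx) as Hb.
  rewrite iter_real. split; unfold unit_disk; rewrite ?fC_real, Cmod_R; [apply Hb|apply (Hb (S k))].
Qed.

(** The rational cycle built for the itinerary of [x] has that same itinerary, so by uniqueness it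
    is the cycle of [x]. *)
Lemma periodic_rational e n x : adm e -> (forall n s, (1 <= n)%nat -> exists L, rational_orbit e L n s) ->
  (1 <= n)%nat -> Nat.iter n (fr e) x = x -> forall k, (k < n)%nat -> RQ (Nat.iter k (fr e) x).
Proof.
  intros H HR Hn Hx.
  destruct (itinerary_of_orbit e n (RtoC x) H (fun k _ => iter_fr_domain e n x H Hn Hx k)) as [s Hs].
  destruct (HR n s Hn) as (L & y & Hy & Hyk).
  assert (E : RtoC y = RtoC x).
  { apply (itinerary_unique e n _ _ s H Hn); auto.
    - rewrite iter_real, Hy. reflexivity.
    - rewrite iter_real, Hx. reflexivity.
    - intros k Hk. rewrite iter_real. destruct (Hyk k Hk) as (_ & _ & Y3 & Y4).
      pose proof (iter_fr_domain e n y H Hn Hy k) as HD. rewrite iter_real in HD.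
      destruct HD as [HD1 HD2]. unfold unit_disk in *.
      split; [lra|]. pose proof (proj2 (fC_region e _ H (Rlt_le _ _ HD1) (Rlt_le _ _ HD2))) as HS.
      rewrite re_RtoC in HS. revert HS Y4. unfold Rabs. destruct (s k), (Rcase_abs _); simpl; lra. }
  apply RtoC_inj in E. subst y. intros k Hk. apply Hyk, Hk.
Qed.

Lemma real_periodic_pt e z : periodic_pt real_line (fC e) z ->
  exists x n, z = RtoC x /\ (1 <= n)%nat /\ Nat.iter n (fr e) x = x.
Proof.
  intros (n & Hn & Hz & Hk). pose proof (Hk O ltac:(lia)) as H0. simpl in H0.
  apply Im_0_real in H0. rewrite H0 in Hz. exists (Re z), n. split; [exact H0|]. split; [exact Hn|].
  apply RtoC_inj. rewrite <- iter_real. exact Hz.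
Qed.

Lemma is_derive_iter e n x : adm e ->
  isdC (Nat.iter n (fC e)) (RtoC x)
    (RtoC (fold_right Rmult 1 (map (fun k => dfr e (Nat.iter k (fr e) x)) (seq 0 n)))).
Proof.
  intros H. induction n.
  - apply (is_derive_ext (fun u => 1 * u + 0)%C). { intros t. simpl. ring. } apply isdC_affine.
  - rewrite seq_S, map_app. simpl.
    assert (HF : forall (l : list R) a, fold_right Rmult 1 (l ++ a :: nil) = a * fold_right Rmult 1 l).
    { induction l; intros; simpl; [ring|]. rewrite IHl. ring. }
    rewrite HF, RtoC_mult.
    apply (isdC_comp (fC e) (Nat.iter n (fC e))); [|exact IHn].
    rewrite iter_real. apply (fC_derive_real e _ _ (adm_coefb e H)).
Qed.

Lemma RQ_prod (g : nat -> R) l : (forall k, In k l -> RQ (g k)) -> RQ (fold_right Rmult 1 (map g l)).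
Proof.
  induction l; intros H; simpl; [apply (RQ_IZR 1)|]. apply RQ_mult; [apply H; left; auto|apply IHl; intros; apply H; right; auto].
Qed.

Theorem theorem1p7 :
  exists f : C -> C,
    real_map f /\ even_map f /\ transcendental_entire f /\
    (* (1) *) convex_on_R (restrR f) /\
    (* (2) *) (forall q : Q, isQ (f (RtoC (Q2R q)))) /\
    (* (3) *) (forall z : C, periodic_pt (preimage_disk_domain f) f z <->
                             periodic_pt real_line f z) /\
              (forall z : C, periodic_pt real_line f z -> isQ z) /\
              (forall z m : C, periodic_pt real_line f z -> multiplier f z m -> isQ m) /\
    (* (4) *) escaping_quadratic_like (preimage_disk_domain f) unit_disk f /\
              ~ conj_to_affine_eql (preimage_disk_domain f) unit_disk f.
Proof.
  destruct arithmetic_series as (e & He & HQ & HO).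
  exists (fC e). split; [|split; [|split; [|split; [|split; [|split; [|split; [|split; [|split]]]]]]]].
  - intros z. apply fC_conj.
  - intros z. apply fC_even.
  - apply fC_transcendental, He.
  - intros x y t Ht. unfold restrR. rewrite !fC_real, !re_RtoC. apply fr_convex; auto.
  - intros q. rewrite fC_real. apply isQ_RtoC. assert (Hq : RQ (Q2R q)) by (exists q; reflexivity).
    apply RQ_hr; [apply RQ_mult; auto|apply (HQ _ Hq)].
  - intros z. split.
    + intros (n & Hn & Hz & Hk). exists n. split; [exact Hn|]. split; [exact Hz|].
      destruct (itinerary_of_orbit e n z He Hk) as [s Hs].
      assert (Hr : Im z = 0) by apply (periodic_real e n z s He Hn Hz Hs).
      intros k _. unfold real_line. rewrite (Im_0_real z Hr), iter_real. apply im_RtoC.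
    + intros Hz. destruct (real_periodic_pt e z Hz) as (x & n & -> & Hn & Hx).
      exists n. split; [exact Hn|]. split; [rewrite iter_real, Hx; reflexivity|].
      intros k _. apply (iter_fr_domain e n x He Hn Hx).
  - intros z Hz. destruct (real_periodic_pt e z Hz) as (x & n & -> & Hn & Hx).
    apply isQ_RtoC. apply (periodic_rational e n x He HO Hn Hx 0%nat). lia.
  (* The iterate being differentiated is that of the exact period [n]; [Hz] only serves to know that
     [z] is real. *)
  - intros z m Hz (n & (Hn & Hzn & _) & Hm).
    destruct (real_periodic_pt e z Hz) as (x & _ & -> & _ & _).
    assert (Hx : Nat.iter n (fr e) x = x) by (apply RtoC_inj; rewrite <- iter_real; exact Hzn).
    rewrite (isdC_unique _ _ _ _ Hm (is_derive_iter e n x He)).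
    apply isQ_RtoC, RQ_prod. intros k Hk. apply in_seq in Hk.
    pose proof (periodic_rational e n x He HO Hn Hx k ltac:(lia)) as Hr. unfold dfr.
    apply RQ_mult; [apply RQ_mult; [apply (RQ_IZR 2)|exact Hr]|apply RQ_plus; [apply (RQ_IZR 8)|apply (HQ _ Hr)]].
  - apply fC_escaping, He.
  - apply fC_not_affine, He.
Qed.
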